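(* Let $Q = \Delta \cup_f J$ be an unexposed taut one-relator presentation 2-complex, where $\Delta$ is a 2-dimensional disk, $J = J_1 \vee J_2 \vee \dots \vee J_n$ is a wedge of $n$ circles with wedge point (vertex) $v$, and $f : \partial\Delta \to J$ is a taut map. Then $Q$ is finitely unsplittable except in the single case in which $n = 1$, $f^{-1}(\{v\})$ has exactly two elements and $f : \partial\Delta \to J$ is null-homotopic. In this exceptional case, $Q$ is (homeomorphic to) a 2-sphere with a pair of points identified.
   Context: Definitions. Let $\Delta$ be a 2-dimensional disk, $J = J_1 \vee \dots \vee J_n$ a wedge of $n$ circles with wedge point $v$, and $f : \partial\Delta \to J$ a map such that $f^{-1}(\{v\})$ is a finite subset of $\partial\Delta$. The quotient space $\Delta \cup_f J$ (attaching $\Delta$ to $J$ along $\partial \Delta$ via $f$) is called a one-relator presentation 2-complex; $v$ is its vertex. The map $f$, and the complex $\Delta\cup_f J$, are called taut if $f$ maps each component of $\partial\Delta - f^{-1}(\{v\})$ homeomorphically onto $J_i - \{v\}$ for some $i$ with $1 \le i \le n$. A taut one-relator presentation 2-complex is unexposed if for every $i$ with $1\le i\le n$ the set $f^{-1}(J_i - \{v\})$ has at least two components (i.e. there is no $i$ for which $f^{-1}(J_i-\{v\})$ is empty or is a single component of $\partial\Delta - f^{-1}(\{v\})$). A taut one-relator presentation 2-complex is finitely splittable if it is the union of two proper subpolyhedra each of which has a finite first homology group (integer coefficients; subpolyhedra are not required to be connected). Otherwise it is finitely unsplittable. Convention: piecewise linear structures on $\Delta$ and $J$ are chosen so that $f$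 is piecewise linear, and $\Delta\cup_f J$ is regarded as a compact polyhedron with the resulting structure, so that the quotient map $\Delta \to \Delta\cup_f J$ is piecewise linear and $\{v\}$ and each $J_i$ are subpolyhedra. Subpolyhedra are compact. *)

(* Defs.v *)
From HB Require Import structures.
From Stdlib Require Import Relation_Operators.
From mathcomp Require Import freeg.
From mathcomp Require Import all_boot all_order all_algebra generic_quotient.
From mathcomp Require Import all_classical all_reals topology normedtype.
From mathcomp Require Import wedge_sigT.

Set Implicit Arguments.
Unset Strict Implicit.
Unset Printing Implicit Defensive.

Import Order.TTheory GRing.Theory Num.Theory.
Import numFieldNormedType.Exports.
Local Open Scope classical_set_scope.
Local Open Scope ring_scope.
Local Open Scope quotient_scope.
Local Open Scope card_scope.

(* A set [A : set X] used as a type denotes [set_type A], which carries the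
   topology induced from [X]. *)

Section Homeomorphisms.
Context {X Y : topologicalType}.

Definition homeomorphic : Prop :=
  exists (f : X -> Y) (g : Y -> X),
    [/\ continuous f, continuous g, cancel f g & cancel g f].

Definition homeo_onto (A : set X) (B : set Y) (f : X -> Y) : Prop :=
  [/\ set_bij A B f, {within A, continuous f} &
      exists g : Y -> X,
        {within B, continuous g} /\ (forall x, A x -> g (f x) = x)].

End Homeomorphisms.
Arguments homeomorphic : clear implicits.

Section QuotientSpaces.
Context {X : topologicalType} (r : X -> X -> Prop).

Let gen_rel (x y : X) := `[< clos_refl_sym_trans X r x y >].

Local Lemma gen_rel_refl : reflexive gen_rel.
Proof. by move=> x; apply/asboolP; exact: rst_refl. Qed.

Local Lemma gen_rel_sym : symmetric gen_rel.
Proof.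
by move=> x y; apply/asboolP/asboolP => ?; exact: rst_sym.
Qed.

Local Lemma gen_rel_trans : transitive gen_rel.
Proof.
by move=> y x z /asboolP xy /asboolP yz; apply/asboolP; exact: rst_trans yz.
Qed.

Definition gen_equiv := EquivRel _ gen_rel_refl gen_rel_sym gen_rel_trans.

(* The quotient of [X] by the smallest equivalence relation containing [r]. *)
Definition quotient_space := {eq_quot gen_equiv}.

HB.instance Definition _ :=
  Topological.copy quotient_space (quotient_topology quotient_space).
HB.instance Definition _ := Quotient.on quotient_space.

Definition quotient_proj : X -> quotient_space := \pi_quotient_space.

End QuotientSpaces.

(* The attaching space [X \cup_f Y] for [f : A -> Y], where [i : A -> X] is the
   inclusion of the subspace along which [X] is attached: in the disjoint union
   [{b & summand b}], [i a] is identified with [f a] for every [a]. *)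
Section Adjunction.
Context {A X Y : topologicalType} (i : A -> X) (f : A -> Y).

Definition summand (b : bool) : topologicalType := if b then Y else X.

Definition attach_step (s t : {b & summand b}) : Prop :=
  exists a : A, s = existT summand false (i a) /\ t = existT summand true (f a).

Definition adjunction : topologicalType := quotient_space attach_step.

Definition adj_inl (x : X) : adjunction :=
  quotient_proj attach_step (existT summand false x).
Definition adj_inr (y : Y) : adjunction :=
  quotient_proj attach_step (existT summand true y).

End Adjunction.

Section Models.
Variable R : realType.

Definition std_simplex n : set 'rV[R]_n.+1 :=
  [set t | (forall j, 0 <= t 0 j) /\ \sum_j t 0 j = 1].

Definition sphere k : set 'rV[R]_k.+1 := [set x | \sum_j x 0 j ^+ 2 = 1].

Arguments std_simplex : clear implicits.
Arguments sphere : clear implicits.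
Definition disk : set 'rV[R]_2 := [set x | \sum_j x 0 j ^+ 2 <= 1].

Lemma sphere_sub_disk : sphere 1 `<=` disk.
Proof. by rewrite /sphere /disk => x /= x1; rewrite x1. Qed.

Definition bdry_incl (x : sphere 1) : disk :=
  exist _ (set_val x) (mem_set (sphere_sub_disk (set_valP x))).

End Models.

Arguments std_simplex : clear implicits.
Arguments sphere : clear implicits.
Arguments disk : clear implicits.
Arguments bdry_incl : clear implicits.

Notation circle R := (set_type (sphere R 1)).

Section SingularHomology.
Variable R : realType.

Section Faces.
Context {n : nat} (i : 'I_n.+2).

Definition face_row (t : 'rV[R]_n.+1) : 'rV[R]_n.+2 :=
  \row_j (if unlift i j is Some k then t 0 k else 0).

Lemma face_row_simplex t :
  std_simplex R n t -> std_simplex R n.+1 (face_row t).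
Proof.
move=> [t0 t1]; split=> [j|].
  by rewrite mxE; case: unliftP => [k _|_].
rewrite (bigD1_ord i) //= mxE unlift_none add0r -[RHS]t1.
by apply: eq_bigr => k _; rewrite mxE liftK.
Qed.

Lemma face_row_continuous : continuous face_row.
Proof.
move=> t A [P Pt PA].
exists (fun a k => P a (lift i k)).
  by move=> a k; have := Pt a (lift i k); rewrite mxE liftK ord1.
move=> u Pu; apply: PA => a j; rewrite mxE.
case: unliftP => [k ->|ji]; first by rewrite -(ord1 a); exact: Pu.
by apply: nbhs_singleton; have := Pt a j; rewrite mxE ji unlift_none.
Qed.

Definition face (t : std_simplex R n) : std_simplex R n.+1 :=
  exist _ (face_row (set_val t)) (mem_set (face_row_simplex (set_valP t))).

Lemma face_continuous : continuous face.
Proof.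
apply: continuous_comp_initial => t.
have -> : set_val \o face = face_row \o set_val :> (std_simplex R n -> _) by [].
apply: continuous_comp; first exact: initial_continuous.
exact: face_row_continuous.
Qed.

HB.instance Definition _ := isContinuous.Build _ _ face face_continuous.

End Faces.

Variable X : topologicalType.

Definition sing_simplex n := continuousType (std_simplex R n) X.

Definition sing_chain n := {freeg (sing_simplex n) / int}.

Definition sing_face n (i : 'I_n.+2) (s : sing_simplex n.+1) : sing_simplex n :=
  s \o face i.

Definition sing_boundary n : sing_chain n.+1 -> sing_chain n :=
  fglift (fun s => \sum_(i < n.+2) (-1) ^+ i *: << sing_face i s >>).

Definition cycles n : set (sing_chain n.+1) :=
  [set z | sing_boundary z = 0].

Definition boundaries n : set (sing_chain n.+1) := range (@sing_boundary n.+1).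

(* The quotient group Z_1 / B_1, as the set of cosets of B_1 in Z_1. *)
Definition H1 : set (set (sing_chain 1)) :=
  [set [set w | boundaries (w - z)] | z in @cycles 0].

End SingularHomology.

Arguments H1 : clear implicits.

Section Polyhedra.
Variable R : realType.

Definition convex_hull m (s : seq 'rV[R]_m) : set 'rV[R]_m :=
  [set \sum_(i < size s) a i *: s`_i | a in
     [set a : 'I_(size s) -> R | (forall i, 0 <= a i) /\ \sum_i a i = 1]].

(* Compact polyhedra only: finite unions of convex hulls of finite sets. *)
Definition polyhedron m (P : set 'rV[R]_m) : Prop :=
  exists ss : seq (seq 'rV[R]_m), P = \bigcup_(s in [set` ss]) convex_hull s.

(* A PL structure making [X] a compact polyhedron, given by a homeomorphism onto
   a compact polyhedron of some Euclidean space. *)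
Record pl_structure (X : topologicalType) := PLStructure {
  pl_dim : nat;
  pl_chart :> X -> 'rV[R]_pl_dim;
  pl_chart_homeo : homeo_onto setT (range pl_chart) pl_chart;
  pl_chart_polyhedron : polyhedron (range pl_chart)
}.

Definition subpolyhedron X (S : pl_structure X) (A : set X) : Prop :=
  polyhedron (S @` A).

(* A map between compact polyhedra is PL when its graph is a polyhedron.  The
   domain of [g] is a subspace of [X], with inclusion [i : A -> X]. *)
Definition pl_on (A X Y : topologicalType) (i : A -> X) (SX : pl_structure X)
    (SY : pl_structure Y) (g : A -> Y) : Prop :=
  polyhedron (range (fun a => row_mx (SX (i a)) (SY (g a)))).

Definition pl_map (X Y : topologicalType) (SX : pl_structure X)
    (SY : pl_structure Y) (g : X -> Y) : Prop :=
  pl_on id SX SY g.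

Definition finitely_splittable X (S : pl_structure X) : Prop :=
  exists A B : set X,
    [/\ [/\ subpolyhedron S A, A <> setT & finite_set (H1 R A)],
        [/\ subpolyhedron S B, B <> setT & finite_set (H1 R B)] &
        A `|` B = setT].

Definition finitely_unsplittable X (S : pl_structure X) : Prop :=
  ~ finitely_splittable S.

End Polyhedra.

Section OneRelator.
Variables (R : realType) (n : nat).

(* The wedge of [n.+1] circles, the [i]-th one being attached at [p i]. *)
Variable p : 'I_n.+1 -> circle R.

Definition bouquet : topologicalType := wedge p.

Definition vertex : bouquet := wedge_lift p (i := ord0) (p ord0).

Definition petal (i : 'I_n.+1) : set bouquet := range (wedge_lift p (i := i)).

Definition open_petal i : set bouquet := petal i `\ vertex.

Variable f : circle R -> bouquet.

Definition attaching_map : Prop :=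
  continuous f /\ finite_set (f @^-1` [set vertex]).

Definition taut : Prop :=
  forall x, f x <> vertex -> exists i,
    homeo_onto (connected_component (~` (f @^-1` [set vertex])) x)
      (open_petal i) f.

Definition unexposed : Prop :=
  forall i, exists x y,
    [/\ (f @^-1` open_petal i) x, (f @^-1` open_petal i) y &
        connected_component (f @^-1` open_petal i) x <>
        connected_component (f @^-1` open_petal i) y].

Definition null_homotopic : Prop :=
  exists (c : bouquet) (H : R * circle R -> bouquet),
    [/\ {within `[0, 1] `*` setT, continuous H},
        forall x, H (0, x) = f x & forall x, H (1, x) = c].

Definition one_relator_complex : topologicalType :=
  adjunction (bdry_incl R) f.

Definition disk_to_complex : disk R -> one_relator_complex :=
  adj_inl (bdry_incl R) f.

Definition bouquet_to_complex : bouquet -> one_relator_complex :=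
  adj_inr (bdry_incl R) f.

Definition pl_compatible (SD : pl_structure R (disk R))
    (SJ : pl_structure R bouquet) (SQ : pl_structure R one_relator_complex) :=
  [/\ pl_on (bdry_incl R) SD SJ f,
      pl_map SD SQ disk_to_complex,
      pl_map SJ SQ bouquet_to_complex,
      subpolyhedron SQ [set bouquet_to_complex vertex] &
      forall i, subpolyhedron SQ (bouquet_to_complex @` petal i)].

Definition exceptional : Prop :=
  [/\ n.+1 = 1%N, f @^-1` [set vertex] #= `I_2 & null_homotopic].

End OneRelator.

Definition pair_identified (X : topologicalType) (a b : X) : topologicalType :=
  quotient_space (fun x y : X => x = a /\ y = b).

(* Main.v *)
(* Let A, B be proper subpolyhedra with finite H_1 covering Q.  A circle-valued
   function on a polyhedron with finite H_1 lifts to the reals, which gives two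
   facts.  First, neither A nor B contains a petal: otherwise the boundary
   retraction of the disk punctured outside A would give a circle-valued function
   of degree one on the petal that lifts.  Hence each petal, and the boundary of
   the disk, is cut into at least two pieces lying alternately in A and in B.
   Second, for two points p, q of the boundary circle whose images are not in A,
   the chord from p to q cuts the preimage of A in the disk, and its indicator
   function on the boundary is x + y with x integer-valued and locally constant on
   the preimage of A in the disk, y integer-valued and locally constant on the
   preimage in the bouquet.

   If the boundary circle has s pieces of each colour, the chords between
   consecutive pieces give s - 1 such pairs for A and for B.  By unicoherence of
   the disk the "disk parts" x of the two colours are orthogonal for a cyclic
   pairing, while the sums x + y pair non-degenerately; so s - 1 is at most the
   sum of the ranks of the "bouquet parts" y.  These ranks are bounded by the
   number of pieces of the petals, the pieces at the vertex counting only once for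
   each colour.  Since every petal is covered at least twice by the boundary, the
   comparison leaves a single petal, traversed exactly twice, and in opposite
   directions.

   In that case Q is the sphere with two points N, S identified: the disk is
   folded along its vertical chords, each chord being wrapped around a circle of
   latitude.  A small star-shaped neighbourhood of the vertex in the sheet through
   S and the closure of its complement, a retract of the sphere punctured at S,
   then form a splitting. *)
Require Import Defs.
From HB Require Import structures.
From Stdlib Require Import Relation_Operators.
From mathcomp Require Import freeg.
From mathcomp Require Import all_boot all_order all_algebra generic_quotient.
From mathcomp Require Import all_classical all_reals topology normedtype.
From mathcomp Require Import derive realfun trigo numfun wedge_sigT.
From mathcomp Require Import ring lra zify.

Set Implicit Arguments.
Unset Strict Implicit.
Unset Printing Implicit Defensive.

Import Order.TTheory GRing.Theory Num.Theory.
Import numFieldNormedType.Exports.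
Local Open Scope classical_set_scope.
Local Open Scope card_scope.
Local Open Scope ring_scope.

(** * Circle-valued functions and lifting *)

(** A circle-valued function is represented by real values known modulo Z. It lifts over a piece
    with finite first homology because its integral over 1-cycles is a homomorphism from a finite
    group to the reals, hence 0. No cell structure is chosen: a polyhedron is a finite union of
    convex hulls, and continuity, colours and neighbourhoods are read off these hulls. The counting
    works only because it is exact. In each sum x + y a constant can be moved from y to x; this
    lowers the rank bound by one for each colour and compensates the vertex class of that colour.
    Without it the inequality would leave up to three petals. *)

Section RoundedFraction.
Variable R : realType.
Implicit Types u v : R.

(** The representative of [u] modulo Z in [-1/2, 1/2), so that [|zfr u|] is the distance from [u] to
    the integers, the norm of R/Z. *)
Definition zfr u : R := u - (Num.floor (u + 2^-1))%:~R.

Lemma zfr_int u : u - zfr u \is a Num.int.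
Proof. by rewrite /zfr opprB addrC subrK; apply: intr_int. Qed.

Lemma zfr_int' u : zfr u - u \is a Num.int.
Proof. by rewrite -opprB rpredN; exact: zfr_int. Qed.

Lemma zfr_le u : `|zfr u| <= 2^-1.
Proof.
rewrite /zfr ler_norml; have /andP[] := floor_itv (u + 2^-1).
by rewrite intrD; set k : R := (Num.floor _)%:~R; move=> h1 h2; apply/andP; split; lra.
Qed.

Lemma int_small u : u \is a Num.int -> `|u| < 1 -> u = 0.
Proof.
move=> /intrP[k ->]; rewrite -intr_norm -[1]/(1%:~R) ltr_int => k1.
by have -> : k = 0 by lia.
Qed.

Lemma zfr_eq u v : u - v \is a Num.int -> `|v| < 2^-1 -> zfr u = v.
Proof.
move=> uv hv; apply/eqP; rewrite -subr_eq0; apply/eqP/int_small.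
  by rewrite -(subrK u (zfr u)) -addrA rpredD ?zfr_int'.
apply: le_lt_trans (ler_normB _ _) _.
by have := zfr_le u; lra.
Qed.

Lemma zfrD u v : `|zfr u| + `|zfr v| < 2^-1 -> zfr (u + v) = zfr u + zfr v.
Proof.
move=> h; apply: zfr_eq; last exact: le_lt_trans (ler_normD _ _) _.
by rewrite opprD addrACA rpredD ?zfr_int.
Qed.

Lemma zfr_int0 u : u \is a Num.int -> zfr u = 0.
Proof. by move=> uZ; apply: zfr_eq; rewrite ?subr0 // normr0 invr_gt0. Qed.

Lemma zfr_min u v : u - v \is a Num.int -> `|zfr u| <= `|v|.
Proof.
move=> uv; have [hv|hv] := ltP `|v| 2^-1; first by rewrite (zfr_eq uv hv).
exact: le_trans (zfr_le u) hv.
Qed.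

Lemma zfr_norm u : `|zfr u| <= `|u|.
Proof. by apply: zfr_min; rewrite subrr. Qed.

Lemma zfr_congr u v : u - v \is a Num.int -> `|zfr u| = `|zfr v|.
Proof.
move=> uv; apply/eqP; rewrite eq_le; apply/andP; split; apply: zfr_min.
  by rewrite -(subrK v u) -addrA rpredD ?zfr_int.
by rewrite -(subrK u v) -addrA rpredD ?zfr_int // -opprB rpredN.
Qed.

Lemma zfrN u : `|zfr (- u)| = `|zfr u|.
Proof.
apply/eqP; rewrite eq_le; apply/andP; split.
  rewrite -[X in _ <= X]normrN; apply: zfr_min.
  by rewrite opprK addrC zfr_int'.
rewrite -[X in _ <= X]normrN; apply: zfr_min.
by rewrite opprK -{1}(opprK u) addrC zfr_int'.
Qed.

Lemma zfr_triangle u v : `|zfr (u + v)| <= `|zfr u| + `|zfr v|.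
Proof.
apply: le_trans (ler_normD _ _); apply: zfr_min.
by rewrite opprD addrACA rpredD ?zfr_int.
Qed.

End RoundedFraction.

Section Continuity.

Lemma contI (S T : topologicalType) (f : S -> T) :
  (forall x, {for x, continuous f}) -> continuous f.
Proof. by []. Qed.

Lemma contId (S : topologicalType) (x : S) : {for x, continuous (fun y : S => y)}.
Proof. exact: cvg_id. Qed.

Lemma cont_pair (S T U : topologicalType) (f : S -> T) (g : S -> U) :
  continuous f -> continuous g -> continuous (fun x => (f x, g x)).
Proof. by move=> cf cg x; apply: cvg_pair; [exact: cf|exact: cg]. Qed.

Lemma cont_pair_for (S T U : topologicalType) (f : S -> T) (g : S -> U) x :
  {for x, continuous f} -> {for x, continuous g} ->
  {for x, continuous (fun x => (f x, g x))}.
Proof. by move=> cf cg; exact: (cvg_pair cf cg). Qed.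

Lemma closed_pre (S T : topologicalType) (f : S -> T) (D : set T) :
  continuous f -> closed D -> closed (f @^-1` D).
Proof. by move=> cf cD; apply: closed_comp => // x _; exact: cf. Qed.

Lemma open_pre (S T : topologicalType) (f : S -> T) (D : set T) :
  continuous f -> open D -> open (f @^-1` D).
Proof. by move=> cf cD; apply: open_comp => // x _; exact: cf. Qed.

Lemma cont_comp_for (S T U : topologicalType) (f : S -> T) (g : T -> U) x :
  {for x, continuous f} -> {for f x, continuous g} ->
  {for x, continuous (fun x => g (f x))}.
Proof. by move=> cf cg; apply: (@continuous_comp _ _ _ f g). Qed.

Lemma cont_comp (S T U : topologicalType) (f : S -> T) (g : T -> U) :
  continuous f -> continuous g -> continuous (fun x => g (f x)).
Proof. by move=> cf cg x; apply: (@continuous_comp _ _ _ f g); [exact: cf|exact: cg]. Qed.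

Lemma near_forall (T : topologicalType) (I : finType) (P : I -> T -> Prop) (x : T) :
  (forall i, \forall y \near x, P i y) -> \forall y \near x, forall i, P i y.
Proof. exact: filter_forall. Qed.

Lemma near_andb (T : topologicalType) (P Q : T -> Prop) (x : T) :
  (\forall y \near x, P y) -> (\forall y \near x, Q y) -> \forall y \near x, P y /\ Q y.
Proof. by move=> h1 h2; apply: filterS2 h1 h2. Qed.

Lemma near_imp (T : topologicalType) (P Q : T -> Prop) (x : T) :
  (forall y, P y -> Q y) -> (\forall y \near x, P y) -> \forall y \near x, Q y.
Proof. by move=> PQ; apply: filterS. Qed.

Lemma within_near (S T : topologicalType) (W : set S) (f : S -> T) :
  {within W, continuous f} <->
  forall x, W x -> forall B, nbhs (f x) B -> \forall y \near x, W y -> B (f y).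
Proof.
split=> [/subspace_continuousP cf x Wx B fB|h]; first exact: (cf x Wx B fB).
by apply/subspace_continuousP => x Wx B fB; exact: h.
Qed.

End Continuity.

Section ContinuousOperations.
Context {R : realType} {T : topologicalType} {V : normedModType R}.
Implicit Types (a b : T -> R) (f g : T -> V).

Lemma contD f g x : {for x, continuous f} -> {for x, continuous g} ->
  {for x, continuous (fun y => f y + g y)}.
Proof. by move=> cf cg; apply: cvgD. Qed.

Lemma contN f x : {for x, continuous f} -> {for x, continuous (fun y => - f y)}.
Proof. by move=> cf; apply: cvgN. Qed.

Lemma contZ a f x : {for x, continuous a} -> {for x, continuous f} ->
  {for x, continuous (fun y => a y *: f y)}.
Proof. by move=> ca cf; apply: cvgZ. Qed.

Lemma contM a b x : {for x, continuous a} -> {for x, continuous b} ->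
  {for x, continuous (fun y => a y * b y)}.
Proof. by move=> ca cb; apply: cvgM. Qed.

Lemma contV a x : a x != 0 -> {for x, continuous a} ->
  {for x, continuous (fun y => (a y)^-1)}.
Proof. by move=> ax ca; apply: cvgV. Qed.

Lemma cont_norm f x : {for x, continuous f} -> {for x, continuous (fun y => `|f y|)}.
Proof. by move=> cf; apply: cvg_norm. Qed.

Lemma cont_eps f x :
  {for x, continuous f} <-> forall e : R, 0 < e -> \forall y \near x, `|f x - f y| < e.
Proof. by split=> [cf e e0|h]; [have /cvgrPdist_lt := cf; exact|apply/cvgrPdist_lt => e; exact: h]. Qed.

Lemma contC (U : topologicalType) (c : U) (x : T) : {for x, continuous (fun _ : T => c)}.
Proof. exact: cvg_cst. Qed.

Lemma cont_sum (I : Type) (r : seq I) (P : pred I) (F : I -> T -> V) x :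
  (forall i, P i -> {for x, continuous (F i)}) ->
  {for x, continuous (fun y => \sum_(i <- r | P i) F i y)}.
Proof.
move=> cF; elim: r => [|i r IH].
  by rewrite (_ : (fun _ => _) = fun _ => 0); [exact: contC|apply/funext => y; rewrite big_nil].
have [Pi|Pi] := boolP (P i); last first.
  rewrite (_ : (fun _ => _) = fun y => \sum_(i <- r | P i) F i y); first exact: IH.
  by apply/funext => y; rewrite big_cons (negbTE Pi).
rewrite (_ : (fun _ => _) = fun y => F i y + \sum_(i <- r | P i) F i y).
  by apply: contD => //; exact: cF.
by apply/funext => y; rewrite big_cons Pi.
Qed.

End ContinuousOperations.

Ltac cont_step :=
  lazymatch goal with
  | |- @prop_for _ _ (fun x => @continuous_at _ _ x ?f) _ =>
    first [ assumption
    | lazymatch f with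
      | (fun y => @Algebra.add _ (@?a y) (@?b y)) => apply: contD
      | (fun y => @Algebra.opp _ (@?a y)) => apply: contN
      | (fun y => @GRing.mul _ (@?a y) (@?b y)) => apply: contM
      | (fun y => @GRing.scale _ _ (@?a y) (@?b y)) => apply: contZ
      | (fun y => @Num.norm _ _ (@?a y)) => apply: cont_norm
      | @Num.norm _ _ => apply: (@cont_norm _ _ _ (fun y => y))
      | @Algebra.opp _ => apply: (@contN _ _ _ (fun y => y))
      | @Algebra.add _ ?a => apply: (@contD _ _ _ (fun=> a) (fun y => y))
      | @GRing.mul _ ?a => apply: (@contM _ _ (fun=> a) (fun y => y))
      | @GRing.scale _ _ ?a => apply: (@contZ _ _ _ (fun=> a) (fun y => y))
      | _ => first [exact: contId | exact: contC]
      end ]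
  end.
Ltac cont_tac := repeat cont_step.


Section ModularContinuity.
Variable R : realType.

(* Continuity modulo [Z]: a function to the circle [R/Z], given by arbitrary
   real representatives of its values. *)
Definition zcont (T : topologicalType) (W : set T) (phi : T -> R) : Prop :=
  forall x, W x -> forall e : R, 0 < e ->
    \forall y \near x, W y -> `|zfr (phi y - phi x)| < e.

Lemma zcont_comp (S T : topologicalType) (V : set S) (W : set T) (g : S -> T) phi :
  {within V, continuous g} -> (forall x, V x -> W (g x)) ->
  zcont W phi -> zcont V (phi \o g).
Proof.
move=> cg VW zphi x Vx e e0.
have := (within_near _ _).1 cg x Vx _ (zphi _ (VW _ Vx) _ e0).
by apply: filterS => y hy Vy; apply: hy => //; exact: VW.
Qed.

Lemma zcontT_comp (S T : topologicalType) (g : S -> T) phi :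
  continuous g -> zcont setT phi -> zcont setT (phi \o g).
Proof. by move=> cg; apply: zcont_comp => //; exact: continuous_subspaceT. Qed.

Lemma zcont_cont (T : topologicalType) (W : set T) (phi : T -> R) :
  {within W, continuous phi} -> zcont W phi.
Proof.
move=> cphi x Wx e e0.
have := (within_near _ _).1 cphi x Wx _ (nbhsx_ballx _ _ e0).
apply: filterS => y hy Wy; apply: le_lt_trans (zfr_norm _) _.
by rewrite distrC; exact: hy.
Qed.

(** [zfr] jumps only at half-integers. Differences below 1/4 stay away from them, so rounding is
    compatible with small changes of both functions. *)
Lemma zfr_diff_cont (T : topologicalType) (phi psi : T -> R) :
  zcont setT phi -> zcont setT psi ->
  (forall x, `|zfr (phi x - psi x)| < 4^-1) ->
  continuous (fun x => zfr (phi x - psi x)).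
Proof.
move=> zphi zpsi small x; apply/cvgrPdist_lt => e e0.
pose d := Num.min (e / 2) (8^-1).
have d0 : 0 < d by rewrite lt_min; apply/andP; split; lra.
have dl : d <= e / 2 by rewrite ge_min lexx.
have d8 : d <= 8^-1 by rewrite ge_min lexx orbT.
near=> y.
have h1 : `|zfr (phi y - phi x)| < d.
  by near: y; apply: filterS (zphi x I _ d0) => y; apply.
have h2 : `|zfr (psi y - psi x)| < d.
  by near: y; apply: filterS (zpsi x I _ d0) => y; apply.
have h3 : `|zfr ((phi y - phi x) + (psi x - psi y))| < e /\
          `|zfr ((phi y - phi x) + (psi x - psi y))| < 4^-1.
  have := zfr_triangle (phi y - phi x) (psi x - psi y).
  by rewrite -(zfrN (psi x - psi y)) opprB; split; lra.
have := zfrD (u := phi x - psi x) (v := (phi y - phi x) + (psi x - psi y)).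
have -> : phi x - psi x + (phi y - phi x + (psi x - psi y)) = phi y - psi y by ring.
move=> ->; last by have := small x; lra.
by rewrite opprD addrA subrr sub0r normrN; case: h3.
Unshelve. all: by end_near. Qed.

End ModularContinuity.

Section Contractible.
Variable R : realType.

Definition contractible (T : topologicalType) : Prop :=
  exists (c : T) (H : (R * T)%type -> T),
    [/\ continuous H, forall x, H (0, x) = c & forall x, H (1, x) = x].

Lemma contractible_retract (T U : topologicalType) (i : U -> T) (r : T -> U) :
  continuous i -> continuous r -> cancel i r -> contractible T -> contractible U.
Proof.
move=> ci cr ir [c [H [cH H0 H1]]].
exists (r c), (fun tx => r (H (tx.1, i tx.2))); split => [|x|x] /=.
- apply: (cont_comp _ cr); apply: (cont_comp _ cH).
  apply: cont_pair; first by move=> ?; exact: cvg_fst.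
  by apply: (cont_comp _ ci) => ?; exact: cvg_snd.
- by rewrite H0.
- by rewrite H1 ir.
Qed.

Lemma int_valued_const (u : R -> R) a b : a <= b ->
  {within `[a, b], continuous u} ->
  (forall t, t \in `[a, b] -> u t \is a Num.int) -> u a = u b.
Proof.
move=> ab cu uZ; apply: contrapT => uab.
have [k1 k1E] : exists k1 : int, u a = k1%:~R by apply/intrP/uZ; rewrite in_itv /= lexx.
have [k2 k2E] : exists k2 : int, u b = k2%:~R by apply/intrP/uZ; rewrite in_itv /= ab lexx.
(* Two distinct integers have this half-integer between them, and the intermediate value theorem
   would make it a value of [u]. *)
pose v : R := Num.min (u a) (u b) + 2^-1.
have vin : Num.min (u a) (u b) <= v <= Num.max (u a) (u b).
  apply/andP; split; first by rewrite /v; lra.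
  rewrite /v k1E k2E /Num.min /Num.max !ltr_int; case: ifPn => h.
    have : (k1 + 1 <= k2)%R by lia.
    by rewrite -(ler_int R) intrD; lra.
  have : (k2 + 1 <= k1)%R by move: uab; rewrite k1E k2E => /eqP; rewrite eqr_int; lia.
  by rewrite -(ler_int R) intrD; lra.
have [c cab cE] := IVT ab cu vin.
have /intrP[k3 k3E] := uZ _ cab.
have [k0 k0E] : exists k0 : int, Num.min (u a) (u b) = k0%:~R.
  by rewrite /Num.min; case: ifPn => _; eexists; eauto.
move: cE; rewrite k3E /v k0E => h.
have : (2 * k3 = 2 * k0 + 1)%R.
  by apply/eqP; rewrite -(eqr_int R) intrD !intrM h; apply/eqP; field.
by lia.
Qed.

Lemma contractible_int_const (T : topologicalType) (u : T -> R) :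
  contractible T -> continuous u -> (forall x, u x \is a Num.int) ->
  forall x y, u x = u y.
Proof.
move=> [c [H [cH H0 H1]]] cu uZ.
suff h x : u x = u c by move=> x y; rewrite !h.
rewrite -(H0 x) -{1}(H1 x); apply/esym.
apply: (@int_valued_const (fun t => u (H (t, x)))) => //.
apply: continuous_subspaceT; apply: (cont_comp _ cu); apply: (cont_comp _ cH).
by apply: cont_pair => t; [exact: cvg_id|exact: cvg_cst].
Qed.

(** Path lifting along a contraction. Time is cut into [N] steps on each of which the circle value
    moves by less than 1/4, uniformly in [x] by compactness; the rounded increments are continuous
    in [x], and added to the constant [phi c] they give the lift. *)
Lemma zcont_lift (T : topologicalType) (phi : T -> R) :
  compact [set: T] -> contractible T -> zcont setT phi ->
  exists h : T -> R, continuous h /\ forall x, h x - phi x \is a Num.int.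
Proof.
move=> cT [c [H [cH H0 H1]]] zphi.
have zH : zcont setT (phi \o H) by exact: zcontT_comp.
have cK : compact (`[0, 1]%classic `*` [set: T] : set (R * T)).
  by apply: compact_setX => //; exact: segment_compact.
have : \forall d \near 0^'+, forall tx, (`[0, 1]%classic `*` [set: T]) tx ->
    forall t', `|t' - tx.1| < d -> `|zfr (phi (H (t', tx.2)) - phi (H tx))| < 4^-1.
  have /near_covering_withinP cK' := (compact_near_coveringP _).1 cK.
  apply: cK' => -[t x] _.
  have e8 : (0 : R) < 8^-1 by lra.
  have /= := zH (t, x) I _ e8.
  move=> [[P Q] /= [Pt Qx] PQ].
  move: Pt => /nbhs_ballP[r /= r0 rP].
  exists (ball t (r / 2) `*` Q, [set d | d < r / 2]) => /=.
    split; first by exists (ball t (r / 2), Q) => //; split => //; apply: nbhsx_ballx; lra.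
    by apply: nbhs_right_lt; lra.
  move=> [[t1 x1] d] /= [[t1b Qx1] dr] _ t' t't1.
  have Pt1 : P t1 by apply: rP; move: t1b; rewrite /ball /=; lra.
  have Pt' : P t'.
    apply: rP; move: t1b; rewrite /ball /= => t1b.
    have -> : t - t' = (t - t1) - (t' - t1) by ring.
    by apply: le_lt_trans (ler_normB _ _) _; lra.
  have h1 := PQ (t1, x1) (conj Pt1 Qx1) I.
  have h2 := PQ (t', x1) (conj Pt' Qx1) I.
  rewrite /= in h1 h2.
  have -> : phi (H (t', x1)) - phi (H (t1, x1)) =
     (phi (H (t', x1)) - phi (H (t, x))) + - (phi (H (t1, x1)) - phi (H (t, x))) by ring.
  by apply: le_lt_trans (zfr_triangle _ _) _; rewrite zfrN; lra.
case=> d /= d0 dP.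
pose N := (Num.truncn (d^-1 * 2)).+1.
have NP : (N%:R : R)^-1 < d / 2.
  rewrite invf_plt ?posrE ?divr_gt0 //.
  by rewrite invfM invrK /N truncnS_gt.
have dP2 : forall t x t', t \in `[0, 1] -> `|t' - t| < d / 2 ->
    `|zfr (phi (H (t', x)) - phi (H (t, x)))| < 4^-1.
  move=> t x t' t01 tt'; apply: (dP (d / 2)) (t, x) _ _ _ => //=.
  - by rewrite /ball /= sub0r normrN gtr0_norm; lra.
  - by lra.
pose a j : R := j%:R / N%:R.
have aS j : a j.+1 = a j + N%:R^-1 by rewrite /a -addn1 natrD mulrDl mul1r.
have N0 : 0 < (N%:R : R)^-1 by rewrite invr_gt0.
pose h x := phi c + \sum_(j < N) zfr (phi (H (a j.+1, x)) - phi (H (a j, x))).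
have small j x : (j < N)%N -> `|zfr (phi (H (a j.+1, x)) - phi (H (a j, x)))| < 4^-1.
  move=> jN; apply: dP2; last by rewrite aS addrC addKr gtr0_norm.
  rewrite in_itv /= divr_ge0 //= ler_pdivrMr // mul1r ler_nat; exact: ltnW.
exists h; split.
  apply: (@cont_comp _ _ _ (fun x => \sum_(j < N) zfr (phi (H (a j.+1, x)) - phi (H (a j, x)))) (fun u => phi c + u)); last first.
    by move=> u; apply: cvgD; [exact: cvg_cst|exact: cvg_id].
  move=> x; apply: cont_sum => j _ /=.
  apply: (@zfr_diff_cont _ _ (fun x => phi (H (a j.+1, x))) (fun x => phi (H (a j, x)))) => [||y].
  - apply: (@zcontT_comp _ _ _ (fun x => (a j.+1, x)) _ _ zH).
    by apply: cont_pair => t; [exact: cvg_cst|exact: cvg_id].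
  - apply: (@zcontT_comp _ _ _ (fun x => (a j, x)) _ _ zH).
    by apply: cont_pair => t; [exact: cvg_cst|exact: cvg_id].
  - exact: small.
move=> x; have -> : h x - phi x = \sum_(j < N) (zfr (phi (H (a j.+1, x)) - phi (H (a j, x)))
     - (phi (H (a j.+1, x)) - phi (H (a j, x)))).
  rewrite sumrB /h.
  have -> : \sum_(j < N) (phi (H (a j.+1, x)) - phi (H (a j, x))) = phi x - phi c.
    have := @telescope_sumr R 0 N (fun j => phi (H (a j, x))) isT.
    by rewrite big_mkord => ->; rewrite /a mul0r divff ?H0 ?H1 // pnatr_eq0.
  ring.
by apply: rpred_sum => j _; exact: zfr_int'.
Qed.
End Contractible.

(** * Subspaces, simplices and homology of contractible spaces *)

Section Subtypes.
Context {T : topologicalType}.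

Lemma sub_nbhs (A : set T) (x : A) (U : set A) :
  nbhs x U <-> exists2 W, nbhs (set_val x) W & forall y : A, W (set_val y) -> U y.
Proof.
split=> [|[W Wx WU]].
  move=> [_ [[W oW <-] Wx] WU]; exists W; first exact: open_nbhs_nbhs.
  by move=> y Wy; exact: WU.
by apply: (filterS WU); exact: (initial_continuous (f := set_val) Wx).
Qed.

Definition mk_sub (A : set T) x (Ax : A x) : A := exist _ x (mem_set Ax).

Lemma mk_subE (A : set T) x (Ax : A x) : set_val (mk_sub Ax) = x.
Proof. by []. Qed.

Lemma set_val_continuous (A : set T) : continuous (set_val : A -> T).
Proof. exact: initial_continuous. Qed.

Lemma sub_cont_for (S : topologicalType) (A : set T) (f : S -> A) x :
  {for x, continuous (set_val \o f)} -> {for x, continuous f}.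
Proof.
move=> cf U /sub_nbhs[W Wx WU].
by apply: (@filterS _ (nbhs x) _ _ _ _ (cf _ Wx)) => y; exact: WU.
Qed.

Lemma sub_cont (S : topologicalType) (A : set T) (f : S -> A) :
  continuous (fun x => set_val (f x)) -> continuous f.
Proof. by move=> cf x; apply: sub_cont_for; exact: cf. Qed.

Lemma sub_compact (A : set T) : compact A -> compact [set: A].
Proof.
move=> cA F FF _.
have PF : ProperFilter (set_val @ F) by apply: fmap_proper_filter.
have FA : (set_val @ F) A by apply: (@filterS _ F _ _ _ _ filterT) => x _; exact: set_valP.
have [x [Ax xF]] := cA _ PF FA.
exists (mk_sub Ax); split=> // U B FU /sub_nbhs[W Wx WB].
have FU' : (set_val @ F) (set_val @` U) by apply: (@filterS _ F _ _ _ _ FU) => y Uy; exists y.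
by have [_ [[y Uy <-] Wy]] := xF _ _ FU' Wx; exists y; split=> //; exact: WB.
Qed.

Lemma set_val_inj (A : set T) : injective (set_val : A -> T).
Proof. exact: val_inj. Qed.

Lemma sub_hausdorff (A : set T) : hausdorff_space T -> hausdorff_space A.
Proof.
move=> hT x y xy; apply: set_val_inj; apply: hT => U V xU yV.
have [||z [Uz Vz]] := xy (set_val @^-1` U) (set_val @^-1` V).
- exact: (@set_val_continuous A x).
- exact: (@set_val_continuous A y).
by exists (set_val z).
Qed.

Lemma within_sub (S : topologicalType) (W : set S) (f : S -> T) :
  {within W, continuous f} -> continuous (fun x : W => f (set_val x)).
Proof. by move/subspace_sigL_continuousP. Qed.

Lemma sub_within (S : topologicalType) (W : set S) (f : S -> T) :
  continuous (fun x : W => f (set_val x)) -> {within W, continuous f}.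
Proof. by move=> ?; apply/subspace_sigL_continuousP. Qed.

End Subtypes.

Section Matrices.
Context {R : realType} {m : nat}.

Lemma rV_cont (T : topologicalType) (F : T -> 'rV[R]_m) x :
  (forall j, {for x, continuous (fun t => F t 0 j)}) -> {for x, continuous F}.
Proof.
move=> cF A [P Px PA].
have h : \forall t \near x, forall j, P 0 j (F t 0 j).
  by apply: filter_forall => j; exact: (cF j _ (Px 0 j)).
by apply: filterS h => t ht; apply: PA => i j; rewrite (ord1 i).
Qed.

Lemma coord_cont (j : 'I_m) : continuous (fun t : 'rV[R]_m => t 0 j).
Proof. exact: coord_continuous. Qed.

End Matrices.

Section StarShaped.
Context {R : realType}.

(** The retraction of the line onto [0, 1]. In [contractible] time runs over all of [R], so explicit
    homotopies are clamped; the absolute values make continuity immediate. *)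
Definition clamp01 (t : R) : R := (1 + `|t| - `|1 - t|) / 2.

Lemma clamp01_cont : continuous clamp01.
Proof.
by rewrite /clamp01; apply: contI => t; cont_tac.
Qed.

Lemma clamp01_id t : 0 <= t <= 1 -> clamp01 t = t.
Proof. by move=> /andP[t0 t1]; rewrite /clamp01 !ger0_norm ?subr_ge0 //; lra. Qed.

Lemma clamp01_in t : 0 <= clamp01 t <= 1.
Proof.
rewrite /clamp01; have := ler_norm t; have := ler_norm (- t).
have := ler_norm (1 - t); have := ler_norm (- (1 - t)); rewrite !normrN => h1 h2 h3 h4.
have [t0|t0] := lerP 0 t; have [t1|t1] := lerP 0 (1 - t);
 rewrite ?(ger0_norm t0) ?(ltr0_norm t0) ?(ger0_norm t1) ?(ltr0_norm t1); apply/andP; split; lra.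
Qed.

Lemma starshaped_contractible (V : normedModType R) (K : set V) c : K c ->
  (forall x (t : R), K x -> 0 <= t <= 1 -> K ((1 - t) *: c + t *: x)) ->
  contractible R K.
Proof.
move=> Kc Kstar.
have KH (tx : R * K) : K ((1 - clamp01 tx.1) *: c + clamp01 tx.1 *: set_val tx.2).
  by apply: Kstar; [exact: set_valP|exact: clamp01_in].
exists (mk_sub Kc), (fun tx => mk_sub (KH tx)).
have c0 : clamp01 0 = 0 by apply: clamp01_id; rewrite lexx ler01.
have c1 : clamp01 1 = 1 by apply: clamp01_id; rewrite lexx ler01.
split=> [|x|x]; last 2 first.
- by apply: set_val_inj; rewrite !mk_subE c0 subr0 scale1r scale0r addr0.
- by apply: set_val_inj; rewrite mk_subE c1 subrr scale0r add0r scale1r.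
apply: sub_cont; apply: contI => tx.
have cl : {for tx, continuous (fun tx : R * K => clamp01 tx.1)}.
  by apply: (cont_comp _ clamp01_cont) => ?; exact: cvg_fst.
have cs : {for tx, continuous (fun tx : R * K => set_val tx.2)}.
  by apply: (cont_comp _ (@set_val_continuous _ K)) => ?; exact: cvg_snd.
have -> : (fun x => set_val (mk_sub (KH x))) =
  (fun tx => (1 - clamp01 tx.1) *: c + clamp01 tx.1 *: set_val tx.2) by [].
by cont_tac.
Qed.

Definition convex (V : lmodType R) (K : set V) : Prop :=
  forall x y (t : R), K x -> K y -> 0 <= t <= 1 -> K ((1 - t) *: x + t *: y).

Lemma convex_contractible (V : normedModType R) (K : set V) c :
  K c -> convex K -> contractible R K.
Proof. by move=> Kc Kv; apply: (starshaped_contractible Kc) => x t Kx; exact: Kv. Qed.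

End StarShaped.

Section Simplices.
Variable R : realType.

Lemma std_simplex_convex n : convex (std_simplex R n).
Proof.
move=> x y t [x0 x1] [y0 y1] /andP[t0 t1]; split=> [j|].
  by rewrite !mxE addr_ge0 // mulr_ge0 // subr_ge0.
under eq_bigr do rewrite !mxE.
by rewrite big_split /= -!mulr_sumr x1 y1 !mulr1 subrK.
Qed.

Lemma std_simplex_compact n : compact (std_simplex R n).
Proof.
apply: bounded_closed_compact.
  exists 1; split; first exact: num_real.
  move=> M M1 x [x0 x1] /=; apply: le_trans (ltW M1).
  have -> : `|x| = mx_norm x by [].
  rewrite mx_normrE; apply: bigmax_le => // -[i j] _ /=.
  by rewrite (ord1 i) ger0_norm // -x1 (bigD1 j) //= lerDl sumr_ge0.
have -> : std_simplex R n = (\bigcap_j [set t : 'rV[R]_n.+1 | 0 <= t 0 j]) `&`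
    ((fun t : 'rV[R]_n.+1 => \sum_j t 0 j) @^-1` [set 1]).
  by apply/seteqP; split=> t [t0 t1]; split => // j; [move=> _|]; exact: t0.
apply: closedI.
  apply: closed_bigI => j _.
  apply: (@closed_pre _ _ (fun t : 'rV[R]_n.+1 => t 0 j) [set x : R | 0 <= x]).
    exact: coord_cont.
  exact: closed_ge.
apply: (@closed_pre _ _ (fun t : 'rV[R]_n.+1 => \sum_j t 0 j)); last exact: closed_eq.
by move=> t; apply: cont_sum => j _; exact: coord_cont.
Qed.

Lemma delta_simplex n (k : 'I_n.+1) : std_simplex R n (delta_mx 0 k).
Proof.
split=> [j|]; first by rewrite mxE ler0n.
rewrite (bigD1 k) //= mxE !eqxx big1 ?addr0 // => j /negbTE jk.
by rewrite mxE jk andbF.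
Qed.

Definition vert n (k : 'I_n.+1) : std_simplex R n := mk_sub (delta_simplex k).

Lemma std_simplex_contractible n : contractible R (std_simplex R n).
Proof. exact: (convex_contractible (delta_simplex ord0) (@std_simplex_convex n)). Qed.

Lemma std_simplexT_compact n : compact [set: std_simplex R n].
Proof. exact/sub_compact/std_simplex_compact. Qed.

(** Radial projection from vertex 0 onto the opposite face. The value at vertex 0 itself is
    arbitrary: the cone sends that vertex to the apex anyway. *)
Definition tail_row n (t : 'rV[R]_n.+2) : 'rV[R]_n.+1 :=
  if t 0 0 == 1 then delta_mx 0 0 else \row_j (t 0 (lift 0 j) / (1 - t 0 0)).

Lemma tail_row_simplex n (t : 'rV[R]_n.+2) :
  std_simplex R n.+1 t -> std_simplex R n (tail_row t).
Proof.
move=> [t0 t1]; rewrite /tail_row; case: eqP => [_|/eqP h]; first exact: delta_simplex.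
have h' : 0 < 1 - t 0 0.
  rewrite subr_gt0 lt_neqAle h /= -t1 (bigD1 0) //= lerDl sumr_ge0 //.
split=> [j|]; first by rewrite mxE divr_ge0 // ltW.
under eq_bigr do rewrite mxE.
rewrite -mulr_suml (_ : \sum_i t 0 (lift 0 i) = 1 - t 0 0) ?divff ?gt_eqF //.
by rewrite -t1 [in RHS]big_ord_recl addrC addKr.
Qed.

Definition tail_pt n (t : std_simplex R n.+1) : std_simplex R n :=
  mk_sub (tail_row_simplex (set_valP t)).

Lemma tail_ptE n (t : std_simplex R n.+1) : set_val (tail_pt t) = tail_row (set_val t).
Proof. by []. Qed.

Lemma faceE n (i : 'I_n.+2) (t : std_simplex R n) :
  set_val (face i t) = face_row i (set_val t).
Proof. by []. Qed.

Lemma tail_face0 n (t : std_simplex R n) : tail_pt (face 0 t) = t.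
Proof.
apply: set_val_inj; rewrite tail_ptE faceE /tail_row mxE unlift_none eq_sym oner_eq0.
by apply/rowP => j; rewrite !mxE liftK subr0 divr1.
Qed.

Lemma face_lift0 n (i : 'I_n.+2) (t : std_simplex R n.+1) :
  set_val (face (lift 0 i) t) 0 0 = set_val t 0 0.
Proof.
rewrite faceE mxE; case: unliftP => [k k0|/eqP//].
have -> : k = 0 :> 'I__; last by [].
by apply: (@lift_inj _ (lift 0 i)); rewrite -k0; apply: val_inj.
Qed.

Lemma tail_face n (i : 'I_n.+2) (t : std_simplex R n.+1) : set_val t 0 0 != 1 ->
  tail_pt (face (lift 0 i) t) = face i (tail_pt t).
Proof.
move=> t1; apply: set_val_inj; apply/rowP => j.
rewrite tail_ptE {1}/tail_row face_lift0 (negbTE t1) !faceE !mxE.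
case: unliftP => [k jk|jk].
  case: unliftP => [k' jk'|jk'].
    rewrite tail_ptE /tail_row (negbTE t1) mxE; congr (set_val t 0 _ / _).
    apply: (@lift_inj _ (lift 0 i)); rewrite -jk; apply: val_inj.
    by rewrite jk' /= /bump /=; lia.
  have /= := congr1 val jk; rewrite jk' /= /bump /=; have := ltn_ord k; lia.
case: unliftP => [k' jk'|jk']; last by rewrite mul0r.
have /= := congr1 val jk; rewrite jk' /= /bump /=; lia.
Qed.

Lemma tail_pt_cont n (t : std_simplex R n.+1) : set_val t 0 0 != 1 ->
  {for t, continuous (@tail_pt n)}.
Proof.
move=> t1; apply: sub_cont_for.
have cj j : {for t, continuous (fun s : std_simplex R n.+1 => set_val s 0 j)}.
  exact: (cont_comp (@set_val_continuous _ _) (@coord_cont _ _ j)).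
have c1 : {for t, continuous (fun s : std_simplex R n.+1 =>
    (\row_j (set_val s 0 (lift 0 j) / (1 - set_val s 0 0)) : 'rV[R]_n.+1))}.
  apply: rV_cont => j.
  rewrite (_ : (fun _ => _) = fun s : std_simplex R n.+1 =>
     set_val s 0 (lift 0 j) * (1 - set_val s 0 0)^-1).
    apply: contM; first exact: cj.
    apply: contV; first by rewrite subr_eq0 eq_sym.
    by apply: contD; [exact: contC|apply: contN; exact: cj].
  by apply/funext => s; rewrite mxE.
move=> U hU0; have {}hU0 : nbhs (\row_j (set_val t 0 (lift 0 j) / (1 - set_val t 0 0)) : 'rV[R]_n.+1) U.
  by move: hU0; rewrite /= tail_ptE /tail_row (negbTE t1).
have hU := c1 _ hU0.
have near1 : nbhs t (fun s : std_simplex R n.+1 => set_val s 0 0 != 1).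
  have : nbhs (set_val t 0 0) [set u : R | u != 1].
    by apply: open_nbhs_nbhs; split => //; exact: open_neq.
  exact: cj.
apply: (@filterS2 _ (nbhs t) _ _ _ _ _ near1 hU) => s s1 /=.
by rewrite tail_ptE /tail_row (negbTE s1).
Qed.

End Simplices.

Section Cone.
Variables (R : realType) (T : topologicalType) (c : T) (H : (R * T)%type -> T).
Hypotheses (cH : continuous H) (H0 : forall x, H (0, x) = c)
  (H1 : forall x, H (1, x) = x).

Definition cone_fun n (s : sing_simplex R T n) (t : std_simplex R n.+1) : T :=
  H (1 - set_val t 0 0, s (tail_pt t)).

Lemma cone_fun_cont n (s : sing_simplex R T n) : continuous (cone_fun s).
Proof.
move=> t.
have c0 : {for t, continuous (fun s : std_simplex R n.+1 => 1 - set_val s 0 0)}.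
  apply: contD; first exact: contC.
  by apply: contN; exact: (cont_comp (@set_val_continuous _ _) (@coord_cont _ _ _)).
have [t1|t1] := eqVneq (set_val t 0 0) 1; last first.
  apply: (@cont_comp_for _ _ _ (fun t : std_simplex R n.+1 => (1 - set_val t 0 0, s (tail_pt t))) H); last exact: cH.
  apply: cont_pair_for; first exact: c0.
  apply: (@cont_comp_for _ _ _ (@tail_pt _ _) s); first exact: tail_pt_cont.
  exact: cts_fun.
rewrite /continuous_at /cone_fun t1 subrr H0 => W Wc.
(* At the apex [tail_pt] need not be continuous, but [H (u, s x)] tends to [c] uniformly in [x], the
   simplex being compact. *)
have : \forall u \near (0 : R), forall x, [set: std_simplex R n] x -> W (H (u, s x)).
  have /compact_near_coveringP nc := @std_simplexT_compact R n.
  apply: (nc R (nbhs (0 : R)) (fun u x => W (H (u, s x)))) => x _.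
  have : nbhs (H (0, s x)) W by rewrite H0.
  have cG : continuous (fun xu : std_simplex R n * R => H (xu.2, s xu.1)).
    apply: (cont_comp _ cH); apply: cont_pair; first by move=> ?; exact: cvg_snd.
    by apply: (cont_comp _ (@cts_fun _ _ s)) => ?; exact: cvg_fst.
  exact: (cG (x, 0)).
move=> h.
have {}h : nbhs (1 - set_val t 0 0) (fun u => forall x : std_simplex R n, [set: std_simplex R n] x -> W (H (u, s x))).
  by rewrite t1 subrr.
by apply: (@filterS _ (nbhs t) _ _ _ _ (c0 _ h)) => u hu; exact: hu.
Qed.

Definition cone n (s : sing_simplex R T n) : sing_simplex R T n.+1 :=
  mkcts (@cone_fun_cont n s).

Lemma cone_face0 n (s : sing_simplex R T n) : sing_face 0 (cone s) = s.
Proof.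
apply/continuousEP => t; rewrite /sing_face /= /mkcts /cone_fun.
by rewrite tail_face0 /= mxE unlift_none subr0 H1.
Qed.

Lemma cone_face n (i : 'I_n.+2) (s : sing_simplex R T n.+1) :
  sing_face (lift 0 i) (cone s) = cone (sing_face i s).
Proof.
apply/continuousEP => t; rewrite /sing_face /= /mkcts /cone_fun face_lift0.
have [t1|t1] := eqVneq (set_val t 0 0) 1; first by rewrite t1 subrr !H0.
by rewrite tail_face.
Qed.

End Cone.

Section Chains.

Lemma subrACA (M : zmodType) (a b c d : M) : a - b - (c - d) = (a - c) - (b - d).
Proof. by rewrite opprD addrACA -opprD. Qed.

Lemma freeg_ind (K : choiceType) (P : {freeg K / int} -> Prop) :
  P 0 -> (forall x y, P x -> P y -> P (x - y)) -> (forall x, P << x >>) ->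
  forall D, P D.
Proof.
move=> P0 PB P1 D.
have PN x : P x -> P (- x) by rewrite -(sub0r x); exact: PB.
have PD x y : P x -> P y -> P (x + y) by rewrite -{2}(opprK y) => Px /PN; exact: PB.
have PMn x k : P x -> P (x *+ k) by move=> Px; elim: k => [|k IH]; rewrite ?mulr0n // mulrS; exact: PD.
have Pz x k : P x -> P (x *~ k).
  by case: k => k Px; rewrite ?NegzE ?mulrNz -!pmulrn; [exact: PMn|apply: PN; exact: PMn].
rewrite -(freeg_sumE D); elim: (dom D) => [|x r IH]; first by rewrite big_nil.
rewrite big_cons; apply: PD => //.
have -> : << coeff x D *g x >> = << x >> *~ coeff x D :> {freeg K / int}.
  by rewrite freeg_mulz; congr << _ *g _ >>; rewrite intz.
exact: Pz.
Qed.

Lemma freeg_ext (K : choiceType) (M : zmodType) (F : {freeg K / int} -> M) :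
  {morph F : x y / x - y} -> (forall x, F << x >> = 0) -> forall D, F D = 0.
Proof.
move=> FB F1; apply: freeg_ind => // [|x y Fx Fy]; last by rewrite FB Fx Fy subrr.
by have := FB 0 0; rewrite !subrr.
Qed.

Variables (R : realType) (T : topologicalType).

Lemma sing_boundaryB n : {morph @sing_boundary R T n : x y / x - y}.
Proof. exact: lift_is_additive. Qed.

Lemma sing_boundary0 n : @sing_boundary R T n 0 = 0.
Proof. by have := @sing_boundaryB n 0 0; rewrite !subrr. Qed.

Lemma sing_boundary1 (s : sing_simplex R T 1) :
  sing_boundary << s >> = << sing_face 0 s >> - << sing_face 1 s >>.
Proof.
rewrite /sing_boundary liftU scale1r !big_ord_recl big_ord0 addr0.
by rewrite expr0 scale1r expr1 scaleN1r; congr (_ - << sing_face _ s >>); apply: val_inj.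
Qed.

Lemma sing_boundary2 (s : sing_simplex R T 2) :
  sing_boundary << s >> = << sing_face 0 s >> - << sing_face 1 s >> + << sing_face (lift 0 1) s >>.
Proof.
rewrite /sing_boundary liftU scale1r !big_ord_recl big_ord0 addr0.
rewrite expr0 scale1r expr1 scaleN1r sqrrN expr1n scale1r addrA.
by congr (_ - << sing_face _ s >> + << sing_face _ s >>); apply: val_inj.
Qed.

(** Coning is a chain homotopy, z = d (K1 z) + K0 (d z) with d the boundary, so every 1-cycle bounds
    and the only coset is that of the boundaries. *)
Lemma H1_contractible : contractible R T -> finite_set (H1 R T).
Proof.
move=> [c [H [cH H0 H1]]].
pose K0 : sing_chain R T 0 -> sing_chain R T 1 := fglift (fun s => << cone cH H0 s >>).
pose K1 : sing_chain R T 1 -> sing_chain R T 2 := fglift (fun s => << cone cH H0 s >>).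
have K0B : {morph K0 : x y / x - y} by exact: lift_is_additive.
have K1B : {morph K1 : x y / x - y} by exact: lift_is_additive.
have KE z : sing_boundary (K1 z) - (z - K0 (sing_boundary z)) = 0.
  apply: (freeg_ext (F := fun z => sing_boundary (K1 z) - (z - K0 (sing_boundary z)))).
    move=> x y; rewrite !(K1B, K0B, sing_boundaryB).
    by rewrite (subrACA x y) [LHS]subrACA.
  move=> s; rewrite /K1 liftU scale1r sing_boundary2 cone_face0 //.
  have -> : sing_face 1 (cone cH H0 s) = cone cH H0 (sing_face 0 s).
    by rewrite -cone_face //; congr sing_face; apply: val_inj.
  rewrite cone_face // sing_boundary1 K0B /K0 !liftU !scale1r.
  set A := << s >>; set B := << _ >>; set C := << _ >>.
  by have -> : A - (B - C) = A - B + C; [rewrite opprB addrCA addrC|rewrite subrr].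
have -> : @Defs.H1 R T = [set (@boundaries R T 0 : set _)]; last exact: finite_set1.
have zB (z : sing_chain R T 1) : @cycles R T 0 z -> boundaries z.
  move=> z0; exists (K1 z) => //.
  have := KE z; rewrite z0 (_ : K0 0 = 0) ?subr0; first by move/eqP; rewrite subr_eq0 => /eqP.
  by have := K0B 0 0; rewrite !subrr.
have bD (x y : sing_chain R T 1) : boundaries x -> boundaries y -> boundaries (x - y).
  by move=> [a _ <-] [b _ <-]; exists (a - b) => //; rewrite sing_boundaryB.
apply/seteqP; split=> [_ [z z0 <-]|_ ->].
  apply/seteqP; split=> w /= h; last by apply: bD => //; exact: zB.
  have b0 : boundaries (0 : sing_chain R T 1) by exists 0 => //; exact: sing_boundary0.
  by have := bD _ _ h (bD _ _ b0 (zB z z0)); rewrite sub0r opprK subrK.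
exists 0; first exact: sing_boundary0.
by apply/seteqP; split=> w /=; rewrite subr0.
Qed.

End Chains.

(** * Polyhedra and circle-valued functions on spaces with finite first homology *)

Section Hulls.
Context {R : realType} {m : nat}.
Implicit Types s : seq 'rV[R]_m.

Lemma hull_convex s : convex (convex_hull s).
Proof.
move=> _ _ t [a [a0 a1] <-] [b [b0 b1] <-] /andP[t0 t1].
exists (fun i => (1 - t) * a i + t * b i); first split=> [i|].
- by rewrite addr_ge0 // mulr_ge0 // subr_ge0.
- by rewrite big_split /= -!mulr_sumr a1 b1 !mulr1 subrK.
- by rewrite !scaler_sumr -big_split /=; apply: eq_bigr => i _; rewrite !scalerA scalerDl.
Qed.

Lemma hull_compact s : compact (convex_hull s).
Proof.
case: s => [|x s].
  rewrite (_ : convex_hull _ = set0); first exact: compact0.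
  by apply/seteqP; split=> // y [a [_ /esym]]; rewrite big_ord0 => /eqP; rewrite oner_eq0.
pose F (a : 'rV[R]_(size s).+1) := \sum_(i < (size s).+1) a 0 i *: (x :: s)`_i.
have -> : convex_hull (x :: s) = F @` std_simplex R (size s).
  apply/seteqP; split=> [_ [a [a0 a1] <-]|_ [a [a0 a1] <-]].
    exists (\row_i a i).
      by split=> [j|]; rewrite ?mxE // -[RHS]a1; apply: eq_bigr => i _; rewrite mxE.
    by apply: eq_bigr => i _; rewrite mxE.
  by exists (fun i => a 0 i).
apply: continuous_compact; last exact: std_simplex_compact.
apply: continuous_subspaceT; apply: contI => a; apply: cont_sum => i _.
by apply: contZ; [exact: coord_cont|exact: contC].
Qed.

Lemma rV_hausdorff : hausdorff_space 'rV[R]_m.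
Proof. exact: norm_hausdorff. Qed.

Lemma hull_closed s : closed (convex_hull s).
Proof. by apply: compact_closed; [exact: rV_hausdorff|exact: hull_compact]. Qed.

Lemma polyhedron_compact (P : set 'rV[R]_m) : polyhedron P -> compact P.
Proof.
move=> [ss ->]; elim: ss => [|s ss IH].
  rewrite (_ : \bigcup_(_ in _) _ = set0); first exact: compact0.
  by apply/seteqP; split=> // y [].
rewrite (_ : \bigcup_(_ in _) _ = convex_hull s `|` \bigcup_(t in [set` ss]) convex_hull t).
  by apply: compactU => //; exact: hull_compact.
apply/seteqP; split=> [y [t /=]|y [ys|[t tss yt]]].
- by rewrite inE => /orP[/eqP ->|tss] yt; [left|right; exists t].
- by exists s => //=; rewrite inE eqxx.
- by exists t => //=; rewrite inE tss orbT.
Qed.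

Lemma polyhedronP (P : set 'rV[R]_m) (ss : seq (seq 'rV[R]_m)) : P = \bigcup_(s in [set` ss]) convex_hull s ->
  forall y, P y <-> exists2 s : seq 'rV[R]_m, s \in ss & convex_hull s y.
Proof. by move=> -> y; split=> -[s]; exists s. Qed.

End Hulls.

Section Charts.
Context {R : realType} {X : topologicalType} (S : pl_structure R X).

Lemma chart_cont : continuous S.
Proof. by case: (pl_chart_homeo S) => _ cS _; apply/continuous_subspace_setT. Qed.

Lemma chart_inv : exists g : 'rV[R]_(pl_dim S) -> X,
  {within range S, continuous g} /\ forall x, g (S x) = x.
Proof. by case: (pl_chart_homeo S) => _ _ [g [cg gS]]; exists g; split=> // x; exact: gS. Qed.

Lemma chart_inj : injective S.
Proof. by have [g [_ gS]] := chart_inv; exact: can_inj gS. Qed.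

Lemma chart_hausdorff : hausdorff_space X.
Proof.
move=> x y xy; apply: chart_inj; apply: rV_hausdorff => U V xU yV.
have [||z [Uz Vz]] := xy (S @^-1` U) (S @^-1` V); [exact: chart_cont..|].
by exists (S z).
Qed.

Lemma subpoly_closed A : subpolyhedron S A -> closed A.
Proof.
move=> PA; have -> : A = S @^-1` (S @` A).
  by apply/seteqP; split=> [x Ax|x [y Ay /chart_inj <-//]]; exists x.
apply: (closed_pre chart_cont); apply: compact_closed; first exact: rV_hausdorff.
exact: polyhedron_compact.
Qed.

End Charts.

Section LiftFromHomology.
Variables (R : realType) (A : topologicalType) (phi : A -> R).
Hypothesis zphi : zcont setT phi.

Let lift_ex n (s : sing_simplex R A n) :
  exists h : std_simplex R n -> R, continuous h /\ forall x, h x - phi (s x) \is a Num.int.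
Proof.
apply: (@zcont_lift R _ (phi \o s)); [exact: std_simplexT_compact|exact: std_simplex_contractible|].
exact: (zcontT_comp (@cts_fun _ _ s) zphi).
Qed.

(** The total change along a path of a real lift of [phi], the same for all lifts. The type
    [zmodule R] is the field seen as a module over the integers, for the extension to chains. *)
Definition incr (s : sing_simplex R A 1) : zmodule R :=
  let h := projT1 (cid (lift_ex s)) in h (vert R 1) - h (vert R 0).

Lemma lift_diff n (h k : std_simplex R n -> R) (psi : std_simplex R n -> R) :
  continuous h -> continuous k -> (forall x, h x - psi x \is a Num.int) ->
  (forall x, k x - psi x \is a Num.int) -> forall x y, h x - h y = k x - k y.
Proof.
move=> ch ck hZ kZ x y.
have /= hk : h x - k x = h y - k y.
  apply: (@contractible_int_const R _ (fun x => h x - k x)); first exact: std_simplex_contractible.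
    by apply: contI => z; apply: contD; [exact: ch|apply: contN; exact: ck].
  by move=> z; rewrite -(subrKA (psi z)) rpredD // -opprB rpredN.
by apply/eqP; rewrite -subr_eq0 subrACA hk subrr.
Qed.

Lemma incrE (s : sing_simplex R A 1) (h : std_simplex R 1 -> R) :
  continuous h -> (forall x, h x - phi (s x) \is a Num.int) ->
  incr s = h (vert R 1) - h (vert R 0).
Proof.
by rewrite /incr => ch hZ; case: cid => k [ck kZ] /=; exact: (lift_diff ck ch kZ hZ).
Qed.

Definition theta : sing_chain R A 1 -> R := fglift incr.

Lemma thetaB : {morph theta : x y / x - y}.
Proof. exact: (@lift_is_additive _ _ _ incr). Qed.

Lemma theta1 s : theta << s >> = incr s.
Proof. by rewrite /theta liftU scale1r. Qed.

Lemma theta0 : theta 0 = 0.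
Proof. by have := thetaB 0 0; rewrite !subrr. Qed.

Lemma thetaMn z k : theta (z *+ k) = theta z *+ k.
Proof.
have thN x : theta (- x) = - theta x by rewrite -sub0r thetaB theta0 sub0r.
have thD x y : theta (x + y) = theta x + theta y by rewrite -{1}(opprK y) thetaB thN opprK.
by elim: k => [|k IH]; rewrite ?mulr0n ?theta0 // !mulrS thD IH.
Qed.

Lemma face_vert n (i : 'I_n.+2) (k : 'I_n.+1) : face i (vert R k) = vert R (lift i k).
Proof.
apply: set_val_inj; apply/rowP => j; rewrite faceE !mxE /=.
case: unliftP => [k' ->|->]; first by rewrite !mxE /= (inj_eq (@lift_inj _ i)).
by rewrite (negbTE (neq_lift _ _)).
Qed.

(** One lift over the whole 2-simplex restricts to its three edges, and the increments cancel around
    the triangle. *)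
Lemma theta_boundary z : theta (sing_boundary z) = 0.
Proof.
apply: (freeg_ext (F := fun z => theta (sing_boundary z))).
  by move=> x y; rewrite sing_boundaryB thetaB.
move=> s; have [h [ch hZ]] := lift_ex s.
have hf i : theta << sing_face i s >> = h (vert R (lift i 1)) - h (vert R (lift i 0)).
  rewrite theta1 (@incrE _ (fun t => h (face i t))); first by rewrite !face_vert.
    by apply: (cont_comp _ ch); exact: face_continuous.
  by move=> x; exact: hZ.
rewrite sing_boundary2.
have -> : << sing_face 0 s >> - << sing_face 1 s >> + << sing_face (lift 0 1) s >> =
  << sing_face 0 s >> - (<< sing_face 1 s >> - << sing_face (lift 0 1) s >>).
  by move=> K; rewrite opprB addrCA addrC.
rewrite !thetaB !hf.
have e (i j i' j' : 'I_3) : i = i' :> nat -> j = j' :> nat ->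
    h (vert R i) - h (vert R j) = h (vert R i') - h (vert R j').
  by move=> /val_inj -> /val_inj ->.
rewrite (e _ _ 2 1) // (e (lift 1 1) _ 2 0) // (e (lift (lift 0 1) 1) _ 1 0) //.
ring.
Qed.

Definition pt_simplex (a : A) : sing_simplex R A 0 := mkcts (@cst_continuous _ _ a).

Lemma simplex0E (s : sing_simplex R A 0) x : s = pt_simplex (s x).
Proof.
apply/continuousEP => y; rewrite /pt_simplex /mkcts /=; congr (s _).
apply: set_val_inj; apply/rowP => j.
have e z : std_simplex R 0 z -> z 0 j = 1 by move=> [_]; rewrite big_ord1 (ord1 j).
by rewrite !e //; exact: set_valP.
Qed.

Lemma boundary_pt (s : sing_simplex R A 1) :
  sing_boundary << s >> = << pt_simplex (s (vert R 1)) >> - << pt_simplex (s (vert R 0)) >>.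
Proof.
rewrite sing_boundary1 (simplex0E (sing_face 0 s) (vert R 0)) (simplex0E (sing_face 1 s) (vert R 0)) /=.
by congr (<< pt_simplex (s _) >> - << pt_simplex (s _) >>); rewrite face_vert; congr vert; apply: val_inj.
Qed.

Definition joined a b (c : sing_chain R A 1) :=
  sing_boundary c = << pt_simplex b >> - << pt_simplex a >>.

Lemma theta_mod a b c : joined a b c -> theta c - (phi b - phi a) \is a Num.int.
Proof.
pose ev0 (s : sing_simplex R A 0) : zmodule R := phi (s (vert R 0)).
pose ev : sing_chain R A 0 -> R := fglift ev0.
have evB : {morph ev : x y / x - y} by exact: (@lift_is_additive _ _ _ ev0).
have evE x : ev << pt_simplex x >> = phi x by rewrite /ev liftU scale1r.
have h : forall D, theta D - ev (sing_boundary D) \is a Num.int.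
  apply: freeg_ind => [|x y hx hy|s].
  - rewrite sing_boundary0 theta0.
    by have := evB 0 0; rewrite !subrr => ->; rewrite subrr rpred0.
  - by rewrite sing_boundaryB thetaB evB subrACA rpredB.
  - rewrite boundary_pt evB !evE theta1; have [h [ch hZ]] := lift_ex s.
    by rewrite (incrE ch hZ) subrACA rpredB.
by move=> j; have := h c; rewrite j evB !evE.
Qed.

Hypothesis finH : finite_set (H1 R A).

(** Finiteness of the first homology enters here: two different multiples of [z] are homologous, so
    a nonzero integer kills the real number [theta z]. *)
Lemma theta_cycle z : sing_boundary z = 0 -> theta z = 0.
Proof.
move=> z0.
pose coset (k : nat) := [set w | @boundaries R A 0 (w - z *+ k)].
have zk k : sing_boundary (z *+ k) = 0.
  elim: k => [|k IH]; first exact: sing_boundary0.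
  by rewrite mulrS -(opprK (z *+ k)) sing_boundaryB z0 -(sub0r (z *+ k)) sing_boundaryB sing_boundary0 IH !subrr.
have inH k : H1 R A (coset k) by exists (z *+ k) => //; exact: zk.
have [k [l [kl e]]] : exists k l, k <> l /\ coset k = coset l.
  apply: contrapT => h.
  have inj : injective coset.
    by move=> k l e; apply: contrapT => kl; apply: h; exists k, l.
  have : finite_set (coset @^-1` H1 R A) by apply: finite_preimage => // x y _ _; exact: inj.
  rewrite (_ : _ @^-1` _ = setT); first exact: infinite_nat.
  by apply/seteqP; split=> // x _; exact: inH.
have : coset l (z *+ k) by rewrite -e /coset /= subrr; exists 0 => //; exact: sing_boundary0.
move=> [c _ cE]; have := theta_boundary c; rewrite cE thetaB !thetaMn.
rewrite -(mulr_natr (theta z) k) -(mulr_natr (theta z) l) -mulrBr => /eqP; rewrite mulf_eq0 => /orP[/eqP//|].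
by rewrite subr_eq0 eqr_nat => /eqP.
Qed.

Lemma theta_joined a b c c' : joined a b c -> joined a b c' -> theta c = theta c'.
Proof.
move=> j j'; apply/eqP; rewrite -subr_eq0 -thetaB; apply/eqP/theta_cycle.
by rewrite sing_boundaryB j j' subrr.
Qed.

(** In each class of points joined by 1-chains a base point is chosen and [theta] is integrated from
    it; by [theta_joined] the chain does not matter. Continuity is not claimed here; on a polyhedron
    it comes from the convex hulls. *)
Lemma H1_lift : exists h : A -> R, (forall x, h x - phi x \is a Num.int) /\
  forall a b c, joined a b c -> h b - h a = theta c.
Proof.
pose P a := [set b | exists c, joined b a c].
have Pa a : P a !=set0 by exists a, 0; rewrite /joined sing_boundary0 subrr.
have jtr a b c x y : joined a b x -> joined b c y -> joined a c (x + y).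
  rewrite /joined => e1 e2; rewrite -(opprK y) sing_boundaryB e1.
  by rewrite -(sub0r y) sing_boundaryB sing_boundary0 e2 sub0r !opprB addrC addrA subrK.
have jsy a b x : joined a b x -> joined b a (- x).
  by rewrite /joined -(sub0r x) sing_boundaryB sing_boundary0 => ->; rewrite sub0r opprB.
pose rep a := projT1 (cid (Pa a)).
have repP a : exists c, joined (rep a) a c by exact: projT2 (cid (Pa a)).
have repE a b c : joined a b c -> rep a = rep b.
  move=> j; have e : P a = P b.
    apply/seteqP; split=> x [d jd]; first by exists (d + c); exact: jtr jd j.
    by exists (d + - c); exact: jtr jd (jsy _ _ _ j).
  (* The base point is chosen from the set [P a] alone, so equal sets give the same one as soon as
     the nonemptiness proofs are identified. *)
  by rewrite /rep; move: (Pa a) (Pa b); rewrite e => p1 p2; rewrite (Prop_irrelevance p1 p2).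
pose c a := projT1 (cid (repP a)).
have cP a : joined (rep a) a (c a) by exact: projT2 (cid (repP a)).
exists (fun a => phi (rep a) + theta (c a)); split=> [a|a b d j].
  by have := theta_mod (cP a); rewrite opprB addrCA addrA.
rewrite (repE _ _ _ j) opprD addrACA subrr add0r; apply/esym.
rewrite -thetaB; apply: (theta_joined j).
rewrite addrC; apply: jtr (cP b).
by rewrite -(repE _ _ _ j); exact: jsy.
Qed.

End LiftFromHomology.

Section PolyhedralLift.
Variables (R : realType) (X : topologicalType) (S : pl_structure R X) (A : set X).
Hypotheses (polyA : subpolyhedron S A) (finH : finite_set (H1 R A)).

(** Each convex hull is contractible, so [phi] has a continuous lift [l] on it. Segments are
    singular simplices along which [h] and [l] change alike, hence they differ by a constant on the
    hull. Finitely many closed hulls then give continuity on [A]. *)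
Lemma poly_lift (phi : A -> R) : zcont setT phi ->
  exists h : A -> R, continuous h /\ forall x, h x - phi x \is a Num.int.
Proof.
move=> zphi; have [h [hZ hj]] := H1_lift zphi finH.
exists h; split=> //.
have [ss ssE] := polyA; have [g [cg gS]] := chart_inv S.
have ssP := polyhedronP ssE.
have cSA : continuous (fun a : A => S (set_val a)).
  by apply: (cont_comp (@set_val_continuous _ A)); exact: chart_cont.
have key s : s \in ss -> forall y, convex_hull s y -> A (g y) /\ S (g y) = y.
  move=> sss y sy; have [x Ax xy] : (S @` A) y by apply/ssP; exists s.
  by rewrite -xy gS.
have hull_h s (sss : s \in ss) : exists k : convex_hull s -> A,
    [/\ continuous (fun y => h (k y)), forall y, S (set_val (k y)) = set_val y &
     forall (a : A) (sa : convex_hull s (S (set_val a))), k (mk_sub sa) = a].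
  pose k (y : convex_hull s) : A := mk_sub (proj1 (key s sss _ (set_valP y))).
  have ck : continuous k.
    apply: sub_cont; apply: within_sub; apply: continuous_subspaceW cg.
    by move=> y sy; have [_ <-] := key s sss y sy; exists (g y).
  have [l [cl lZ]] : exists l : convex_hull s -> R, continuous l /\
      forall y, l y - phi (k y) \is a Num.int.
    have [[c sc]|s0] := pselect (convex_hull s !=set0).
      apply: (@zcont_lift R _ (phi \o k)); last exact: zcontT_comp.
        exact/sub_compact/hull_compact.
      exact: (convex_contractible sc (@hull_convex _ _ s)).
    exists (fun=> 0); split=> [|y]; first by apply: contI => y; exact: contC.
    by case: s0; exists (set_val y); exact: set_valP.
  exists k; split=> [|y|a sa]; last 2 first.
  - by rewrite /k mk_subE; have [_] := key s sss _ (set_valP y).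
  - by apply: set_val_inj; rewrite /k !mk_subE gS.
  have diff y y' : h (k y') - h (k y) = l y' - l y.
    have seg (t : std_simplex R 1) : convex_hull s ((1 - set_val t 0 1) *: set_val y + set_val t 0 1 *: set_val y').
      have [t0 /esym t1] := set_valP t.
      apply: hull_convex; [exact: set_valP..|].
      rewrite t0 /= t1 (bigD1 1) //= lerDl sumr_ge0 //.
    pose p t := mk_sub (seg t).
    have cp : continuous p.
      apply: sub_cont; apply: contI => t.
      have c1 : {for t, continuous (fun t : std_simplex R 1 => set_val t 0 1)}.
        exact: (cont_comp (@set_val_continuous _ _) (@coord_cont _ _ _)).
      have -> : (fun x => set_val (p x)) = (fun t => (1 - set_val t 0 1) *: set_val y + set_val t 0 1 *: set_val y') by [].
      by cont_tac.
    have p0 : p (vert R 0) = y.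
      by apply: set_val_inj; rewrite /p !mk_subE mxE /= subr0 scale1r scale0r addr0.
    have p1 : p (vert R 1) = y'.
      by apply: set_val_inj; rewrite /p !mk_subE mxE /= subrr scale1r scale0r add0r.
    pose si : sing_simplex R A 1 := mkcts (cont_comp cp ck).
    have : joined (k y) (k y') << si >> by rewrite /joined boundary_pt /= /mkcts p0 p1.
    move/(hj _ _ _) ->; rewrite theta1 (@incrE _ _ _ zphi si (fun t => l (p t))); first by rewrite p0 p1.
      exact: (cont_comp cp cl).
    by move=> x; exact: lZ.
  have [[c sc]|s0] := pselect (convex_hull s !=set0); last first.
    by move=> y; case: s0; exists (set_val y); exact: set_valP.
  have -> : (fun y => h (k y)) = (fun y => h (k (mk_sub sc)) - l (mk_sub sc) + l y).
    apply/funext => y; have := diff (mk_sub sc) y.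
    by move=> /eqP; rewrite subr_eq => /eqP ->; rewrite addrC addrA addrAC.
  by apply: contI => y; apply: contD; [exact: contC|exact: cl].
apply: contI => x; apply/cont_eps => e e0.
have near_s (i : 'I_(size ss)) : \forall y \near x, convex_hull (nth [::] ss i) (S (set_val y)) -> `|h x - h y| < e.
  have sss : nth [::] ss i \in ss by exact: mem_nth.
  have [k [ck kS kE]] := hull_h _ sss.
  have [sx|sx] := pselect (convex_hull (nth [::] ss i) (S (set_val x))); last first.
    have : nbhs (S (set_val x)) (~` convex_hull (nth [::] ss i)).
      by apply: open_nbhs_nbhs; split=> //; apply: closed_openC; exact: hull_closed.
    move/(cSA x); apply: (@filterS _ (nbhs x)) => y /= nsy sy; by case: nsy.
  have /cont_eps /(_ _ e0) : {for mk_sub sx, continuous (fun y => h (k y))} by exact: ck.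
  move=> /sub_nbhs[W Wx WP].
  apply: (@filterS _ (nbhs x) _ _ _ _ (cSA x _ Wx)) => y Wy sy.
  by have := WP (mk_sub sy) Wy; rewrite !kE.
have nearA : \forall y \near x, forall i : 'I_(size ss), convex_hull (nth [::] ss i) (S (set_val y)) -> `|h x - h y| < e.
  exact: near_forall.
apply: (@filterS _ (nbhs x) _ _ _ _ nearA) => y hy.
have [s sss sy] : exists2 s : seq 'rV[R]_(pl_dim S), s \in ss & convex_hull s (S (set_val y)).
  by apply/ssP; exists (set_val y) => //; exact: set_valP.
have iP : (index s ss < size ss)%N by rewrite index_mem.
by apply: (hy (Ordinal iP)); rewrite /= nth_index.
Qed.

End PolyhedralLift.

Section ClosedMaps.

(* A map from a compact set to a Hausdorff space is closed, so a property that
   holds near a whole fiber holds near its image. *)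
Lemma compact_map_near (S T : topologicalType) (K : set S) (g : S -> T) (P : T -> Prop) (a : T) :
  compact K -> {within K, continuous g} -> hausdorff_space T ->
  (forall x, K x -> g x = a -> \forall y \near x, K y -> P (g y)) ->
  \forall b \near a, (exists2 x, K x & g x = b) -> P b.
Proof.
move=> cK cg hT hP.
pose O := [set x : S | \forall y \near x, K y -> P (g y)].
have oO : open O.
  rewrite openE => x Ox; rewrite /interior /O /=.
  by have := nbhs_interior Ox; apply: (@filterS _ (nbhs x)) => y.
have cKO : compact (g @` (K `&` ~` O)).
  apply: continuous_compact; last by apply: compact_closedI => //; exact: open_closedC.
  by apply: continuous_subspaceW cg => x [].
have : closed (g @` (K `&` ~` O)) by exact: compact_closed.
move/closed_openC => oC.
have aC : (~` (g @` (K `&` ~` O))) a by move=> [x [Kx nO] gx]; apply: nO; exact: hP.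
have : nbhs a (~` (g @` (K `&` ~` O))) by apply: open_nbhs_nbhs.
apply: near_imp => b nb [x Kx gx].
have Ox : O x by apply: contrapT => nO; apply: nb; exists x.
by rewrite -gx; apply: (nbhs_singleton Ox).
Qed.

Lemma compact_map_cont (S T U : topologicalType) (K : set S) (g : S -> T) (u : T -> U) (a : T) :
  compact K -> {within K, continuous g} -> hausdorff_space T ->
  (forall b, exists2 x, K x & g x = b) -> {within K, continuous (fun x => u (g x))} ->
  {for a, continuous u}.
Proof.
move=> cK cg hT surj cu B aB.
have := @compact_map_near _ _ K g (fun b => B (u b)) a cK cg hT.
have h : forall x, K x -> g x = a -> \forall y \near x, K y -> B (u (g y)).
  by move=> x Kx gx; apply: ((within_near _ _).1 cu) => //; rewrite gx.
by move/(_ h); apply: near_imp => b; apply.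
Qed.

(** As [psi] has only to agree with [phi] modulo Z, it may be defined through arbitrarily chosen
    preimages. *)
Lemma compact_map_zcont (R : realType) (S T : topologicalType) (K : set S) (g : S -> T)
    (W : set T) (psi : T -> R) (phi : S -> R) :
  compact K -> {within K, continuous g} -> hausdorff_space T ->
  (forall b, W b -> exists2 x, K x & g x = b) ->
  zcont (K `&` g @^-1` W) phi ->
  (forall x, K x -> W (g x) -> psi (g x) - phi x \is a Num.int) ->
  zcont W psi.
Proof.
move=> cK cg hT surj zphi h a Wa e e0.
have := @compact_map_near _ _ K g (fun b => W b -> `|zfr (psi b - psi a)| < e) a cK cg hT.
have hh : forall x, K x -> g x = a ->
    \forall y \near x, K y -> W (g y) -> `|zfr (psi (g y) - psi a)| < e.
  move=> x Kx gx; have Wx : W (g x) by rewrite gx.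
  have := zphi x (conj Kx Wx) e e0; apply: near_imp => y hy Ky Wy.
  rewrite (@zfr_congr _ _ (phi y - phi x)); first exact: hy.
  by rewrite -gx subrACA rpredB ?h.
move/(_ hh); apply: near_imp => b hb Wb.
by apply: hb => //; exact: surj.
Qed.

(** Both spaces are the quotient of [T] by the same relation: [X] because a map from a compact to a
    Hausdorff space is closed, [Y] by hypothesis. *)
Lemma homeo_of_fibers (T X Y : topologicalType) (g : T -> X) (k : T -> Y) :
  compact [set: T] -> hausdorff_space X -> continuous g -> continuous k ->
  (forall x, exists t, g t = x) -> (forall y, exists t, k t = y) ->
  (forall U : set Y, open (k @^-1` U) -> open U) ->
  (forall s t, g s = g t <-> k s = k t) -> homeomorphic X Y.
Proof.
move=> cT hX cg ck sg sk qk fib.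
pose F x := k (projT1 (cid (sg x))); pose G y := g (projT1 (cid (sk y))).
have FE t : F (g t) = k t by rewrite /F; case: cid => s /= /fib.
have GE t : G (k t) = g t by rewrite /G; case: cid => s /= /fib.
exists F, G; split.
- apply: contI => x; apply: (@compact_map_cont _ _ _ setT g) => //.
  + exact: continuous_subspaceT.
  + by move=> b; have [t tb] := sg b; exists t.
  + by apply: continuous_subspaceT; rewrite (_ : (fun _ => _) = k) //; apply/funext => t; exact: FE.
- apply/continuousP => U oU; apply: qk.
  rewrite (_ : _ @^-1` _ = g @^-1` U); first exact: open_pre.
  by apply/seteqP; split=> t /=; rewrite GE.
- by move=> x; have [t <-] := sg x; rewrite FE GE.
- by move=> y; have [t <-] := sk y; rewrite GE FE.
Qed.

Lemma hausdorff_compact_quotient (S T : topologicalType) (g : S -> T) :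
  compact [set: S] -> hausdorff_space T -> continuous g ->
  (forall b, exists x, g x = b) -> forall U : set T, open (g @^-1` U) -> open U.
Proof.
move=> cS hT cg surj U oU; rewrite openE => a Ua; rewrite /interior.
have := @compact_map_near _ _ setT g U a cS (continuous_subspaceT _) hT.
have hP : forall x, [set: S] x -> g x = a -> \forall y \near x, [set: S] y -> U (g y).
  move=> x _ gx; have : nbhs x (g @^-1` U) by apply: open_nbhs_nbhs; split=> //=; rewrite gx.
  by apply: near_imp.
move/(_ cg hP); apply: near_imp => b; apply.
by have [x xb] := surj b; exists x.
Qed.

End ClosedMaps.

Section Intervals.
Variable R : realType.

Lemma real_zcont_lift (psi : R -> R) a b : zcont setT psi -> a <= b ->
  exists h : R -> R, continuous h /\ forall t, a <= t <= b -> h t - psi t \is a Num.int.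
Proof.
move=> zpsi ab.
have cab : compact [set: `[a, b]%classic] by apply: sub_compact; exact: segment_compact.
have aab : (`[a, b]%classic : set R) a by rewrite /= in_itv /= lexx.
have vab : convex (`[a, b]%classic : set R).
  move=> x y t; rewrite /= !in_itv /= => /andP[ax xb] /andP[ay yb] /andP[t0 t1].
  have e1 : (1 - t) * a + t * a = a by ring.
  have e2 : (1 - t) * b + t * b = b by ring.
  have t1' : 0 <= 1 - t by rewrite subr_ge0.
  apply/andP; split; [rewrite -[X in X <= _]e1|rewrite -[X in _ <= X]e2];
    by apply: lerD; apply: ler_wpM2l.
have con : contractible R `[a, b]%classic := convex_contractible aab vab.
have [h [ch hZ]] := zcont_lift cab con (zcontT_comp (@set_val_continuous _ _) zpsi).
(* The retraction of the line onto [a, b], which extends the lift continuously to [R]. *)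
pose cl t : R := (a + b + `|t - a| - `|t - b|) / 2.
have clE t : [/\ t <= a -> cl t = a, a <= t <= b -> cl t = t & b <= t -> cl t = b].
  rewrite /cl; split=> [h1|/andP[h1 h2]|h1].
  - rewrite ler0_norm ?subr_le0 // ler0_norm ?subr_le0 ?(le_trans h1) //; lra.
  - rewrite ger0_norm ?subr_ge0 // ler0_norm ?subr_le0 //; lra.
  - rewrite ger0_norm ?subr_ge0 ?(le_trans ab) // ger0_norm ?subr_ge0 //; lra.
have clP t : (`[a, b]%classic : set R) (cl t).
  rewrite /= in_itv /=; have [c1 c2 c3] := clE t.
  have [ta|/ltW ta] := leP t a; first by rewrite c1 // lexx.
  have [tb|/ltW tb] := leP t b; first by rewrite c2 ta.
  by rewrite c3 // lexx andbT.
have ccl : continuous (fun t => mk_sub (clP t)).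
  by apply: sub_cont; apply: contI => t; rewrite (_ : (fun _ => _) = cl) // /cl; cont_tac.
exists (fun t => h (mk_sub (clP t))); split; first exact: (cont_comp ccl ch).
move=> t tab; have e : cl t = t by have [_ c2 _] := clE t; exact: c2.
suff <- : psi (cl t) = psi t by exact: (hZ (mk_sub (clP t))).
by rewrite e.
Qed.

Lemma const_on_interval (u : R -> R) a b :
  {within `[a, b], continuous u} -> (forall t, a <= t <= b -> u t \is a Num.int) ->
  forall s t, a <= s <= b -> a <= t <= b -> u s = u t.
Proof.
move=> cu uZ; suff key : forall s, a <= s <= b -> u a = u s.
  by move=> s t sab tab; rewrite -(key s) // -(key t).
move=> s /andP[as_ sb]; apply: int_valued_const => //.
  apply: continuous_subspaceW cu => t; rewrite /= !in_itv /= => /andP[-> ts].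
  exact: le_trans ts sb.
by move=> t; rewrite in_itv /= => /andP[at_ ts]; apply: uZ; rewrite at_ (le_trans ts sb).
Qed.

End Intervals.

(** * The circle, the bouquet and the attaching space *)

Section Circle.
Variable R : realType.

Lemma circle_row (t : R) :
  sphere R 1 (\row_(j < 2) if j == 0 then cos (2 * pi * t) else sin (2 * pi * t)).
Proof. by rewrite /sphere /= !big_ord_recl big_ord0 !mxE /= addr0 cos2Dsin2. Qed.

(** The covering exp(2 pi i t) of the circle, normalised to have period 1. *)
Definition ce (t : R) : circle R := mk_sub (circle_row t).

Lemma ce0 t : set_val (ce t) 0 0 = cos (2 * pi * t).
Proof. by rewrite /ce mk_subE mxE. Qed.

Lemma ce1 t : set_val (ce t) 0 1 = sin (2 * pi * t).
Proof. by rewrite /ce mk_subE mxE. Qed.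

Lemma ord2P (j : 'I_2) : j = 0 \/ j = 1.
Proof. by case: j => [[|[|//]] jP]; [left|right]; apply: val_inj. Qed.

Lemma circle_eq (x y : circle R) : set_val x 0 0 = set_val y 0 0 ->
  set_val x 0 1 = set_val y 0 1 -> x = y.
Proof.
move=> h0 h1; apply: set_val_inj; apply/rowP => j.
by have [->|->] := ord2P j.
Qed.

Lemma circleP (x : circle R) : set_val x 0 0 ^+ 2 + set_val x 0 1 ^+ 2 = 1.
Proof.
have h : \sum_(j < 2) set_val x 0 j ^+ 2 = 1 by exact: (set_valP x).
apply: (etrans _ h); rewrite !big_ord_recl big_ord0 addr0.
by congr (_ + set_val x 0 _ ^+ 2); apply: val_inj.
Qed.

Lemma ce_cont : continuous ce.
Proof.
apply: sub_cont; apply: contI => t; apply: rV_cont => j.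
have c2 : {for t, continuous (fun t : R => 2 * pi * t)} by cont_tac.
have -> : (fun t => set_val (ce t) 0 j) = (fun t => if j == 0 then cos (2 * pi * t) else sin (2 * pi * t)).
  by apply/funext => u; rewrite /ce mk_subE mxE.
by case: (j == 0); [exact: (cont_comp_for c2 (@continuous_cos R _))|exact: (cont_comp_for c2 (@continuous_sin R _))].
Qed.

Lemma ce_add1 t : ce (t + 1) = ce t.
Proof.
have e : 2 * pi * (t + 1) = 2 * pi * t + pi *+ 2 :> R by rewrite mulrDr mulr1 (mulr_natl pi 2).
by apply: circle_eq; rewrite !(ce0, ce1) e ?cosD2pi ?sinD2pi.
Qed.

Lemma ce_addn t (n : nat) : ce (t + n%:R) = ce t.
Proof. by elim: n => [|n IH]; rewrite ?addr0 // -natr1 addrA ce_add1. Qed.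

Lemma ce_int s t : s - t \is a Num.int -> ce s = ce t.
Proof.
move=> /intrP[[n|n]] h.
  by rewrite -(subrK t s) h addrC ce_addn.
by rewrite -(subrK s t) -opprB h NegzE intrN opprK addrC ce_addn.
Qed.

Lemma ce_inj s t : ce s = ce t -> s - t \is a Num.int.
Proof.
move=> e; pose u := zfr (s - t).
have c1 : cos (2 * pi * u) = 1.
  have -> : cos (2 * pi * u) = cos (2 * pi * (s - t)).
    by rewrite -!ce0 (@ce_int u (s - t)) //; exact: zfr_int'.
  rewrite mulrBr cosB -!ce0 -!ce1 e -!expr2; exact: circleP.
suff u0 : u = 0 by have := zfr_int (s - t); rewrite -/u u0 subr0.
have ple : 0 < 2 * pi :> R by rewrite mulr_gt0 // pi_gt0.
have : `|2 * pi * u| = 0.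
  apply: (@cos_inj R); rewrite ?in_itv /= ?lexx ?pi_ge0 ?cos_norm ?c1 ?cos0 //.
  rewrite normr_ge0 /= normrM gtr0_norm //.
  by have := zfr_le (s - t); rewrite -/u -(ler_pM2l ple); lra.
by move/eqP; rewrite normr_eq0 mulf_eq0 gt_eqF //= => /eqP.
Qed.

Lemma ce_surj (x : circle R) : exists t, ce t = x.
Proof.
have := circleP x; set x0 := set_val x 0 0; set x1 := set_val x 0 1 => x01.
have x0b : -1 <= x0 <= 1 by rewrite -ler_norml -(@expr_le1 _ 2) // -normrX ger0_norm ?sqr_ge0 //; have := sqr_ge0 x1; lra.
have p0 : 2 * pi != 0 :> R by rewrite mulf_neq0 // gt_eqF // pi_gt0.
have sE : Num.sqrt (1 - x0 ^+ 2) = `|x1| by rewrite -x01 addrC addKr sqrtr_sqr.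
have [h|h] := leP 0 x1.
  exists (acos x0 / (2 * pi)); apply: circle_eq; rewrite !(ce0, ce1) mulrC divfK //.
    by rewrite acosK // in_itv.
  by rewrite sin_acos // sE ger0_norm.
exists (- acos x0 / (2 * pi)); apply: circle_eq; rewrite !(ce0, ce1) mulrC divfK //.
  by rewrite cosN acosK // in_itv.
by rewrite sinN sin_acos // sE ltr0_norm // opprK.
Qed.

Lemma window (a t : R) : exists2 s, a <= s < a + 1 & s - t \is a Num.int.
Proof.
exists (t - (Num.floor (t - a))%:~R); last by rewrite addrAC subrr sub0r rpredN intr_int.
have /andP[] := floor_itv (t - a); rewrite intrD; set k : R := _%:~R => h1 h2.
apply/andP; split; lra.
Qed.

Lemma ce_surj_window (a : R) (x : circle R) : exists2 t, a <= t < a + 1 & ce t = x.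
Proof.
have [t <-] := ce_surj x; have [s sa st] := window a t.
by exists s => //; exact: ce_int.
Qed.

Lemma circle_hausdorff : hausdorff_space (circle R).
Proof. exact/sub_hausdorff/rV_hausdorff. Qed.

(** Any choice of argument will do, since only its class modulo Z is used. *)
Definition ang (x : circle R) : R := projT1 (cid (ce_surj x)).

Lemma angK x : ce (ang x) = x.
Proof. by rewrite /ang; case: cid. Qed.

Lemma ang_ce t : ang (ce t) - t \is a Num.int.
Proof. by apply: ce_inj; rewrite angK. Qed.

Lemma ang_zcont : zcont setT ang.
Proof.
apply: (@compact_map_zcont R _ _ (`[0, 1]%classic : set R) ce setT ang (fun t => t)).
- exact: segment_compact.
- exact/continuous_subspaceT/ce_cont.
- exact: circle_hausdorff.
- move=> x _; have [t /andP[t0 t1] <-] := ce_surj_window 0 x.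
  by rewrite add0r in t1; exists t => //; rewrite /= in_itv /= t0 ltW.
- by apply: zcont_cont; apply: continuous_subspaceT => ?; exact: cvg_id.
- by move=> t _ _; exact: ang_ce.
Qed.

End Circle.
Arguments ce {R} t.

Section Bouquet.
Variables (R : realType) (n : nat) (p : 'I_n.+1 -> circle R).
Local Notation X := (fun _ : 'I_n.+1 => (circle R : topologicalType)).
Local Notation J := (bouquet p).
Local Notation v := (vertex p).

Definition loop i (t : R) : J := wedge_lift p (i := i) (ce (ang (p i) + t)).

Lemma loop_cont i : continuous (loop i).
Proof.
apply: (@cont_comp _ _ _ (fun t => ce (ang (p i) + t)) (@wedge_lift _ X p i)).
  apply: (@cont_comp _ _ _ (fun t => ang (p i) + t)); last exact: ce_cont.
  by apply: contI => t; cont_tac.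
exact: (@wedge_lift_continuous _ X p i).
Qed.

Lemma loop_int i s t : s - t \is a Num.int -> loop i s = loop i t.
Proof. by move=> st; rewrite /loop (@ce_int _ (_ + s) (ang (p i) + t)) // opprD addrACA subrr add0r. Qed.

Lemma loop_vertex i : loop i 0 = v.
Proof. by rewrite /loop addr0 angK; exact: (@wedge_liftE _ X p ord0 (p ord0) i (p i)). Qed.

Lemma loop_int0 i t : t \is a Num.int -> loop i t = v.
Proof. by move=> tZ; rewrite -(loop_vertex i); apply: loop_int; rewrite subr0. Qed.

Lemma loop_surj_window i (x : circle R) a :
  exists2 t, a <= t < a + 1 & loop i t = wedge_lift p (i := i) x.
Proof.
have [t ta tx] := ce_surj_window (ang (p i) + a) x.
exists (t - ang (p i)); last by rewrite /loop addrC subrK tx.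
by move: ta => /andP[t0 t1]; apply/andP; split; lra.
Qed.

Lemma petalP i y : petal (p := p) i y <-> exists t, loop i t = y.
Proof.
split=> [[x _ <-]|[t <-]]; last by eexists.
by have [t _ <-] := loop_surj_window i x 0; exists t.
Qed.

Lemma bouquet_surj (y : J) : exists i, petal (p := p) i y.
Proof.
have : [set: J] y by [].
by rewrite -(@wedgeTE _ X p) => -[i _ [x _ <-]]; exists i, x.
Qed.

Let collapse i k : circle R -> circle R := if k == i then idfun else cst (p i).

Let collapse_base i k l : collapse i k (p k) = collapse i l (p l).
Proof. by rewrite /collapse; case: eqP => [->|_]; case: eqP => [->|_]. Qed.

(** The angle, measured from the vertex, of the image of [y] under the retraction that crushes the
    other petals. It is a non-integer exactly on the open petal [i]. *)
Definition coord i (y : J) : R := ang (@wedge_fun _ X p _ (collapse i) y) - ang (p i).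

Lemma coord_zcont i : zcont setT (coord i).
Proof.
have cw : continuous (@wedge_fun _ X p _ (collapse i)).
  apply: (@wedge_fun_continuous _ X p) => [k|k l]; last exact: collapse_base.
  rewrite /collapse; case: ifP => _; first by apply: contI => x; exact: contId.
  by apply: contI => x; exact: contC.
have := zcontT_comp cw (@ang_zcont R) => z x _ e e0.
have := z x I e e0; apply: near_imp => y /= hy _.
by rewrite /coord opprB addrA subrK; exact: hy.
Qed.

Lemma coord_loop i t : coord i (loop i t) - t \is a Num.int.
Proof.
rewrite /coord /loop (@wedge_lift_funE _ X p); last by move=> k l; exact: collapse_base.
by rewrite /collapse eqxx /= -addrA -opprD; exact: ang_ce.
Qed.

Lemma coord_loop_neq i k t : k != i -> coord i (loop k t) \is a Num.int.
Proof.
move=> ki; rewrite /coord /loop (@wedge_lift_funE _ X p); last by move=> a b; exact: collapse_base.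
by rewrite /collapse (negbTE ki) /= subrr.
Qed.

Lemma coord_vertex i : coord i v \is a Num.int.
Proof. by have := coord_loop i 0; rewrite loop_vertex subr0. Qed.

Lemma loop_inj i s t : loop i s = loop i t -> s - t \is a Num.int.
Proof.
move=> e; have := rpredB (coord_loop i t) (coord_loop i s).
by rewrite e subrACA subrr sub0r opprB.
Qed.

Lemma loop_eq_vertex i t : loop i t = v -> t \is a Num.int.
Proof. by rewrite -(loop_vertex i) => /loop_inj; rewrite subr0. Qed.

Lemma coord_petal i y : coord i y \isn't a Num.int -> y = loop i (coord i y).
Proof.
have [k /petalP[t <-]] := bouquet_surj y.
have [->|ki] := eqVneq k i; last by rewrite coord_loop_neq.
by move=> _; apply: loop_int; rewrite -opprB rpredN coord_loop.
Qed.

Lemma open_petalP i y : open_petal (p := p) i y <-> exists2 t, t \isn't a Num.int & y = loop i t.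
Proof.
split=> [[/petalP[t <-] tv]|[t tZ ->]].
  by exists t => //; apply/negP => tZ; apply: tv; exact: loop_int0.
by split; [apply/petalP; exists t|move=> /loop_eq_vertex; apply/negP].
Qed.

Lemma open_petal_coord i y : open_petal (p := p) i y -> coord i y \isn't a Num.int.
Proof.
move=> /open_petalP[t tZ ->]; apply: contra tZ => cZ.
by rewrite -(subKr (coord i (loop i t)) t) rpredB ?coord_loop.
Qed.

Lemma open_petal_disj i k y : open_petal (p := p) i y -> open_petal (p := p) k y -> i = k.
Proof.
move=> /open_petal_coord ci /open_petalP[t _ e].
apply/eqP; rewrite eq_sym; apply: contraNT ci => ki; rewrite e.
exact: coord_loop_neq.
Qed.

End Bouquet.

Section Disk.
Variable R : realType.

Lemma diskP (z : 'rV[R]_2) : disk R z <-> z 0 0 ^+ 2 + z 0 1 ^+ 2 <= 1.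
Proof.
rewrite /disk /= !big_ord_recl big_ord0 addr0.
by have -> : lift ord0 ord0 = 1 :> 'I_2 by apply: val_inj.
Qed.

Lemma sphere1P (z : 'rV[R]_2) : sphere R 1 z <-> z 0 0 ^+ 2 + z 0 1 ^+ 2 = 1.
Proof.
rewrite /sphere /= !big_ord_recl big_ord0 addr0.
by have -> : lift ord0 ord0 = 1 :> 'I_2 by apply: val_inj.
Qed.

Lemma disk_convex : convex (disk R).
Proof.
move=> x y t /diskP dx /diskP dy /andP[t0 t1]; apply/diskP; rewrite !mxE.
have key (a b : R) : ((1 - t) * a + t * b) ^+ 2 <= (1 - t) * a ^+ 2 + t * b ^+ 2.
  rewrite -subr_ge0 (_ : _ - _ = (1 - t) * t * (a - b) ^+ 2); last by ring.
  by apply: mulr_ge0; [apply: mulr_ge0; rewrite ?subr_ge0|exact: sqr_ge0].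
have := key (x 0 0) (y 0 0); have := key (x 0 1) (y 0 1) => k1 k2.
have h1 : (1 - t) * (x 0 0 ^+ 2 + x 0 1 ^+ 2) <= (1 - t) * 1 by rewrite ler_wpM2l // subr_ge0.
have h2 : t * (y 0 0 ^+ 2 + y 0 1 ^+ 2) <= t * 1 by rewrite ler_wpM2l.
by move: h1 h2; rewrite !mulrDr; lra.
Qed.

Lemma disk0 : disk R 0.
Proof. by apply/diskP; rewrite !mxE expr0n /= addr0. Qed.

Lemma disk_contractible : contractible R (disk R).
Proof. exact: (convex_contractible disk0 disk_convex). Qed.

Lemma disk_compact : compact (disk R).
Proof.
apply: bounded_closed_compact.
  exists 1; split; first exact: num_real.
  move=> M M1 x /diskP x1 /=; apply: le_trans (ltW M1).
  have -> : `|x| = mx_norm x by [].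
  rewrite mx_normrE; apply: bigmax_le => // -[i j] _ /=; rewrite (ord1 i).
  rewrite -(@expr_le1 _ 2) // -normrX ger0_norm ?sqr_ge0 //.
  by have := sqr_ge0 (x 0 0); have := sqr_ge0 (x 0 1); have [->|->] := ord2P j; lra.
have -> : disk R = (fun x : 'rV[R]_2 => x 0 0 * x 0 0 + x 0 1 * x 0 1) @^-1` [set x : R | x <= 1].
  by apply/seteqP; split=> x; rewrite diskP /= !expr2.
apply: closed_pre; last exact: closed_le.
apply: contI => x; have c0 : {for x, continuous (fun x : 'rV[R]_2 => x 0 0)} by exact: coord_cont.
have c1 : {for x, continuous (fun x : 'rV[R]_2 => x 0 1)} by exact: coord_cont.
by cont_tac.
Qed.

Lemma diskT_compact : compact [set: disk R].
Proof. exact: sub_compact disk_compact. Qed.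

Lemma disk_hausdorff : hausdorff_space (disk R).
Proof. exact/sub_hausdorff/rV_hausdorff. Qed.

Lemma bdry_val (x : circle R) : set_val (bdry_incl R x) = set_val x.
Proof. by []. Qed.

Lemma bdry_inj : injective (bdry_incl R).
Proof. by move=> x y e; apply: set_val_inj; rewrite -!bdry_val e. Qed.

Lemma bdry_cont : continuous (bdry_incl R).
Proof. by apply: sub_cont; exact: set_val_continuous. Qed.

Lemma bdryP (z : disk R) : set_val z 0 0 ^+ 2 + set_val z 0 1 ^+ 2 = 1 <->
  exists x, bdry_incl R x = z.
Proof.
split=> [/sphere1P h|[x <-]]; last by rewrite bdry_val; exact: circleP.
by exists (mk_sub h); apply: set_val_inj.
Qed.

End Disk.

Lemma quotient_proj_cont (X : topologicalType) (r : X -> X -> Prop) :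
  continuous (quotient_proj r).
Proof. exact: (@pi_continuous _ (quotient_space r)). Qed.

Section Complex.
Variables (R : realType) (n : nat) (p : 'I_n.+1 -> circle R) (f : circle R -> bouquet p).
Local Notation Q := (one_relator_complex f).
Local Notation q := (disk_to_complex f).
Local Notation jq := (bouquet_to_complex f).
Local Notation bd := (bdry_incl R).

Lemma q_bdry x : q (bd x) = jq (f x).
Proof. by apply/eqmodP/asboolP; apply: rst_step; exists x. Qed.

Lemma q_cont : continuous q.
Proof.
have h := @existT_continuous bool (@summand (disk R) (bouquet p)) false.
exact: (cont_comp h (@quotient_proj_cont _ (attach_step bd f))).
Qed.

Lemma jq_cont : continuous jq.
Proof.
have h := @existT_continuous bool (@summand (disk R) (bouquet p)) true.
exact: (cont_comp h (@quotient_proj_cont _ (attach_step bd f))).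
Qed.

(** A normal form for the points of the attaching space: boundary points of the disk are moved to
    their image in the bouquet. It is invariant under the gluing, so it detects which points are
    identified. *)
Let code (s : {b & @summand (disk R) (bouquet p) b}) : disk R + bouquet p :=
  match s with
  | existT true y => inr y
  | existT false z => if pselect (exists x, bd x = z) is left h
                      then inr (f (projT1 (cid h))) else inl z
  end.

Let code_bdry x : code (existT _ false (bd x)) = inr (f x).
Proof.
rewrite /code; case: pselect => [h|[]]; last by exists x.
by case: cid => y /= /bdry_inj ->.
Qed.

Let code_eq s t : quotient_proj (attach_step bd f) s = quotient_proj (attach_step bd f) t ->
  code s = code t.
Proof.
move/eqmodP/asboolP; elim=> [a b [x [-> ->]]|//|a b _ ->//|a b c _ -> _ ->//].
exact: code_bdry.
Qed.

Lemma jq_inj : injective jq.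
Proof. by move=> y y' /code_eq [->]. Qed.

Lemma q_eq z z' : q z = q z' ->
  z = z' \/ exists x x', [/\ z = bd x, z' = bd x' & f x = f x'].
Proof.
move/code_eq; rewrite /code; case: pselect => h; case: pselect => h' //.
  by case: cid => x /= <-; case: cid => x' /= <- [e]; right; exists x, x'.
by move=> [->]; left.
Qed.

Lemma q_surj : (forall y, exists x, f x = y) -> forall a : Q, exists z, q z = a.
Proof.
move=> fs a; have := reprK a; case: (repr a) => -[] w <-; last by exists w.
by have [x <-] := fs w; exists (bd x); exact: q_bdry.
Qed.

End Complex.

(** * Arcs of a taut map *)

Section RealFunctions.
Variable R : realType.
Implicit Types h : R -> R.

Lemma IVT_between h a b w : continuous h -> a <= b -> (h a <= w <= h b) || (h b <= w <= h a) ->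
  exists2 c, a <= c <= b & h c = w.
Proof.
move=> ch ab hw; have ch' : {within `[a, b], continuous h} by exact: continuous_subspaceT.
have [|c] := IVT ab ch' (v := w); last by rewrite in_itv /=; exists c.
by move: hw => /orP[] /andP[h1 h2]; apply/andP; split; rewrite ?ge_min ?le_max ?h1 ?h2 ?orbT.
Qed.

(** If [h] is not constant, the value halfway between [h a] and some other [h c] is taken on both
    sides of [c]. *)
Lemma real_not_inj h a b : continuous h -> a < b -> h a = h b ->
  exists s t, [/\ a < s, s < t, t < b & h s = h t].
Proof.
move=> ch ab hab.
have [[c /andP[ac cb] hc]|hconst] := pselect (exists2 c, a < c < b & h c != h a); last first.
  have E c : a < c < b -> h c = h a.
    by move=> cab; apply: contrapT => /eqP hc; apply: hconst; exists c.
  exists ((2 * a + b) / 3), ((a + 2 * b) / 3); split; try lra.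
  by rewrite !E //; apply/andP; split; lra.
pose w := (h a + h c) / 2.
have wa : w != h a by apply: contraNneq hc => ww; apply/eqP; rewrite /w in ww; lra.
have wc : w != h c by apply: contraNneq hc => ww; apply/eqP; rewrite /w in ww; lra.
have [|s /andP[as_ sc] hs] := @IVT_between h a c w ch (ltW ac).
  by rewrite /w; case: (ltP (h a) (h c)) => hh; apply/orP; [left|right]; apply/andP; split; lra.
have [|t /andP[ct tb] ht] := @IVT_between h c b w ch (ltW cb).
  by rewrite /w -hab; case: (ltP (h a) (h c)) => hh; apply/orP; [right|left]; apply/andP; split; lra.
exists s, t; split; last by rewrite hs ht.
- by rewrite lt_neqAle as_ andbT; apply: contraNneq wa => ->; rewrite hs.
- apply: lt_le_trans ct; rewrite lt_neqAle sc andbT; apply: contraNneq wc => <-; by rewrite hs.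
- by rewrite lt_neqAle tb andbT; apply: contraNneq wa => tb'; rewrite hab -tb' ht.
Qed.

Lemma int_between (u : R) : u \is a Num.int -> 0 <= u <= 1 -> u = 0 \/ u = 1.
Proof.
move=> /intrP[k ->]; rewrite (ler_int R 0) (ler_int R k 1) => k01.
have [k0 k1] := andP k01.
have [->|->] : k = 0 \/ k = 1 by lia.
  by left.
by right.
Qed.

End RealFunctions.

Definition orient (R : realType) (o : bool) (u : R) : R := if o then u else 1 - u.

Section Arcs.
Variables (R : realType) (n : nat) (p : 'I_n.+1 -> circle R) (f : circle R -> bouquet p).
Local Notation v := (vertex p).
Local Notation F := (fun t => f (ce t)).

(* [o] is the direction in which the petal is traversed. *)
Definition is_arc (a b : R) (i : 'I_n.+1) (o : bool) (beta : R -> R) : Prop :=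
  [/\ continuous beta, beta a = 0, beta b = 1,
      {in `[a, b] &, {mono beta : x y / x <= y}} &
      forall t, a <= t <= b -> F t = loop p i (orient o (beta t))].

Hypotheses (fc : continuous f) (ft : taut f).

Lemma F_cont : continuous F.
Proof. exact: (cont_comp (@ce_cont R) fc). Qed.

Lemma ce_itv_connected (a b : R) : connected (ce @` `]a, b[%classic).
Proof.
apply: connected_continuous_connected; first exact/connected_intervalP/interval_is_interval.
exact/continuous_subspaceT/ce_cont.
Qed.

(** By tautness the open arc goes injectively into one open petal [i]. A real lift of [coord i]
    along it meets no integer inside, so it stays between consecutive integers and ends at them.
    Equal ends are excluded by [real_not_inj], so after a shift it runs monotonically through
    [0, 1], up or down. *)
Lemma arc_exists a b : a < b -> b <= a + 1 -> F a = v -> F b = v ->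
  (forall t, a < t < b -> F t <> v) -> exists i o beta, is_arc a b i o beta.
Proof.
move=> ab ba Fa Fb Fn.
pose m := (a + b) / 2.
have mab : a < m < b by rewrite /m; apply/andP; split; lra.
have [i [[Himg Hinj _] _ _]] := ft (Fn m mab).
have inC t : a < t < b -> connected_component (~` (f @^-1` [set v])) (ce m) (ce t).
  move=> tab; exists (ce @` `]a, b[%classic); last by exists t => //=; rewrite in_itv.
  split; last exact: ce_itv_connected.
  - by exists m => //=; rewrite in_itv.
  - by move=> _ [s /= sab <-]; move: sab; rewrite in_itv /= => sab /=; exact: Fn.
have Fp t : a < t < b -> open_petal (p := p) i (F t).
  by move=> tab; apply: Himg; exact: inC.
have Finj s t : a < s < b -> a < t < b -> F s = F t -> s = t.
  move=> sab tab e; have : ce s = ce t by apply: Hinj; rewrite ?inE //; exact: inC.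
  move/ce_inj/int_small => h; apply/eqP; rewrite -subr_eq0; apply/eqP/h.
  by move: sab tab => /andP[s1 s2] /andP[t1 t2]; rewrite ltr_norml; apply/andP; split; lra.
have zF : zcont setT (fun t => coord i (F t)) by exact: (zcontT_comp F_cont (@coord_zcont _ _ p i)).
have [h [ch hZ]] := real_zcont_lift zF (ltW ab).
have hn t : a < t < b -> h t \isn't a Num.int.
  move=> tab; apply: contra (open_petal_coord (Fp t tab)) => hZt.
  have tab' : a <= t <= b by move: tab => /andP[/ltW -> /ltW ->].
  by rewrite -(subKr (h t) (coord i (F t))) rpredB // hZ.
have hend t : a <= t <= b -> F t = v -> h t \is a Num.int.
  by move=> tab Ft; rewrite -(subrK (coord i (F t)) (h t)) rpredD ?hZ // Ft; exact: coord_vertex.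
pose k : R := (Num.floor (h m))%:~R.
have kZ : k \is a Num.int by exact: intr_int.
have [km mk] : k < h m /\ h m < k + 1.
  have /andP[] := floor_itv (h m); rewrite intrD => h1 h2; split=> //.
  rewrite lt_neqAle h1 andbT; apply: contraNneq (hn m mab) => <-; exact: intr_int.
pose al t := h t - k.
have cal : continuous al by apply: contI => t; have := ch t => ?; rewrite /al; cont_tac.
have noint t w : a <= t <= b -> w \is a Num.int -> (al m < w < al t) || (al t < w < al m) -> False.
  move=> /andP[at_ tb] wZ hw.
  have key c : (m <= c <= t) || (t <= c <= m) -> al c = w -> False.
    move=> hc cw; have cZ : h c \is a Num.int by rewrite -(subrK k (h c)) rpredD // -[h c - k]/(al c) cw.
    have cm : c != m by apply: contraTneq cZ => ->; exact: hn.
    have ct : c != t by apply: contraTneq hw => e; rewrite -cw e !ltxx andbF.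
    suff : a < c < b by move/hn; rewrite cZ.
    have [m1 m2] := andP mab.
    case/orP: hc => /andP[c1 c2]; apply/andP; split.
    - exact: lt_le_trans m1 c1.
    - by apply: lt_le_trans tb; rewrite lt_neqAle ct.
    - by apply: le_lt_trans at_ _; rewrite lt_neqAle eq_sym ct.
    - exact: le_lt_trans c2 m2.
  have [mt|tm] := leP m t.
    have [|c c1 c2] := @IVT_between _ al m t w cal mt; last by apply: (key c) => //; rewrite c1.
    by move: hw => /orP[]/andP[h1 h2]; apply/orP; [left|right]; apply/andP; split; lra.
  have [|c c1 c2] := @IVT_between _ al t m w cal (ltW tm); last by apply: (key c) => //; rewrite c1 orbT.
  by move: hw => /orP[]/andP[h1 h2]; apply/orP; [right|left]; apply/andP; split; lra.
have al01 t : a <= t <= b -> 0 <= al t <= 1.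
  move=> tab; apply/andP; split; rewrite leNgt; apply/negP => hh.
    by apply: (noint t 0 tab (rpred0 _)); apply/orP; right; rewrite hh /al subr_gt0.
  by apply: (noint t 1 tab (rpred1 _)); apply/orP; left; rewrite hh /al ltrBlDl andbT.
have alZ t : a <= t <= b -> al t - coord i (F t) \is a Num.int.
  by move=> tab; rewrite /al addrAC rpredB // hZ.
have ale t : a <= t <= b -> F t = loop p i (al t).
  move=> tab.
  have [at_|at_] := eqVneq a t; first by rewrite -at_ Fa loop_int0 // rpredB // hend // lexx ltW.
  have [tb|tb] := eqVneq t b; first by rewrite tb Fb loop_int0 // rpredB // hend // lexx ltW.
  have tab' : a < t < b by move: tab => /andP[h1 h2]; rewrite !lt_neqAle at_ h1 tb h2.
  rewrite (coord_petal (open_petal_coord (Fp t tab'))); apply: loop_int.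
  by rewrite -opprB rpredN alZ.
have aab : a <= a <= b by rewrite lexx ltW.
have bab : a <= b <= b by rewrite lexx ltW.
have ala : al a = 0 \/ al a = 1 by apply: int_between; [rewrite rpredB // hend|exact: al01].
have alb : al b = 0 \/ al b = 1 by apply: int_between; [rewrite rpredB // hend|exact: al01].
have alinj s t : a < s < b -> a < t < b -> al s = al t -> s = t.
  move=> /[dup] sab /andP[/ltW s1 /ltW s2] /[dup] tab /andP[/ltW t1 /ltW t2] e; apply: Finj => //.
  by rewrite !ale ?s1 ?t1 // e.
have alab : al a <> al b.
  move=> e; have [s [t [as_ st tb est]]] := real_not_inj cal ab e.
  have := alinj s t; rewrite as_ tb (lt_trans st tb) (lt_trans as_ st) => /(_ isT isT est).
  by move=> e'; rewrite e' ltxx in st.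
have alint t : a < t < b -> al t \isn't a Num.int.
  by move=> tab; apply: contra (hn t tab) => tZ; rewrite -(subrK k (h t)) rpredD.
have injall : {in `[a, b] &, injective al}.
  move=> s t; rewrite !in_itv /= => sab tab e.
  have cases u : a <= u <= b -> [\/ u = a, u = b | a < u < b].
    move=> /andP[]; rewrite le_eqVlt => /orP[/eqP <-|h1]; first by constructor 1.
    by rewrite le_eqVlt => /orP[/eqP ->|h2]; [constructor 2|constructor 3; rewrite h1].
  have aZ : al a \is a Num.int by case: ala => ->; [exact: rpred0|exact: rpred1].
  have bZ : al b \is a Num.int by case: alb => ->; [exact: rpred0|exact: rpred1].
  have [sa|sb|sab'] := cases s sab; have [ta|tb|tab'] := cases t tab; subst => //.
  - by have := alint t tab'; rewrite -e aZ.
  - by move/esym: e.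
  - by have := alint t tab'; rewrite -e bZ.
  - by have := alint s sab'; rewrite e aZ.
  - by have := alint s sab'; rewrite e bZ.
  - exact: alinj.
have cw : {within `[a, b], continuous al} by exact: continuous_subspaceT.
have [a0|a1] := ala.
  have b1 : al b = 1 by case: alb => // b0; rewrite a0 b0 in alab.
  exists i, true, al; split=> // s t ss tt.
  by apply: (segment_continuous_inj_le _ cw injall) => //; rewrite a0 b1.
have b0 : al b = 0 by case: alb => // b1; rewrite a1 b1 in alab.
exists i, false, (fun t => 1 - al t); split; rewrite ?a1 ?b0 ?subrr ?subr0 //.
- by apply: contI => t; have := cal t => ?; cont_tac.
- move=> s t ss tt; rewrite lerD2l lerN2.
  by apply: (segment_continuous_inj_ge _ cw injall) => //; rewrite a1 b0.
- by move=> t tab; rewrite /orient subKr ale.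
Qed.

End Arcs.

Section ArcSequence.
Variables (R : realType) (n : nat) (p : 'I_n.+1 -> circle R) (f : circle R -> bouquet p).
Local Notation v := (vertex p).
Local Notation F := (fun t => f (ce t)).

Definition arc_seq (M : nat) (th : nat -> R) (io : nat -> 'I_n.+1) (o : nat -> bool)
    (be : nat -> R -> R) : Prop :=
  [/\ (0 < M)%N, th M = th 0 + 1, forall j, (j < M)%N -> th j < th j.+1 &
      forall j, (j < M)%N -> is_arc f (th j) (th j.+1) (io j) (o j) (be j)].

Lemma locate (th : nat -> R) M t : th 0%N <= t < th M ->
  exists2 j, (j < M)%N & th j <= t < th j.+1.
Proof.
elim: M => [|M IH] /andP[t0 tM]; first by have := le_lt_trans t0 tM; rewrite ltxx.
have [h|h] := ltP t (th M); last by exists M; rewrite ?h.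
by have [|j jM hj] := IH; [rewrite t0|exists j => //; exact: ltnW].
Qed.

Lemma window_small (a s t : R) : a <= s < a + 1 -> a <= t < a + 1 ->
  s - t \is a Num.int -> s = t.
Proof.
move=> /andP[s1 s2] /andP[t1 t2] /int_small h; apply/eqP; rewrite -subr_eq0; apply/eqP/h.
by rewrite ltr_norml; apply/andP; split; lra.
Qed.

Lemma arc_inside a b i o be t : is_arc f a b i o be -> a < t < b -> 0 < be t < 1.
Proof.
move=> [_ b0 b1 mono _] /andP[at_ tb].
have ab := lt_trans at_ tb.
have inI : (t \in `[a, b]) /\ (a \in `[a, b]) /\ (b \in `[a, b]).
  by rewrite !in_itv /= !lexx (ltW at_) (ltW tb) (ltW ab).
case: inI => [it [ia ib]].
by rewrite -b0 -b1 !(leW_mono_in mono) // at_ tb.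
Qed.

Lemma orient_int (o : bool) (u : R) : orient o u \is a Num.int -> u \is a Num.int.
Proof. by case: o => //= h; rewrite -(subKr 1 u) rpredB ?rpred1. Qed.

Lemma arc_open a b i o be t : is_arc f a b i o be -> a < t < b -> open_petal (p := p) i (F t).
Proof.
move=> A tab; have /andP[b0 b1] := arc_inside A tab; have [_ _ _ _ AF] := A.
have /andP[at_ tb] := tab.
apply/open_petalP; exists (orient o (be t)); last by rewrite AF // !ltW.
apply/negP => /orient_int /int_small; rewrite ger0_norm ?ltW // => /(_ b1) b00.
by rewrite b00 ltxx in b0.
Qed.

Hypotheses (fa : attaching_map f) (ft : taut f) (fu : unexposed f).

(** If [f] missed the vertex, the circle would be a single component sent into one open petal by
    tautness; but the preimage of the open petal [ord0] has two components. *)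
Lemma zero_exists : exists x, f x = v.
Proof.
have [fc _] := fa; apply: contrapT => nz.
have cT : connected [set: circle R].
  have -> : [set: circle R] = ce @` [set: R].
    by apply/seteqP; split=> // x _; have [t <-] := ce_surj x; exists t.
  apply: connected_continuous_connected; last exact/continuous_subspaceT/ce_cont.
  by apply/connected_intervalP => x y _ _ z _.
have all (x : circle R) : connected_component setT x = setT.
  by apply/seteqP; split=> // y _; exists setT.
have nT : ~` (f @^-1` [set v]) = setT.
  by apply/seteqP; split=> // x _ fx; apply: nz; exists x.
have [x [y [fx fy xy]]] := fu ord0.
have [i [[img _ _] _ _]] := ft (fun e => nz (ex_intro _ x e)).
have fi z : open_petal (p := p) i (f z) by apply: img; rewrite nT all.
have i0 : i = ord0 by exact: open_petal_disj (fi x) fx.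
have e : f @^-1` open_petal ord0 = setT by apply/seteqP; split=> // z _ /=; rewrite -i0.
by apply: xy; rewrite e !all.
Qed.

Lemma arc_seq_exists th0 : F th0 = v -> exists M th io o be, arc_seq M th io o be /\ th 0%N = th0.
Proof.
move=> F0; have [fc fz] := fa.
pose Z := [set t | th0 <= t <= th0 + 1 /\ F t = v].
have Zf : finite_set Z.
  pose w x := projT1 (cid2 (ce_surj_window th0 x)).
  apply: (@sub_finite_set _ _ ([set th0 + 1] `|` w @` (f @^-1` [set v]))); last first.
    by rewrite finite_setU; split; [exact: finite_set1|exact: finite_image].
  move=> t [/andP[t0 t1] Ft]; have [->|tn] := eqVneq t (th0 + 1); [by left|right].
  exists (ce t) => //; rewrite /w; case: cid2 => s /= sw es.
  by apply: (window_small sw); rewrite ?t0 ?lt_neqAle ?tn //; exact: ce_inj.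
have [s sE] := (finite_seqP _).1 Zf.
pose s' := sort <=%R (undup s).
have s'Z t : (t \in s') = `[< Z t >].
  by rewrite mem_sort mem_undup; apply/idP/asboolP; rewrite sE.
have ss : sorted <%R s'.
  by rewrite lt_sorted_uniq_le sort_uniq undup_uniq sort_sorted //; exact: le_total.
have nthlt i j : (i < j)%N -> (j < size s')%N -> nth 0 s' i < nth 0 s' j.
  move=> ij js; apply: (sorted_ltn_nth lt_trans 0 ss); rewrite ?inE //.
  exact: ltn_trans js.
have nthZ i : (i < size s')%N -> Z (nth 0 s' i).
  by move=> si; apply/asboolP; rewrite -s'Z mem_nth.
have in0 : th0 \in s' by rewrite s'Z; apply/asboolP; split=> //; rewrite lexx; lra.
have in1 : th0 + 1 \in s'.
  by rewrite s'Z; apply/asboolP; split; [rewrite lexx; lra|rewrite ce_add1].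
have i0 : index th0 s' = 0%N.
  apply/eqP; rewrite -leqn0 leqNgt; apply/negP => h.
  have hs : (index th0 s' < size s')%N by rewrite index_mem.
  have := nthlt _ _ h hs; rewrite nth_index //.
  have [/andP[h1 _] _] := nthZ 0%N (ltn_trans h hs).
  by rewrite ltNge h1.
have sz : (0 < size s')%N by rewrite -i0 index_mem.
have e0 : nth 0 s' 0 = th0 by rewrite -i0 nth_index.
have i1 : index (th0 + 1) s' = (size s').-1.
  apply/eqP; rewrite eqn_leq -ltnS prednK // index_mem in1 /= leqNgt; apply/negP => h.
  have hs : ((size s').-1 < size s')%N by rewrite prednK.
  have := nthlt _ _ h hs; rewrite nth_index //.
  have [/andP[_ h1] _] := nthZ _ hs.
  by rewrite ltNge h1.
have e1 : nth 0 s' (size s').-1 = th0 + 1 by rewrite -i1 nth_index.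
pose M := (size s').-1.
have MS : size s' = M.+1 by rewrite prednK.
have M0 : (0 < M)%N.
  by rewrite lt0n; apply/eqP => M00; move: e1; rewrite -/M M00 e0; lra.
have arcs j : (j < M)%N -> exists iob : 'I_n.+1 * bool * (R -> R),
    is_arc f (nth 0 s' j) (nth 0 s' j.+1) iob.1.1 iob.1.2 iob.2.
  move=> jM; have j1 : (j.+1 < size s')%N by rewrite MS ltnS.
  have j0 : (j < size s')%N by exact: ltnW.
  have [/andP[l0 u0] z0] := nthZ _ j0; have [/andP[l1 u1] z1] := nthZ _ j1.
  have [||i [o [be A]]] := arc_exists fc ft (nthlt j j.+1 (ltnSn j) j1) _ z0 z1; last by exists (i, o, be).
    by apply: le_trans u1 _; rewrite lerD2r.
  move=> t /andP[tj jt] Ft.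
  have : t \in s'.
    rewrite s'Z; apply/asboolP; split=> //.
    by rewrite (le_trans l0 (ltW tj)) (le_trans (ltW jt) u1).
  move=> ts; have ti : (index t s' < size s')%N by rewrite index_mem.
  have [h|h] := leqP (index t s') j.
    suff : t <= nth 0 s' j by rewrite leNgt tj.
    rewrite -[X in X <= _](nth_index 0 ts); move: h; rewrite leq_eqVlt => /orP[/eqP ->//|h].
    exact/ltW/nthlt.
  suff : nth 0 s' j.+1 <= t by rewrite leNgt jt.
  rewrite -[X in _ <= X](nth_index 0 ts); move: h; rewrite leq_eqVlt => /orP[/eqP ->//|h].
  exact/ltW/nthlt.
pose P j (iob : 'I_n.+1 * bool * (R -> R)) := (j < M)%N -> is_arc f (nth 0 s' j) (nth 0 s' j.+1) iob.1.1 iob.1.2 iob.2.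
have exP j : exists iob, P j iob.
  have [jM|jM] := ltnP j M; first by have [iob A] := arcs j jM; exists iob.
  by exists (ord0, true, id); rewrite /P ltnNge jM.
have [c cP] := choice exP.
exists M, (fun j => nth 0 s' j), (fun j => (c j).1.1), (fun j => (c j).1.2), (fun j => (c j).2).
split=> //; split; [exact: M0|by rewrite e1 e0| |exact: cP].
by move=> j jM; apply: nthlt; rewrite // MS ltnS.
Qed.

Variables (M : nat) (th : nat -> R) (io : nat -> 'I_n.+1) (o : nat -> bool) (be : nat -> R -> R).
Hypothesis A : arc_seq M th io o be.

Lemma th_vertex j : (j <= M)%N -> F (th j) = v.
Proof.
have [M0 _ ths arcs] := A; rewrite leq_eqVlt => /orP[/eqP ->|jM].
  case: M M0 ths arcs => // m _ ths arcs.
  have [_ _ b1 _ AF] := arcs m (ltnSn m).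
  rewrite AF; last by rewrite lexx andbT ltW // ths.
  by rewrite b1 loop_int0 // /orient; case: (o m); rewrite ?subrr ?rpred0 ?rpred1.
have [_ b0 _ _ AF] := arcs j jM.
rewrite AF; last by rewrite lexx ltW // ths.
by rewrite b0 loop_int0 // /orient; case: (o j); rewrite ?subr0 ?rpred0 ?rpred1.
Qed.

(** The interior of an arc is connected, so points in different components of the preimage of the
    open petal lie on different arcs. *)
Lemma petal_two_arcs i : exists j k, [/\ (j < M)%N, (k < M)%N, j <> k, io j = i & io k = i].
Proof.
have [M0 thM ths arcs] := A.
have [x [y [fx fy xy]]] := fu i.
have loc z : (f @^-1` open_petal i) z ->
    exists j s, [/\ (j < M)%N, th j < s < th j.+1, ce s = z & io j = i].
  move=> fz; have [s sw sz] := ce_surj_window (th 0) z.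
  rewrite -thM in sw; have [j jM /andP[js sj]] := locate sw.
  have sn : th j != s.
    apply/eqP => e; move: fz; rewrite /= -sz -e => -[_]; apply.
    by apply: th_vertex; exact: ltnW.
  have js' : th j < s < th j.+1 by rewrite lt_neqAle sn js sj.
  exists j, s; split=> //; apply: (@open_petal_disj _ _ _ _ _ (F s)).
    exact: arc_open (arcs j jM) js'.
  by rewrite sz.
have [j [s [jM js sx ji]]] := loc x fx; have [k [t [kM kt ty ki]]] := loc y fy.
exists j, k; split=> // jk; subst k; apply: xy.
have sub : ce @` `]th j, th j.+1[%classic `<=` f @^-1` open_petal i.
  move=> _ [u /= uj <-]; rewrite -ji; apply: arc_open (arcs j jM) _.
  by move: uj; rewrite in_itv.
have cmem w : th j < w < th j.+1 -> (ce @` `]th j, th j.+1[%classic) (ce w).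
  by move=> hw; exists w => //=; rewrite in_itv.
apply: same_connected_component; exists (ce @` `]th j, th j.+1[%classic).
  split=> //; last exact: ce_itv_connected.
  by rewrite -sx; exact: cmem.
by rewrite -ty; exact: cmem.
Qed.

Lemma f_surj y : exists x, f x = y.
Proof.
have [i yi] := bouquet_surj y.
have [j [_ [jM _ _ ji _]]] := petal_two_arcs i.
have [_ _ ths arcs] := A; have [cb b0 b1 _ AF] := arcs j jM.
have [t ty] := (petalP i y).1 yi.
have [s /andP[s0 s1] st] := window 0 t.
have hs : 0 <= orient (o j) s <= 1.
  rewrite add0r in s1; rewrite /orient; case: (o j); apply/andP; split; rewrite ?subr_ge0 //; try exact: ltW.
  by rewrite lerBlDr lerDl.
have [|c cj bc] := IVT_between cb (ltW (ths j jM)) (w := orient (o j) s).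
  by rewrite b0 b1 hs.
exists (ce c); rewrite AF // ji bc -ty; apply: loop_int.
suff -> : orient (o j) (orient (o j) s) = s by [].
by rewrite /orient; case: (o j); rewrite ?subKr.
Qed.

End ArcSequence.

(** * Unicoherence and functions on the pieces of a splitting *)

Section Unicoherence.
Variables (R : realType) (T : topologicalType).
Hypotheses (cT : compact [set: T]) (hT : hausdorff_space T) (kT : contractible R T).

(* An integer cocycle on the intersection of two closed sets covering a
   contractible space is a coboundary: extend it to [W1] by real values, close
   it up by [0] on the rest of [W2], and lift the resulting circle-valued map. *)
Lemma unicoherence (W1 W2 : set T) (c : T -> R) :
  closed W1 -> closed W2 -> W1 `|` W2 = setT ->
  {within W1 `&` W2, continuous c} -> (forall z, (W1 `&` W2) z -> c z \is a Num.int) ->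
  exists a b : T -> R,
    [/\ {within W1, continuous a}, {within W2, continuous b},
        forall z, W1 z -> a z \is a Num.int, forall z, W2 z -> b z \is a Num.int &
        forall z, (W1 `&` W2) z -> c z = a z - b z].
Proof.
move=> c1 c2 c12 cc cZ.
have cI : compact (W1 `&` W2).
  by apply: (@subclosed_compact _ _ setT) => //; exact: closedI.
have [M M0 cM] : exists2 M : R, 0 < M & forall z, (W1 `&` W2) z -> `|c z| <= M.
  have /compact_bounded[M [_ hM]] := continuous_compact cc cI.
  exists (Num.max 1 (M + 1)); first by rewrite lt_max ltr01.
  move=> z Wz; apply: hM; last by exists z.
  by rewrite lt_max ltrDl ltr01 orbT.
have [g [gc cg _]] := continuous_bounded_extension (compact_normal hT cT) (closedI c1 c2) M0 cc cM.
pose psi z : R := if pselect (W1 z) then g z else 0.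
have psi1 z : W1 z -> psi z = g z by rewrite /psi; case: pselect.
have psi0 z : ~ W1 z -> psi z = 0 by rewrite /psi; case: pselect.
(* The switch between [g] and 0 happens at points of both sets; there [g] is an integer, so the jump
   is invisible modulo Z. *)
have zpsi : zcont setT psi.
  move=> x _ e e0.
  have gx : \forall y \near x, `|zfr (g y - g x)| < e.
    have : zcont setT g by apply: zcont_cont; apply: continuous_subspaceT.
    by move/(_ x I e e0); apply: near_imp => y; apply.
  have [x1|x1] := pselect (W1 x); last first.
    have : nbhs x (~` W1) by apply: open_nbhs_nbhs; split=> //; exact: closed_openC.
    apply: near_imp => y y1 _; rewrite !psi0 //.
    by rewrite subrr zfr_int0 ?rpred0 ?normr0.
  have [x2|x2] := pselect (W2 x); last first.
    have : nbhs x (~` W2) by apply: open_nbhs_nbhs; split=> //; exact: closed_openC.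
    move=> h; have := near_andb gx h; apply: near_imp => y [hy y2] _.
    have y1 : W1 y by have [//|] : (W1 `|` W2) y by rewrite c12.
    by rewrite !psi1.
  have gZ : g x \is a Num.int by rewrite -gc ?inE //; exact: cZ.
  apply: near_imp gx => y hy _; rewrite (psi1 x) //.
  have [y1|y1] := pselect (W1 y); first by rewrite psi1.
  by rewrite psi0 // sub0r zfrN zfr_int0 ?normr0.
have [h [ch hZ]] := zcont_lift cT kT zpsi.
exists (fun z => g z - h z), (fun z => - h z); split.
- apply: continuous_subspaceT; apply: contI => z.
  have cgz : {for z, continuous g} by exact: cg.
  have chz : {for z, continuous h} by exact: ch.
  by cont_tac.
- apply: continuous_subspaceT; apply: contI => z.
  have chz : {for z, continuous h} by exact: ch.
  by cont_tac.
- move=> z z1; have := hZ z; rewrite psi1 //.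
  by rewrite -rpredN opprB.
- move=> z z2; rewrite rpredN; have := hZ z; have [z1|z1] := pselect (W1 z); last by rewrite psi0 // subr0.
  have gZ : g z \is a Num.int by rewrite -gc ?inE //; exact: cZ.
  by move=> h1; rewrite -(subrK (psi z) (h z)) rpredD // psi1.
- by move=> z z12; rewrite opprK subrK; apply: gc; rewrite inE.
Qed.

End Unicoherence.

Section SineSign.
Variable R : realType.

Lemma sin_pi_gt0 (s : R) : 0 < s < 1 -> 0 < sin (pi * s).
Proof.
move=> /andP[s0 s1]; apply: sin_gt0_pi; rewrite mulr_gt0 ?pi_gt0 //=.
by rewrite -[X in _ < X]mulr1 ltr_pM2l // pi_gt0.
Qed.

Lemma sin_pi_lt0 (s : R) : -1 < s < 0 -> sin (pi * s) < 0.
Proof.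
move=> /andP[s0 s1]; rewrite -oppr_gt0 -sinN -mulrN; apply: sin_pi_gt0.
by rewrite oppr_gt0 s1 /= ltrNl.
Qed.

Lemma sin_pi_eq0 (s : R) : `|s| < 1 -> sin (pi * s) = 0 -> s = 0.
Proof.
rewrite ltr_norml => /andP[s0 s1] e; case: (ltgtP s 0) => // h.
  by have := @sin_pi_lt0 s; rewrite s0 h e ltxx => /(_ isT).
by have := @sin_pi_gt0 s; rewrite s1 h e ltxx => /(_ isT).
Qed.

End SineSign.

Section Descend.
Variables (R : realType) (n : nat) (p : 'I_n.+1 -> circle R) (f : circle R -> bouquet p).
Local Notation Q := (one_relator_complex f).
Local Notation q := (disk_to_complex f).
Local Notation jq := (bouquet_to_complex f).
Local Notation bd := (bdry_incl R).
Local Notation F := (fun t => f (ce t)).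
Variables (SQ : pl_structure R Q) (C : set Q).
Hypotheses (fc : continuous f) (fs : forall y, exists x, f x = y).
Hypotheses (polyC : subpolyhedron SQ C) (finC : finite_set (H1 R C)).

(** The form in which finite homology is used from here on: a circle-valued function on the disk
    side, compatible modulo Z with the identifications on the boundary, passes to [C] and lifts
    there to a real function. *)
Lemma descend (u : disk R -> R) : zcont (q @^-1` C) u ->
  (forall x x', f x = f x' -> C (q (bd x)) -> u (bd x) - u (bd x') \is a Num.int) ->
  exists h : Q -> R, {within C, continuous h} /\
    forall z, C (q z) -> h (q z) - u z \is a Num.int.
Proof.
move=> zu uf.
pose sec a := projT1 (cid (q_surj fs a)).
have secK a : q (sec a) = a by exact: projT2 (cid (q_surj fs a)).
have secZ z : C (q z) -> u (sec (q z)) - u z \is a Num.int.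
  move=> Cz; have [->|[x [x' [e1 e2 e3]]]] := q_eq (secK (q z)); first by rewrite subrr rpred0.
  have Cx : C (q (bd x)) by rewrite -e1 secK.
  by rewrite e1 e2; exact: uf.
have zpsi : zcont C (fun a => u (sec a)).
  apply: (@compact_map_zcont R _ _ setT q C _ u).
  - exact: diskT_compact.
  - exact/continuous_subspaceT/q_cont.
  - exact: chart_hausdorff SQ.
  - by move=> b _; exists (sec b).
  - by rewrite setTI.
  - by move=> z _; exact: secZ.
have zpsi' : zcont setT (fun a : C => u (sec (set_val a))).
  apply: (@zcont_comp R _ _ setT C (set_val : C -> Q) (fun a => u (sec a))) => //.
    exact/continuous_subspaceT/set_val_continuous.
  by move=> a _; exact: set_valP.
have [h [ch hZ]] := poly_lift polyC finC zpsi'.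
pose h' a := if pselect (C a) is left Ca then h (mk_sub Ca) else 0.
have h'E (a : C) : h' (set_val a) = h a.
  rewrite /h'; case: pselect => [Ca|[]]; last exact: set_valP.
  by congr h; apply: set_val_inj.
exists h'; split.
  by apply: sub_within; rewrite (_ : (fun _ => _) = h) //; apply/funext => a; exact: h'E.
move=> z Cz; have := hZ (mk_sub Cz); rewrite -h'E mk_subE => h1.
by rewrite -(subrKA (u (sec (q z)))) rpredD // secZ.
Qed.

(** [ka] extends the indicator of the arc into the disk. On the boundary it is an integer, so modulo
    Z it passes to [C], where it lifts to [h]. Then [x] is [ka] minus [h] on the disk, [y] is [h] on
    the bouquet, both are integers, and [h] cancels in the sum. *)
Lemma chord (al be : R) : al < be < al + 1 -> ~ C (jq (F al)) -> ~ C (jq (F be)) ->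
  exists (x : disk R -> R) (y : bouquet p -> R),
    [/\ {within q @^-1` C, continuous x}, {within jq @^-1` C, continuous y},
        forall z, C (q z) -> x z \is a Num.int, forall w, C (jq w) -> y w \is a Num.int &
        forall t, `|t - al| < 1 -> `|be - t| < 1 -> C (jq (F t)) ->
          (if al < t < be then 1 else 0) = x (bd (ce t)) + y (F t)].
Proof.
move=> /andP[ab ba] Ca Cb.
(* [l] is the affine function vanishing on the chord and positive beyond it on the side of the arc.
   [dn] equals [|l|] on the circle and vanishes only at the two ends of the chord, which do not lie
   over [C]; so [ka] is continuous over [C]. *)
pose l (z : disk R) : R := cos (pi * (al + be)) * set_val z 0 0 + sin (pi * (al + be)) * set_val z 0 1
  - cos (pi * (be - al)).
pose dn (z : disk R) : R := `|l z| + (1 - (set_val z 0 0 * set_val z 0 0 + set_val z 0 1 * set_val z 0 1)).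
pose ka (z : disk R) : R := (1 + l z * (dn z)^-1) * 2^-1.
have lce t : l (bd (ce t)) = 2 * (sin (pi * (t - al)) * sin (pi * (be - t))).
  rewrite /l bdry_val ce0 ce1 -cosB.
  have -> : pi * (al + be) - 2 * pi * t = pi * (be - t) - pi * (t - al) by ring.
  have -> : pi * (be - al) = pi * (be - t) + pi * (t - al) by ring.
  by rewrite cosB cosD; ring.
have dnb t : dn (bd (ce t)) = `|l (bd (ce t))|.
  by rewrite /dn bdry_val -!expr2 circleP subrr addr0.
have Cl t : C (q (bd (ce t))) -> l (bd (ce t)) != 0.
  rewrite q_bdry => Ct; have [s /andP[s0 s1] st] := window al t.
  have {}Ct : C (jq (F s)) by rewrite (ce_int st).
  rewrite -(ce_int st) lce; apply/negP; rewrite mulf_eq0 pnatr_eq0 /= mulf_eq0 => /orP[] /eqP /sin_pi_eq0 e.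
    have : s - al = 0 by apply: e; rewrite ger0_norm; lra.
    by move/eqP; rewrite subr_eq0 => /eqP e'; apply: Ca; rewrite -e'.
  have : be - s = 0 by apply: e; rewrite ltr_norml; apply/andP; split; lra.
  by move/eqP; rewrite subr_eq0 => /eqP e'; apply: Cb; rewrite e'.
have dn0 z : C (q z) -> dn z != 0.
  move=> Cz; have dz := (diskP _).1 (set_valP z); rewrite !expr2 in dz.
  apply/negP => /eqP; rewrite /dn => /eqP; rewrite paddr_eq0 ?normr_ge0 ?subr_ge0 // normr_eq0.
  case/andP => /eqP lz; rewrite subr_eq0 eq_sym -!expr2 => /eqP /bdryP[x xz].
  by have [t tx] := ce_surj x; move: lz => /eqP; rewrite -xz -tx (negbTE (Cl t _)) // tx xz.
have kac z : C (q z) -> {for z, continuous ka}.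
  move=> Cz.
  have c0 : {for z, continuous (fun z : disk R => set_val z 0 0)}.
    exact: (cont_comp (@set_val_continuous _ _) (@coord_cont _ _ _)).
  have c1 : {for z, continuous (fun z : disk R => set_val z 0 1)}.
    exact: (cont_comp (@set_val_continuous _ _) (@coord_cont _ _ _)).
  have cl : {for z, continuous l} by rewrite /l; cont_tac.
  have cd : {for z, continuous dn} by rewrite /dn; cont_tac.
  have cv : {for z, continuous (fun z => (dn z)^-1)} by apply: contV => //; exact: dn0.
  by rewrite /ka; cont_tac.
have kab t : C (q (bd (ce t))) -> ka (bd (ce t)) = if 0 < l (bd (ce t)) then 1 else 0.
  move=> Ct; rewrite /ka dnb; have := Cl t Ct; case: (ltgtP (l (bd (ce t))) 0) => // h _.
    by rewrite ltr0_norm // invrN mulrN divff ?lt_eqF // subrr mul0r.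
  by rewrite gtr0_norm // divff ?gt_eqF //; field.
have kaZ x : C (q (bd x)) -> ka (bd x) \is a Num.int.
  have [t <-] := ce_surj x => Ct; rewrite kab //.
  by case: ifP => _; [exact: rpred1|exact: rpred0].
have ckw : {within q @^-1` C, continuous ka}.
  by apply/within_near => z Cz B kB; apply: near_imp (kac z Cz B kB).
have [h [ch hZ]] : exists h : Q -> R, {within C, continuous h} /\
    forall z, C (q z) -> h (q z) - ka z \is a Num.int.
  apply: descend; first exact: zcont_cont.
  by move=> x x' e Cx; rewrite rpredB ?kaZ // q_bdry -e -q_bdry.
have xZ z : C (q z) -> ka z - h (q z) \is a Num.int by move=> Cz; rewrite -opprB rpredN hZ.
exists (fun z => ka z - h (q z)), (fun w => h (jq w)); split=> //.
- apply: sub_within; apply: contI => z; apply: contD.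
    by have := within_sub ckw => /(_ z).
  apply: contN.
  have cqC : continuous (fun z : (q @^-1` C) => mk_sub (set_valP z : C (q (set_val z)))).
    by apply: sub_cont; apply: (cont_comp (@set_val_continuous _ _)); exact: q_cont.
  by have := cont_comp cqC (within_sub ch) => /(_ z).
- apply: sub_within.
  have cqC : continuous (fun w : (jq @^-1` C) => mk_sub (set_valP w : C (jq (set_val w)))).
    by apply: sub_cont; apply: (cont_comp (@set_val_continuous _ _)); exact: jq_cont.
  exact: cont_comp cqC (within_sub ch).
- move=> w Cw; have [x xw] := fs w; have Cx : C (q (bd x)) by rewrite q_bdry xw.
  by rewrite -xw -q_bdry -(subrK (ka (bd x)) (h _)) rpredD ?hZ ?kaZ.
- move=> t ta tb Ct; rewrite -q_bdry in Ct.
  rewrite -q_bdry subrK kab //; congr (if _ then _ else _).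
  have := Cl t Ct; rewrite lce.
  move: ta tb; rewrite !ltr_norml => /andP[t1 t2] /andP[t3 t4].
  rewrite pmulr_rgt0 // mulf_eq0 pnatr_eq0 /=.
  case: (ltgtP al t) => h1 /=.
  - have s1 : 0 < sin (pi * (t - al)) by apply: sin_pi_gt0; apply/andP; split; lra.
    rewrite pmulr_rgt0 //; case: (ltgtP t be) => h2 hh.
    + by apply/esym; apply: sin_pi_gt0; apply/andP; split; lra.
    + by apply/esym/negbTE; rewrite -leNgt ltW //; apply: sin_pi_lt0; apply/andP; split; lra.
    + by rewrite h2 subrr mulr0 sin0 ltxx.
  - have s1 : sin (pi * (t - al)) < 0 by apply: sin_pi_lt0; apply/andP; split; lra.
    have s2 : 0 < sin (pi * (be - t)) by apply: sin_pi_gt0; apply/andP; split; lra.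
    by move=> _; rewrite pmulr_lgt0 //; apply/esym/negbTE; rewrite -leNgt ltW.
  - by rewrite h1 subrr mulr0 sin0 mul0r ltxx.
Qed.

Lemma petal_not_inside i : C <> setT -> exists t, ~ C (jq (loop p i t)).
Proof.
move=> CT; apply: contrapT => nt.
have pC t : C (jq (loop p i t)) by apply: contrapT => nC; apply: nt; exists t.
have [z1 Cz1] : exists z, ~ C (q z).
  apply: contrapT => nz; apply: CT; apply/seteqP; split=> // a _; apply: contrapT => Ca.
  by have [z za] := q_surj fs a; apply: nz; exists z; rewrite za.
have cC : closed C by exact: subpoly_closed polyC.
(* The complement of [C] is open, so [z1] can be moved slightly towards the centre, to a point [z0]
   of the open disk from which the disk can be projected to its boundary. *)
have shr (s : R) : disk R ((1 - clamp01 s) *: 0 + clamp01 s *: set_val z1).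
  by apply: disk_convex; [exact: disk0|exact: set_valP|exact: clamp01_in].
pose sh s := mk_sub (shr s).
have csh : continuous sh.
  apply: sub_cont; apply: contI => s.
  have cl : {for s, continuous (fun s : R => clamp01 s)} by exact: clamp01_cont.
  have -> : (fun s => set_val (sh s)) = (fun s => clamp01 s *: set_val z1).
    by apply/funext => u; rewrite mk_subE scaler0 add0r.
  by apply: contZ; [exact: cl|exact: contC].
have c1 : clamp01 1 = 1 :> R by apply: clamp01_id; rewrite lexx ler01.
have sh1 : sh 1 = z1.
  by apply: set_val_inj; rewrite mk_subE c1 subrr scale0r add0r scale1r.
have [z0 [Cz0 nz0]] : exists z0, ~ C (q z0) /\ set_val z0 0 0 ^+ 2 + set_val z0 0 1 ^+ 2 < 1.
  have : nbhs (1 : R) ((fun s => q (sh s)) @^-1` ~` C).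
    apply: (cont_comp csh (@q_cont _ _ _ f)); apply: open_nbhs_nbhs; split.
      exact: closed_openC.
    by rewrite sh1.
  move=> /nbhs_ballP[e /= e0 he].
  pose s := 1 - Num.min (e / 2) (2^-1).
  have m0 : 0 < Num.min (e / 2) (2^-1) by rewrite lt_min; apply/andP; split; lra.
  have m1 : Num.min (e / 2) (2^-1) <= e / 2 by rewrite ge_min lexx.
  have m2 : Num.min (e / 2) (2^-1) <= 2^-1 by rewrite ge_min lexx orbT.
  have s01 : 0 <= s <= 1 by rewrite /s; apply/andP; split; lra.
  exists (sh s); split.
    by apply: he; rewrite /ball /= /s opprB addrCA subrr addr0 gtr0_norm //; lra.
  rewrite mk_subE clamp01_id // !mxE !mulr0 !add0r !exprMn -mulrDr.
  have dz := (diskP _).1 (set_valP z1).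
  apply: le_lt_trans (_ : s ^+ 2 * 1 < 1).
    by apply: ler_wpM2l => //; exact: sqr_ge0.
  by rewrite mulr1 expr_lt1 //; rewrite /s; case/andP: s01 => //; lra.
(* The ray from [z0] through [z] leaves the disk at z0 + la (z - z0), where [la z] is the positive
   root of a la^2 + 2 b la - c = 0. *)
pose a0 := set_val z0 0 0; pose a1 := set_val z0 0 1.
pose w0 (z : disk R) : R := set_val z 0 0 - a0.
pose w1 (z : disk R) : R := set_val z 0 1 - a1.
pose a z := w0 z * w0 z + w1 z * w1 z.
pose b z := a0 * w0 z + a1 * w1 z.
pose c : R := 1 - (a0 * a0 + a1 * a1).
have cpos : 0 < c by rewrite /c subr_gt0 -!expr2.
have apos z : z <> z0 -> 0 < a z.
  move=> zz; rewrite /a lt_neqAle -!expr2 addr_ge0 ?sqr_ge0 // andbT eq_sym.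
  rewrite paddr_eq0 ?sqr_ge0 // !sqrf_eq0 !subr_eq0; apply/negP => /andP[/eqP e0 /eqP e1].
  by apply: zz; apply: set_val_inj; apply/rowP => j; have [->|->] := ord2P j.
pose la z := (Num.sqrt (b z * b z + a z * c) - b z) * (a z)^-1.
pose rr z : 'rV[R]_2 := \row_j ((if j == 0 then a0 else a1) + la z * (if j == 0 then w0 z else w1 z)).
have rrP z : z <> z0 -> sphere R 1 (rr z).
  move=> /apos az; apply/sphere1P; rewrite !mxE /=.
  have la2 : (la z * a z + b z) ^+ 2 = b z * b z + a z * c.
    rewrite /la divfK ?gt_eqF // subrK sqr_sqrtr //; apply: addr_ge0.
      by rewrite -expr2 sqr_ge0.
    by apply: mulr_ge0; exact: ltW.
  have : a z * (a z * la z ^+ 2 + 2 * b z * la z - c) = 0 by move: la2; rewrite /GRing.exp /=; lra.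
  move/eqP; rewrite mulf_eq0 gt_eqF //= => /eqP h.
  by move: h; rewrite /a /b /c => h; apply/eqP; rewrite -subr_eq0 -h; apply/eqP; ring.
have rrb x : bd x <> z0 -> rr (bd x) = set_val x.
  move=> /apos az; have cx := circleP x.
  have e : a (bd x) + 2 * b (bd x) = c.
    have -> : c = set_val x 0 0 ^+ 2 + set_val x 0 1 ^+ 2 - (a0 * a0 + a1 * a1) by rewrite cx.
    by rewrite /a /b /w0 /w1 bdry_val; ring.
  have la1 : la (bd x) = 1.
    have pos : 0 <= a (bd x) + b (bd x) by lra.
    have -> : la (bd x) = (Num.sqrt ((a (bd x) + b (bd x)) ^+ 2) - b (bd x)) * (a (bd x))^-1.
      by rewrite /la; congr ((Num.sqrt _ - _) * _); rewrite -e; ring.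
    by rewrite sqrtr_sqr ger0_norm // addrK divff // gt_eqF.
  apply/rowP => j; rewrite mxE la1 mul1r /w0 /w1 bdry_val.
  by have [->|->] := ord2P j; rewrite /= addrC subrK.
pose ret (y : 'rV[R]_2) : circle R := if pselect (sphere R 1 y) is left h then mk_sub h else ce 0.
have retE y : sphere R 1 y -> set_val (ret y) = y by rewrite /ret; case: pselect.
have Cz z : C (q z) -> z <> z0 by move=> Cz e; apply: Cz0; rewrite -e.
have zu : zcont (q @^-1` C) (fun z => coord i (f (ret (rr z)))).
  have zcf : zcont setT (fun x => coord i (f x)) by exact: (zcontT_comp fc (@coord_zcont _ _ p i)).
  apply: (@zcont_comp R _ _ (q @^-1` C) setT (fun z => ret (rr z)) (fun x => coord i (f x))) => //.
  apply: sub_within; apply: sub_cont.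
  rewrite (_ : (fun _ => _) = (fun z : (q @^-1` C) => rr (set_val z))); last first.
    by apply/funext => z; apply: retE; apply: rrP; apply: Cz; exact: (set_valP z).
  apply: contI => z; apply: (@cont_comp_for _ _ _ (set_val : (q @^-1` C) -> disk R) rr).
    exact: set_val_continuous.
  have zz0 : set_val z <> z0 by apply: Cz; exact: (set_valP z).
  move: (set_val z) zz0 => {}z zz0.
  have d0 : {for z, continuous (fun z : disk R => set_val z 0 0)}.
    exact: (cont_comp (@set_val_continuous _ _) (@coord_cont _ _ _)).
  have d1 : {for z, continuous (fun z : disk R => set_val z 0 1)}.
    exact: (cont_comp (@set_val_continuous _ _) (@coord_cont _ _ _)).
  have cw0 : {for z, continuous w0} by rewrite /w0; cont_tac.
  have cw1 : {for z, continuous w1} by rewrite /w1; cont_tac.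
  have ca : {for z, continuous a} by rewrite /a; cont_tac.
  have cb : {for z, continuous b} by rewrite /b; cont_tac.
  have ci : {for z, continuous (fun z => (a z)^-1)} by apply: contV => //; rewrite gt_eqF ?apos.
  have cs : {for z, continuous (fun z => Num.sqrt (b z * b z + a z * c))}.
    by apply: (@cont_comp_for _ _ _ (fun z => b z * b z + a z * c) Num.sqrt); [cont_tac|exact: sqrt_continuous].
  have cl : {for z, continuous la} by rewrite /la; cont_tac.
  apply: rV_cont => j.
  rewrite (_ : (fun _ => _) = (fun z => (if j == 0 then a0 else a1) + la z * (if j == 0 then w0 z else w1 z))).
    by have [->|->] := ord2P j; rewrite /=; cont_tac.
  by apply/funext => z'; rewrite mxE.
have retb x : C (q (bd x)) -> ret (rr (bd x)) = x.
  by move=> /Cz bx; apply: set_val_inj; rewrite retE rrb //; exact: (set_valP x).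
have [h [ch hZ]] : exists h : Q -> R, {within C, continuous h} /\
    forall z, C (q z) -> h (q z) - coord i (f (ret (rr z))) \is a Num.int.
  apply: descend => // x x' e Cx; rewrite !retb ?e ?subrr ?rpred0 //.
  by rewrite q_bdry -e -q_bdry.
have hl t : h (jq (loop p i t)) - t \is a Num.int.
  have [x fx] := fs (loop p i t).
  have Cx : C (q (bd x)) by rewrite q_bdry fx.
  have := hZ _ Cx; rewrite retb // q_bdry fx => h1.
  by rewrite -(subrKA (coord i (loop p i t))) rpredD // coord_loop.
have cG : continuous (fun t => h (jq (loop p i t)) - t).
  have cl : continuous (fun t => mk_sub (pC t)).
    by apply: sub_cont; apply: (cont_comp (@loop_cont _ _ p i)); exact: jq_cont.
  apply: contI => t.
  have ct : {for t, continuous (fun t => h (jq (loop p i t)))} by exact: (cont_comp cl (within_sub ch)).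
  by cont_tac.
(* The lift minus [t] is constant, although [loop] is back at the same point when [t] has passed
   from 0 to 1. *)
have := @int_valued_const R _ 0 1 ler01 (continuous_subspaceT cG) (fun t _ => hl t).
rewrite (@loop_int _ _ p i 0 1) ?subr0; last by rewrite sub0r rpredN rpred1.
move=> e; have : (1 : R) = 0 by lra.
by move/eqP; rewrite oner_eq0.
Qed.

End Descend.

(** * Alternating subdivisions *)

Section Subdivisions.
Variable R : realType.
Variable P : bool -> R -> Prop.

(** [P c x] means that [x] has colour [c]; a point may have both colours. Degenerate pieces, with
    equal ends, are allowed. *)
Definition subdiv (a b : R) (K : nat) (tau : nat -> R) (lam : nat -> bool) : Prop :=
  [/\ (0 < K)%N, tau 0 = a, tau K = b &
      forall k, (k < K)%N -> tau k <= tau k.+1 /\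
        forall x, tau k <= x <= tau k.+1 -> P (lam k) x].

Definition has_subdiv a b := exists K tau lam, subdiv a b K tau lam.

Lemma subdiv1 a b c : a <= b -> (forall x, a <= x <= b -> P c x) -> has_subdiv a b.
Proof.
move=> ab h; exists 1%N, (fun k => if k is 0%N then a else b), (fun=> c).
by split=> // -[].
Qed.

Lemma subdiv_cat a b c : has_subdiv a b -> has_subdiv b c -> has_subdiv a c.
Proof.
move=> [K [t [l [K0 t0 tK h]]]] [K' [t' [l' [K0' t0' tK' h']]]].
exists (K + K')%N, (fun k => if (k < K)%N then t k else t' (k - K)%N),
  (fun k => if (k < K)%N then l k else l' (k - K)%N).
split; rewrite ?addn_gt0 ?K0 // ?t0 //.
  by rewrite ltnNge leq_addr /= addKn.
move=> k kK; have [kK1|kK1] := ltnP k K.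
  have [kK2|kK2] := ltnP k.+1 K; first exact: h.
  have e : k.+1 = K by apply/eqP; rewrite eqn_leq kK1.
  by rewrite e subnn t0' -tK -e; exact: h.
by rewrite ltnNge (leqW kK1) /= subSn //; apply: h'; rewrite ltn_subLR.
Qed.

Lemma subdiv_refine (l : seq R) a b : a <= b ->
  (forall u v, a <= u -> u <= v -> v <= b -> (forall x, x \in l -> ~ (u < x < v)) -> has_subdiv u v) ->
  has_subdiv a b.
Proof.
elim: l a b => [|x l IH] a b ab h; first by apply: h.
have [xab|xab] := pselect (a < x < b); last first.
  apply: IH => // u v au uv vb hl; apply: h => // y.
  rewrite inE => /orP[/eqP ->|]; last exact: hl.
  by move=> /andP[ux xv]; apply: xab; rewrite (le_lt_trans au ux) (lt_le_trans xv vb).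
have [ax xb] := andP xab.
apply: (@subdiv_cat a x b); apply: IH; rewrite ?ltW // => u v au uv vb hl; apply: h => //.
- exact: le_trans vb (ltW xb).
- by move=> y; rewrite inE => /orP[/eqP ->|]; [rewrite (ltNge x) vb andbF|exact: hl].
- exact: le_trans (ltW ax) au.
- by move=> y; rewrite inE => /orP[/eqP ->|]; [rewrite ltNge au|exact: hl].
Qed.

Lemma subdiv_le a b K tau lam : subdiv a b K tau lam ->
  forall i j, (i <= j)%N -> (j <= K)%N -> tau i <= tau j.
Proof.
move=> [_ _ _ h] i j; elim: j => [|j IH]; first by rewrite leqn0 => /eqP ->.
rewrite leq_eqVlt => /orP[/eqP -> //|ij] jK.
by apply: le_trans (IH ij (ltnW jK)) _; have [] := h j jK.
Qed.

(* A subdivision with the least number of pieces alternates, and each of its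
   pieces has a point of only one colour: otherwise two pieces would merge. *)
Lemma alternating_subdiv a b : has_subdiv a b ->
  (forall c, exists2 x, a <= x <= b & ~ P c x) ->
  exists K tau lam (d : nat -> R), [/\ (1 < K)%N, subdiv a b K tau lam,
    forall k, (k < K)%N -> lam k = lam 0%N (+) odd k &
    forall k, (k < K)%N -> tau k <= d k <= tau k.+1 /\ ~ P (~~ lam k) (d k)].
Proof.
move=> hs hc.
have exK : exists K, `[< exists tau lam, subdiv a b K tau lam >].
  by have [K [t [l h]]] := hs; exists K; apply/asboolP; exists t, l.
case: (ex_minnP exK) => K /asboolP[tau [lam S]] min.
have diff tau' lam' k : subdiv a b K tau' lam' -> (k.+1 < K)%N -> lam' k <> lam' k.+1.
  move=> [K0 t0 tK h] kK e.
  suff : (K <= K.-1)%N by rewrite leqNgt ltn_predL K0.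
  apply: min; apply/asboolP.
  exists (fun j => if (j <= k)%N then tau' j else tau' j.+1), (fun j => if (j <= k)%N then lam' j else lam' j.+1).
  split.
  - by rewrite ltn_predRL; apply: leq_ltn_trans kK.
  - by rewrite leq0n.
  - by rewrite prednK // leqNgt ltn_predRL kK.
  - move=> j jK; have jK' : (j.+1 < K)%N by rewrite -ltn_predRL.
    have [jk|jk|jk] := ltngtP j k.
    + by apply: h; exact: ltnW jK'.
    + exact: h.
    + have [l1 p1] := h k (ltnW kK); have [l2 p2] := h k.+1 kK.
      rewrite jk; split; first exact: le_trans l1 l2.
      move=> x /andP[x1 x2]; have [xm|xm] := leP x (tau' k.+1); first by apply: p1; rewrite x1.
      by rewrite e; apply: p2; rewrite (ltW xm).
have [K0 t0 tK h] := S.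
have K1 : (1 < K)%N.
  rewrite ltn_neqAle K0 andbT; apply/eqP => K1; subst K.
  have [x xab nx] := hc (lam 0%N); apply: nx.
  by have [_ p1] := h 0%N isT; apply: p1; rewrite t0 tK.
(* If the whole piece also had the other colour, repainting it would give it the colour of a
   neighbour, against [diff]. *)
have strict k : (k < K)%N -> exists2 x, tau k <= x <= tau k.+1 & ~ P (~~ lam k) x.
  move=> kK; apply: contrapT => ns.
  have S' : subdiv a b K tau (fun j => if j == k then ~~ lam k else lam j).
    split=> // j jK; have [l1 p1] := h j jK; split=> // x xj.
    case: eqP => [jk|_]; last exact: p1.
    by apply: contrapT => nx; apply: ns; exists x => //; rewrite -jk.
  have [kK1|kK1] := ltnP k.+1 K.
    have := diff _ _ k S' kK1; rewrite eqxx gtn_eqF //; apply.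
    by have := diff _ _ k S kK1; case: (lam k); case: (lam k.+1).
  case: k kK kK1 S' {ns} => [|k] kK kK1 S'; first by rewrite ltnNge kK1 in K1.
  have := diff _ _ k S' kK; rewrite eqxx ltn_eqF //; apply.
  by have := diff _ _ k S kK; case: (lam k); case: (lam k.+1).
pose d k := if pselect (k < K)%N is left kK then projT1 (cid2 (strict k kK)) else 0.
exists K, tau, lam, d; split=> //.
  elim=> [|k IH] kK; first by rewrite addbF.
  have := diff _ _ k S kK; rewrite (IH (ltnW kK)) /=.
  by case: (lam 0%N); case: (odd k); case: (lam k.+1).
by move=> k kK; rewrite /d; case: pselect => // kK'; case: cid2.
Qed.

(** [idx e] is the first piece reaching up to [e], a monotone choice. A point of a single colour
    reveals the colour of its piece, so successive points of alternating single colours force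
    successive distinct pieces. *)
Lemma subdiv_index a b K tau lam : subdiv a b K tau lam ->
  exists idx : R -> nat, [/\ forall e, a <= e <= b -> (idx e < K)%N,
    forall e, a <= e <= b -> tau (idx e) <= e <= tau (idx e).+1,
    forall e e', a <= e <= b -> a <= e' <= b -> e <= e' -> (idx e <= idx e')%N &
    forall e c, a <= e <= b -> ~ P (~~ c) e -> lam (idx e) = c].
Proof.
move=> S; have [K0 t0 tK h] := S.
have ex e : exists k, (K <= k.+1)%N || (e <= tau k.+1) by exists K; rewrite leqnSn.
pose idx e := ex_minn (ex e).
have idxK e : (idx e < K)%N.
  rewrite /idx; case: ex_minnP => k _ min.
  have := min K.-1; rewrite prednK // leqnn => /(_ isT) kK.
  by apply: leq_ltn_trans kK _; rewrite prednK.
have up e : e <= b -> e <= tau (idx e).+1.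
  rewrite /idx; case: ex_minnP => k /orP[kK|//] min eb.
  have -> : k.+1 = K by apply/eqP; rewrite eqn_leq kK andbT; have := idxK e; rewrite /idx; case: ex_minnP => k' hk min' k'K; apply: leq_trans k'K; rewrite ltnS; apply: min.
  by rewrite tK.
have low e : a <= e -> tau (idx e) <= e.
  rewrite /idx; case: ex_minnP => -[|k] hk min ae; first by rewrite t0.
  rewrite leNgt; apply/negP => ek.
  by have := min k; rewrite (ltW ek) orbT => /(_ isT); rewrite ltnn.
exists idx; split=> [e _|e /andP[ae eb]|e e' /andP[ae eb] /andP[ae' eb'] ee'|e c /andP[ae eb] nP].
- exact: idxK.
- by rewrite low // up.
- rewrite {1}/idx; case: ex_minnP => k _ min; apply: min.
  by rewrite (le_trans ee' (up _ eb')) orbT.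
- have [_ p1] := h _ (idxK e).
  have := p1 e; rewrite low // up // => /(_ isT) Pe.
  by case: (lam _) c nP Pe => -[].
Qed.

End Subdivisions.

Section ConvexPieces.
Variables (R : realType) (m : nat) (G : R -> 'rV[R]_m).
Hypotheses (cG : continuous G) (Ginj : forall s t, G s = G t <-> s - t \is a Num.int).

(** The parameter of the closed curve [G] lifts to a real function [h] on the convex set [M], with
    an interval as range. The parameters of the points of [M] form the integer translates of this
    interval, and [l] lists the ends of all translates that can meet [0, 1]. *)
Lemma convex_piece (M : set 'rV[R]_m) : compact M -> convex M ->
  (forall y, M y -> exists t, G t = y) ->
  exists l : seq R, forall u v w, 0 <= u -> v <= 1 -> u < w < v ->
    (forall x, x \in l -> ~ (u < x < v)) -> M (G w) -> forall x, u <= x <= v -> M (G x).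
Proof.
move=> cM vM MG.
have [[c Mc]|M0] := pselect (M !=set0); last first.
  by exists [::] => u v w _ _ _ _ Mw; case: M0; exists (G w).
have MG1 y : M y -> exists2 t, 0 <= t < 1 & G t = y.
  move=> My; have [t <-] := MG y My; have [s s01 st] := window 0 t.
  by rewrite add0r in s01; exists s => //; apply/Ginj.
pose de y := if pselect (M y) is left My then projT1 (cid2 (MG1 y My)) else 0.
have deP y : M y -> G (de y) = y.
  by rewrite /de; case: pselect => // My _; case: cid2.
have zde : zcont M de.
  apply: (@compact_map_zcont R R 'rV[R]_m (`[0, 1]%classic : set R) G M de (fun t => t)).
  - exact: segment_compact.
  - exact: continuous_subspaceT.
  - exact: rV_hausdorff.
  - move=> y /MG1[t /andP[t0 t1] <-]; exists t => //.
    by rewrite /= in_itv /= t0 ltW.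
  - by apply: zcont_cont; apply: continuous_subspaceT; apply: contI => t; exact: contId.
  - by move=> t _ Mt; apply/Ginj; exact: deP.
have zM : zcont setT (fun y : M => de (set_val y)).
  apply: (@zcont_comp R _ _ setT M (set_val : M -> 'rV[R]_m) de) => //.
    exact/continuous_subspaceT/set_val_continuous.
  by move=> y _; exact: set_valP.
have kM : contractible R M := convex_contractible Mc vM.
have [h [ch hZ]] := zcont_lift (sub_compact cM) kM zM.
have img x y w : h x <= w <= h y -> exists z, h z = w.
  move=> hw.
  have seg (t : R) : M ((1 - clamp01 t) *: set_val x + clamp01 t *: set_val y).
    by apply: vM; [exact: set_valP|exact: set_valP|exact: clamp01_in].
  pose g t := mk_sub (seg t).
  have cg : continuous (fun t => h (g t)).
    apply: (cont_comp _ ch); apply: sub_cont; apply: contI => t.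
    have cl : {for t, continuous (fun t : R => clamp01 t)} by exact: clamp01_cont.
    apply: contD; apply: contZ; try exact: contC; last exact: cl.
    by apply: contD; [exact: contC|exact: contN].
  have g0 : g 0 = x.
    by apply: set_val_inj; rewrite mk_subE clamp01_id ?lexx ?ler01 // subr0 scale1r scale0r addr0.
  have g1 : g 1 = y.
    by apply: set_val_inj; rewrite mk_subE clamp01_id ?lexx ?ler01 // subrr scale1r scale0r add0r.
  have [|t _ ht] := IVT_between cg (@ler01 R) (w := w); first by rewrite g0 g1 hw.
  by exists (g t).
have M0 : [set: M] !=set0 by exists (mk_sub Mc).
have [yh _ hiP] := compact_EVT_max M0 (sub_compact cM) (continuous_subspaceT ch).
have [yl _ loP] := compact_EVT_min M0 (sub_compact cM) (continuous_subspaceT ch).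
pose N := (`|Num.floor (h yl)| + `|Num.ceil (h yh)| + 1)%N.
pose ks : seq int := [seq k%:Z - N%:Z | k <- iota 0 (2 * N)%N.+1].
exists ([seq h yl - k%:~R | k <- ks] ++ [seq h yh - k%:~R | k <- ks]) => u v w u0 v1 /andP[uw wv] nl Mw.
pose kw := h (mk_sub Mw) - w.
have kZ : kw \is a Num.int.
  have := hZ (mk_sub Mw); rewrite mk_subE => h1.
  by rewrite /kw -(subrKA (de (G w))) rpredD //; apply/Ginj; exact: deP.
have /intrP[k kE] := kZ.
have wlo : h yl <= w + k%:~R by rewrite -kE /kw addrC subrK; apply: loP; rewrite inE.
have whi : w + k%:~R <= h yh by rewrite -kE /kw addrC subrK; apply: hiP; rewrite inE.
have kks : k \in ks.
  have /andP[f1 _] := floor_itv (h yl); have /andP[_ f2] := ceil_itv (h yh).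
  have kl : (Num.floor (h yl) - 1 <= k)%R.
    rewrite -(ler_int R) intrB; apply: le_trans (_ : h yl - 1 <= _); first by rewrite lerB.
    by rewrite lerBlDr addrC; apply: le_trans wlo _; rewrite lerD2r; lra.
  have ku : (k <= Num.ceil (h yh))%R.
    rewrite -(ler_int R); apply: le_trans f2; apply: le_trans whi; rewrite lerDr; lra.
  apply/mapP; exists (absz (k + N%:Z)); last by rewrite /N in kl ku *; lia.
  by rewrite mem_iota /= add0n ltnS /N; lia.
move=> x /andP[ux xv].
have lo_u : h yl - k%:~R <= u.
  rewrite leNgt; apply/negP => hh; apply: (nl (h yl - k%:~R)).
    by rewrite mem_cat; apply/orP; left; apply/mapP; exists k.
  by rewrite hh /= (le_lt_trans _ wv) // lerBlDr.
have hi_v : v <= h yh - k%:~R.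
  rewrite leNgt; apply/negP => hh; apply: (nl (h yh - k%:~R)).
    by rewrite mem_cat; apply/orP; right; apply/mapP; exists k.
  by rewrite hh andbT (lt_le_trans uw) // lerBrDr.
have [|z hz] := img yl yh (x + k%:~R).
  apply/andP; split; first by rewrite -lerBlDr; exact: le_trans lo_u ux.
  by rewrite -lerBrDr; exact: le_trans xv hi_v.
have -> : G x = set_val z; last exact: set_valP.
rewrite -(deP (set_val z)); last exact: set_valP.
apply/Ginj; rewrite -opprB rpredN.
have -> : de (set_val z) - x = k%:~R - (h z - de (set_val z)) by rewrite hz; ring.
by rewrite rpredB ?intr_int //; exact: hZ.
Qed.

End ConvexPieces.

(** * Counting pieces *)

Section RankBound.
Variable R : realType.

Lemma sum_delta (n : nat) (g : 'I_n -> R) (c : 'I_n) :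
  \sum_(b < n) g b * (b == c)%:R = g c.
Proof.
rewrite (bigD1 c) //= eqxx mulr1 big1 ?addr0 // => b /negbTE ->.
by rewrite mulr0.
Qed.

(** The columns of [Y] depend only on the class and vanish outside [U], so [Y] factors through a
    space with basis [U]. *)
Lemma rank_classes m n (T : finType) (U : {set T}) (Y : 'M[R]_(m, n)) (g : 'I_n -> T)
    (h : 'I_m -> T -> R) :
  (forall i a, Y i a = h i (g a)) -> (forall a, g a \in U \/ forall i, h i (g a) = 0) ->
  (\rank Y <= #|U|)%N.
Proof.
move=> YE gU.
pose A : 'M[R]_(m, #|U|) := \matrix_(i, u) h i (enum_val u).
pose B : 'M[R]_(#|U|, n) := \matrix_(u, a) (enum_val u == g a)%:R.
have -> : Y = A *m B; last by apply: leq_trans (mxrankM_maxl _ _) _; exact: rank_leq_col.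
apply/matrixP => i a; rewrite !mxE YE.
have [gaU|ga0] := gU a; last first.
  rewrite ga0 big1 // => u _; rewrite !mxE.
  by have [->|_] := eqVneq (enum_val u) (g a); rewrite ?mulr0 // ga0 mul0r.
rewrite (bigD1 (enum_rank_in gaU (g a))) //= !mxE enum_rankK_in // eqxx mulr1.
rewrite big1 ?addr0 // => u; rewrite !mxE => un.
have [e|_] := eqVneq (enum_val u) (g a); last by rewrite mulr0.
by case/eqP: un; have := enum_valK_in gaU u; rewrite e => ->.
Qed.

(** Let [D] be the cyclic difference operator on columns, [E = X + Y] and [E' = X' + Y']. The matrix
    [E (E' D)^T] is lower triangular with ones on the diagonal, so it has rank [S]; as the [X] and
    [X'] parts pair to 0, it is the sum of [Y (E' D)^T] and [X (Y' D)^T]. *)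
Lemma cyclic_rank_bound S (X Y X' Y' : 'M[R]_(S, S.+1)) :
  (forall i a, X i a + Y i a = (val a == val i)%:R) ->
  (forall i a, X' i a + Y' i a = (val a == (val i).+1)%:R) ->
  (forall i j, \sum_a X i a * (X' j (ordS a) - X' j a) = 0) ->
  (S <= \rank Y + \rank Y')%N.
Proof.
move=> XY XY' X0.
pose D : 'M[R]_S.+1 := \matrix_(b, a) ((b == ordS a)%:R - (b == a)%:R).
have DE (Z : 'M[R]_(S, S.+1)) j a : (Z *m D) j a = Z j (ordS a) - Z j a.
  rewrite mxE; under eq_bigr do rewrite mxE mulrBr.
  by rewrite sumrB !sum_delta.
have PE (Z Z' : 'M[R]_(S, S.+1)) i j :
    (Z *m (Z' *m D)^T) i j = \sum_a Z i a * (Z' j (ordS a) - Z' j a).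
  by rewrite mxE; apply: eq_bigr => a _; rewrite mxE DE.
have X00 : X *m (X' *m D)^T = 0 by apply/matrixP => i j; rewrite PE X0 mxE.
pose E := X + Y; pose E' := X' + Y'.
have decomp : E *m (E' *m D)^T = Y *m (E' *m D)^T + X *m (Y' *m D)^T.
  rewrite /E mulmxDl addrC; congr (_ + _).
  by rewrite /E' mulmxDl linearD /= mulmxDr X00 add0r.
have full : \rank (E *m (E' *m D)^T) = S.
  apply: mxrank_unit.
  have entry i j : (E *m (E' *m D)^T) i j = (val i == val j)%:R - (val i == (val j).+1)%:R.
    rewrite PE.
    have iS : (i < S.+1)%N by rewrite ltnS ltnW.
    rewrite (bigD1 (Ordinal iS)) //= [X in _ + X]big1 ?addr0; last first.
      move=> a /negP ai; have nai : val a != val i.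
        by apply/negP => /eqP e; apply: ai; apply/eqP/val_inj.
      by rewrite mxE XY (negbTE nai) mul0r.
    rewrite mxE XY eqxx mul1r !mxE !XY' /=.
    by rewrite modn_small ?eqSS // ltnS.
  rewrite unitmxE det_trig; last first.
    apply/is_trig_mxP => i j ij; rewrite entry !ltn_eqF ?subrr //.
    exact: ltn_trans ij _.
  rewrite big1 ?unitr1 // => i _.
  by rewrite entry eqxx ltn_eqF ?subr0.
rewrite -{1}full decomp; apply: leq_trans (mxrank_add _ _) _.
apply: leq_add; first exact: mxrankM_maxl.
apply: leq_trans (mxrankM_maxr _ _) _; rewrite mxrank_tr.
exact: mxrankM_maxl.
Qed.

End RankBound.

(** * Coloured subdivisions of the petals and of the arcs *)

Section SplitComplex.
Variables (R : realType) (n : nat) (p : 'I_n.+1 -> circle R) (f : circle R -> bouquet p).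
Local Notation Q := (one_relator_complex f).
Local Notation q := (disk_to_complex f).
Local Notation jq := (bouquet_to_complex f).
Local Notation bd := (bdry_incl R).
Local Notation F := (fun t => f (ce t)).
Local Notation v := (vertex p).
Variables (SQ : pl_structure R Q) (C : bool -> set Q).
Hypotheses (fc : continuous f) (fs : forall y, exists x, f x = y).
Hypotheses (polyC : forall c, subpolyhedron SQ (C c)) (finC : forall c, finite_set (H1 R (C c))).
Hypotheses (CT : forall c, C c <> setT) (Ccov : forall a, exists c, C c a).
Hypothesis polyP : forall i, subpolyhedron SQ (jq @` petal (p := p) i).

Definition on_petal i c : set R := [set u | C c (jq (loop p i u))].
Definition on_circle c : set R := [set t | C c (jq (F t))].

(** The hulls forming [C c] are intersected with those forming the petal, so that [convex_piece]
    applies to sets inside the closed curve. Between consecutive cut points the colour found at the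
    midpoint holds throughout. *)
Lemma petal_has_subdiv i : has_subdiv (on_petal i) 0 1.
Proof.
pose G u := SQ (jq (loop p i u)).
have cG : continuous G.
  by apply: (cont_comp _ (@chart_cont _ _ SQ)); apply: (cont_comp (@loop_cont _ _ p i)); exact: jq_cont.
have Ginj s t : G s = G t <-> s - t \is a Num.int.
  split=> [/(@chart_inj _ _ SQ) /jq_inj /loop_inj //|st].
  by rewrite /G (loop_int _ _ st).
have [sp spE] := polyP i; have spP := polyhedronP spE.
pose ss c := projT1 (cid (polyC c)).
have ssP c : forall y, (SQ @` C c) y <-> exists2 s : seq 'rV[R]_(pl_dim SQ), s \in ss c & convex_hull s y.
  by apply: polyhedronP; rewrite /ss; case: cid.
have ex_l (s s' : seq 'rV[R]_(pl_dim SQ)) : exists l : seq R, s' \in sp ->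
    forall u v w, 0 <= u -> v <= 1 -> u < w < v -> (forall x, x \in l -> ~ (u < x < v)) ->
    (convex_hull s `&` convex_hull s') (G w) -> forall x, u <= x <= v -> convex_hull s (G x).
  have [s'p|s'p] := pselect (s' \in sp); last by exists [::].
  have [||y [_ s'y]|l lP] := @convex_piece R _ G cG Ginj (convex_hull s `&` convex_hull s').
  - by apply: compact_closedI; [exact: hull_compact|exact: hull_closed].
  - by move=> x y t [sx s'x] [sy s'y] t01; split; exact: hull_convex.
  - have [_ [w [x _ <-] <-] <-] : (SQ @` (jq @` petal i)) y by apply/spP; exists s'.
    by have [t _ <-] := @loop_surj_window _ _ p i x 0; exists t.
  exists l => _ u v' w u0 v1 uwv nl Gw x xuv.
  by have [] := lP u v' w u0 v1 uwv nl Gw x xuv.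
pose ell s s' := projT1 (cid (ex_l s s')).
have ellP s s' := projT2 (cid (ex_l s s')).
apply: (@subdiv_refine _ _ (flatten [seq ell s s' | s <- ss true ++ ss false, s' <- sp])).
  exact: ler01.
move=> u v' u0 uv v1 nl.
have [e|uv'] := eqVneq u v'.
  have [c Cc] := Ccov (jq (loop p i u)).
  by apply: (@subdiv1 _ _ _ _ c) => // x; rewrite -e -eq_le => /eqP <-.
have {}uv' : u < v' by rewrite lt_neqAle uv' uv.
pose w := (u + v') / 2.
have uwv : u < w < v' by rewrite /w; apply/andP; split; lra.
have [c Cc] := Ccov (jq (loop p i w)).
have [s sc sw] : exists2 s : seq 'rV[R]_(pl_dim SQ), s \in ss c & convex_hull s (G w).
  by apply/ssP; exists (jq (loop p i w)).
have [s' s'p s'w] : exists2 s' : seq 'rV[R]_(pl_dim SQ), s' \in sp & convex_hull s' (G w).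
  by apply/spP; exists (jq (loop p i w)) => //; exists (loop p i w) => //; apply/petalP; exists w.
apply: (@subdiv1 _ _ _ _ c) => // x xuv.
have : convex_hull s (G x).
  apply: (ellP s s' s'p u v' w u0 v1 uwv _ _ x xuv) => // y yl; apply: nl.
  apply/flattenP; exists (ell s s') => //; apply/allpairsP; exists (s, s'); split=> //=.
  by rewrite mem_cat; case: c sc {Cc} => ->; rewrite ?orbT.
move=> sx; have [a Ca /(@chart_inj _ _ SQ) e] : (SQ @` C c) (G x) by apply/ssP; exists s.
by rewrite /on_petal /= -e.
Qed.

Lemma arc_inverse a b i o be : a < b -> is_arc f a b i o be ->
  exists xi : R -> R, forall u, 0 <= u <= 1 -> a <= xi u <= b /\ be (xi u) = u.
Proof.
move=> ab [cb b0 b1 _ _].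
have ex u : 0 <= u <= 1 -> exists2 t, a <= t <= b & be t = u.
  by move=> u01; apply: (IVT_between cb (ltW ab)); rewrite b0 b1 u01.
exists (fun u => if pselect (0 <= u <= 1) is left h then projT1 (cid2 (ex u h)) else 0).
by move=> u u01; case: pselect => // h; case: cid2.
Qed.

Lemma orient01 (o : bool) (u : R) : 0 <= u <= 1 -> 0 <= orient o u <= 1.
Proof. by case: o => //= /andP[u0 u1]; apply/andP; split; lra. Qed.

Lemma orientK (o : bool) : involutive (@orient R o).
Proof. by case: o => u //=; rewrite /orient subKr. Qed.

Lemma arc_mono a b i o be s t : is_arc f a b i o be -> a <= s <= b -> a <= t <= b ->
  (be s <= be t) = (s <= t).
Proof. by move=> [_ _ _ mono _] sab tab; apply: mono; rewrite in_itv. Qed.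

(** Numbering of a petal as met along an arc, reversed when the arc runs backwards: [flip o K]
    renumbers the [K.+1] cut points, [flip o K.-1] the [K] pieces. *)
Definition flip (o : bool) K k := if o then k else (K - k)%N.

Lemma arc_has_subdiv a b i o be : a < b -> is_arc f a b i o be -> has_subdiv on_circle a b.
Proof.
move=> ab A; have [xi xiP] := arc_inverse ab A; have [cb b0 b1 _ AF] := A.
have [K [tau [lam S]]] := petal_has_subdiv i; have [K0 t0 tK h] := S.
have tin k : (k <= K)%N -> 0 <= tau k <= 1.
  by move=> kK; rewrite -{1}t0 -tK !(subdiv_le S).
have fin k : (k <= K)%N -> (flip o K k <= K)%N by rewrite /flip; case: o {A AF} => // _; exact: leq_subr.
have aab : a <= a <= b by rewrite lexx ltW.
have bab : a <= b <= b by rewrite lexx ltW.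
have be_inj s t : a <= s <= b -> a <= t <= b -> be s = be t -> s = t.
  by move=> sab tab e; apply/eqP; rewrite eq_le -(arc_mono A sab tab) -(arc_mono A tab sab) e lexx.
pose sg k := xi (orient o (tau (flip o K k))).
have sgP k : (k <= K)%N -> a <= sg k <= b /\ be (sg k) = orient o (tau (flip o K k)).
  by move=> kK; apply: xiP; apply: orient01; apply: tin; exact: fin.
exists K, sg, (fun k => lam (if o then k else K.-1 - k)%N); split=> //.
- have [s0 e0] := sgP 0%N isT; apply: be_inj => //; rewrite e0 b0 /flip.
  by case: o {A AF sg sgP fin s0 e0}; rewrite /= ?subn0 ?t0 // tK subrr.
- have [s0 e0] := sgP K (leqnn K); apply: be_inj => //; rewrite e0 b1 /flip.
  by case: o {A AF sg sgP fin s0 e0}; rewrite /= ?subnn ?tK // t0 subr0.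
- move=> k kK; have [s1 e1] := sgP k (ltnW kK); have [s2 e2] := sgP k.+1 kK.
  pose k' := (if o then k else K.-1 - k)%N.
  have k'K : (k' < K)%N by rewrite /k'; case: o {A AF sg sgP fin s1 e1 s2 e2 k'} => //; lia.
  have [l1 p1] := h k' k'K.
  have E x : (be (sg k) <= x <= be (sg k.+1)) = (tau k' <= orient o x <= tau k'.+1).
    rewrite e1 e2 /flip /k'; case: o {A AF sg sgP fin s1 e1 s2 e2 k' k'K l1 p1} => //=.
    have -> : (K - k)%N = (K.-1 - k).+1 by lia.
    have -> : (K - k.+1)%N = (K.-1 - k)%N by lia.
    by apply/idP/idP => /andP[h1 h2]; apply/andP; split; lra.
  split.
    rewrite -(arc_mono A s1 s2) e1 e2 /flip; move: l1; rewrite /k'.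
    case: o {A AF sg sgP fin s1 e1 s2 e2 k' k'K p1 E} => //=.
    have -> : (K - k)%N = (K.-1 - k).+1 by lia.
    have -> : (K - k.+1)%N = (K.-1 - k)%N by lia.
    by move=> ?; lra.
  move=> x /andP[x1 x2].
  have xab : a <= x <= b.
    by case/andP: s1 => s11 _; case/andP: s2 => _ s22; rewrite (le_trans s11 x1) (le_trans x2 s22).
  rewrite /on_circle /= AF //; apply: p1; rewrite -E.
  by rewrite (arc_mono A s1 xab) (arc_mono A xab s2) x1.
Qed.

Lemma arc_points a b i o be K tau lam d : a < b -> is_arc f a b i o be ->
  subdiv (on_petal i) 0 1 K tau lam ->
  (forall k, (k < K)%N -> tau k <= d k <= tau k.+1 /\ ~ on_petal i (~~ lam k) (d k)) ->
  exists e : nat -> R, forall k, (k < K)%N ->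
    [/\ a <= e k <= b, ~ on_circle (~~ lam (flip o K.-1 k)) (e k) &
        ((k.+1 < K)%N -> e k <= e k.+1)].
Proof.
move=> ab A S dP; have [xi xiP] := arc_inverse ab A; have [cb b0 b1 _ AF] := A.
have [K0 t0 tK h] := S.
have din k : (k < K)%N -> 0 <= d k <= 1.
  move=> kK; have [/andP[d1 d2] _] := dP k kK.
  by rewrite (le_trans _ d1) -?t0 ?(subdiv_le S) //= ?(ltnW kK) // -tK (le_trans d2) // (subdiv_le S).
have dmono k l : (k <= l)%N -> (l < K)%N -> d k <= d l.
  rewrite leq_eqVlt => /orP[/eqP ->//|kl] lK.
  have [/andP[_ d2] _] := dP k (ltn_trans kl lK); have [/andP[d1 _] _] := dP l lK.
  by apply: le_trans d2 _; apply: le_trans d1; apply: (subdiv_le S) => //; exact: ltnW.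
have fin k : (k < K)%N -> (flip o K.-1 k < K)%N.
  by rewrite /flip; case: o {A AF} => // kK; lia.
have eP k : (k < K)%N -> a <= xi (orient o (d (flip o K.-1 k))) <= b /\
    be (xi (orient o (d (flip o K.-1 k)))) = orient o (d (flip o K.-1 k)).
  by move=> kK; apply: xiP; apply: orient01; apply: din; exact: fin.
exists (fun k => xi (orient o (d (flip o K.-1 k)))) => k kK; have [e1 e2] := eP k kK.
split=> [//||kK1].
  by rewrite /on_circle /= AF // e2 orientK; have [] := dP _ (fin k kK).
have [e3 e4] := eP k.+1 kK1.
rewrite -(arc_mono A e1 e3) e2 e4 /flip.
case: o {A AF fin eP e1 e2 e3 e4} => /=; first exact: dmono.
by rewrite lerD2l lerN2; apply: dmono; lia.
Qed.

End SplitComplex.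

Section Counting.

Lemma card_interior (m c : nat) : (\sum_(k < m) ((0 < k) && (k < c.-1))%N <= c.-2)%N.
Proof.
suff h : (\sum_(k < m) ((0 < k) && (k < c.-1))%N <= (minn m c.-1).-1)%N by lia.
elim: m => [|m IH]; first by rewrite big_ord0.
by rewrite big_ord_recr /=; move: IH; case: (posnP m) => [->|m0]; case: (ltnP m c.-1) => h /=; lia.
Qed.

(* The pieces that contain the vertex form a single class [None]. *)
Definition piece_class (I : finType) m (K : I -> nat) (ik : I * 'I_m) : option (I * 'I_m) :=
  if (0 < ik.2)%N && (ik.2 < (K ik.1).-1)%N then Some ik else None.

Definition piece_classes (I : finType) m (K : I -> nat) (lam : I -> nat -> bool) c : {set option (I * 'I_m)} :=
  [set piece_class K ik | ik in [set ik : I * 'I_m | (ik.2 < K ik.1)%N && (lam ik.1 ik.2 == c)]]%SET.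

(** Apart from its first and last ones a petal has [K i - 2] pieces, shared out between the colours;
    only the class [None] can occur for both. *)
Lemma card_classes (I : finType) m (K : I -> nat) (lam : I -> nat -> bool) (S := @piece_classes I m K lam) :
  (#|S true| + #|S false| <= \sum_i (K i).-2 + (None \in S true) + (None \in S false))%N.
Proof.
pose T c := [set ik : I * 'I_m | [&& (0 < ik.2)%N, (ik.2 < (K ik.1).-1)%N & lam ik.1 ik.2 == c]]%SET.
have sub c : (#|S c| <= #|T c| + (None \in S c))%N.
  rewrite (cardsD1 None) addnC leq_add2r.
  apply: leq_trans (_ : #|[set Some ik | ik in T c]%SET| <= _)%N; last exact: leq_imset_card.
  apply: subset_leq_card; apply/fintype.subsetP => x; rewrite !inE => /andP[xN /imsetP[ik]].
  rewrite inE /piece_class => /andP[_ lc]; case: ifP => [/andP[h1 h2] xE|_ xE]; last by rewrite xE in xN.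
  by apply/imsetP; exists ik; rewrite // inE h1 h2.
have TT : (#|T true| + #|T false| <= \sum_i (K i).-2)%N.
  rewrite -cardsUI (_ : T true :&: T false = finset.set0) ?cards0 ?addn0; last first.
    by apply/setP => ik; rewrite !inE; case: (lam _ _); rewrite /= ?andbF.
  apply: leq_trans (_ : \sum_i \sum_(k < m) ((0 < k) && (k < (K i).-1))%N <= _)%N; last first.
    by apply: leq_sum => i _; exact: card_interior.
  rewrite pair_big /= -sum1_card big_mkcond /=; apply: leq_sum => -[i k] _ /=.
  by rewrite !inE; case: (0 < k)%N; case: (_ < _)%N; case: (lam _ _).
by have := sub true; have := sub false; lia.
Qed.

Lemma petal_sum_bound (n M : nat) (io : nat -> 'I_n) (g : 'I_n -> nat) :
  (forall i, exists j k, [/\ (j < M)%N, (k < M)%N, j <> k, io j = i & io k = i]) ->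
  (2 * \sum_i g i <= \sum_(j < M) g (io j))%N.
Proof.
move=> two; rewrite (partition_big (fun j : 'I_M => io j) predT) //= big_distrr /=.
apply: leq_sum => i _; have [j [k [jM kM jk ji ki]]] := two i.
have kj : Ordinal kM != Ordinal jM by apply/eqP => -[] /esym.
rewrite (bigD1 (Ordinal jM)) /= ?ji // (bigD1 (Ordinal kM)) /= ?ki ?eqxx //.
by rewrite addnA mul2n -addnn leq_addr.
Qed.

End Counting.

(** * Changes of colour and the rank inequality *)

Section SplitCount.
Variables (R : realType) (n : nat) (p : 'I_n.+1 -> circle R) (f : circle R -> bouquet p).
Local Notation Q := (one_relator_complex f).
Local Notation q := (disk_to_complex f).
Local Notation jq := (bouquet_to_complex f).
Local Notation bd := (bdry_incl R).
Local Notation F := (fun t => f (ce t)).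
Local Notation v := (vertex p).
Variables (SQ : pl_structure R Q) (C : bool -> set Q).
Hypotheses (fc : continuous f) (fs : forall y, exists x, f x = y).
Hypotheses (polyC : forall c, subpolyhedron SQ (C c)) (finC : forall c, finite_set (H1 R (C c))).
Hypotheses (CT : forall c, C c <> setT) (Ccov : forall a, exists c, C c a).
Hypothesis polyP : forall i, subpolyhedron SQ (jq @` petal (p := p) i).

(** Only the sum of the two parts is prescribed, so a constant can be moved from [y] to [x].
    Vanishing at [w0] saves one class for each colour in the rank bound. *)
Lemma chord_based c (w0 : bouquet p) (al be : R) : C c (jq w0) ->
  al < be < al + 1 -> ~ C c (jq (F al)) -> ~ C c (jq (F be)) ->
  exists xy : (disk R -> R) * (bouquet p -> R),
    [/\ {within q @^-1` C c, continuous xy.1}, {within jq @^-1` C c, continuous xy.2},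
        forall z, C c (q z) -> xy.1 z \is a Num.int, forall w, C c (jq w) -> xy.2 w \is a Num.int &
        xy.2 w0 = 0 /\
        forall t, `|t - al| < 1 -> `|be - t| < 1 -> C c (jq (F t)) ->
          (if al < t < be then 1 else 0) = xy.1 (bd (ce t)) + xy.2 (F t)].
Proof.
move=> Cw0 ab Ca Cb.
have [x [y [cx cy xZ yZ E]]] := chord fs (polyC c) (@finC c) ab Ca Cb.
exists ((fun z => x z + y w0), (fun w => y w - y w0)); split=> /=.
- apply: sub_within; apply: contI => z; apply: contD; last exact: contC.
  by have := within_sub cx => /(_ z).
- apply: sub_within; apply: contI => z; apply: contD; last exact: contC.
  by have := within_sub cy => /(_ z).
- by move=> z Cz; rewrite rpredD ?xZ ?yZ.
- by move=> w Cw; rewrite rpredB ?yZ.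
- by split=> [|t ta tb Ct]; [rewrite subrr|rewrite E //; ring].
Qed.

Lemma bdry_pull c (x : disk R -> R) : {within q @^-1` C c, continuous x} ->
  {within on_circle C c, continuous (fun t => x (bd (ce t)))}.
Proof.
move=> cx; apply: sub_within.
have Cb (t : on_circle C c) : (q @^-1` C c) (bd (ce (set_val t))).
  by rewrite /= q_bdry; exact: (set_valP t).
have cb : continuous (fun t => mk_sub (Cb t)).
  apply: sub_cont; apply: (cont_comp _ (@bdry_cont R)); apply: (cont_comp _ (@ce_cont R)).
  exact: set_val_continuous.
exact: (cont_comp cb (within_sub cx)).
Qed.

Lemma petal_pull c i (y : bouquet p -> R) : {within jq @^-1` C c, continuous y} ->
  {within on_petal C i c, continuous (fun t => y (loop p i t))}.
Proof.
move=> cy; apply: sub_within.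
have Cb (t : on_petal C i c) : (jq @^-1` C c) (loop p i (set_val t)) by exact: (set_valP t).
have cb : continuous (fun t => mk_sub (Cb t)).
  apply: sub_cont; apply: (cont_comp _ (@loop_cont _ _ p i)); exact: set_val_continuous.
exact: (cont_comp cb (within_sub cy)).
Qed.

Lemma piece_const (P : set R) (u : R -> R) a b : {within P, continuous u} ->
  (forall t, P t -> u t \is a Num.int) -> (forall t, a <= t <= b -> P t) ->
  forall s t, a <= s <= b -> a <= t <= b -> u s = u t.
Proof.
move=> cu uZ abP; apply: const_on_interval => [|t tab]; last by apply: uZ; exact: abP.
by apply: continuous_subspaceW cu => t; rewrite /= in_itv /= => /abP.
Qed.

Lemma petal_alternating i : exists D : nat * (nat -> R) * (nat -> bool) * (nat -> R),
  [/\ (1 < D.1.1.1)%N, subdiv (on_petal C i) 0 1 D.1.1.1 D.1.1.2 D.1.2,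
    forall k, (k < D.1.1.1)%N -> D.1.2 k = D.1.2 0%N (+) odd k &
    forall k, (k < D.1.1.1)%N -> D.1.1.2 k <= D.2 k <= D.1.1.2 k.+1 /\
      ~ on_petal C i (~~ D.1.2 k) (D.2 k)].
Proof.
have hs := petal_has_subdiv polyC Ccov polyP i.
have [|K [tau [lam [d [h1 h2 h3 h4]]]]] := alternating_subdiv hs; last by exists (K, tau, lam, d).
move=> c; have [t nt] := petal_not_inside fc fs (polyC c) (@finC c) i (@CT c).
have [s /andP[s0 s1] st] := window 0 t.
exists s; first by rewrite s0 ltW //; rewrite add0r in s1.
by rewrite /on_petal /= (loop_int _ _ st).
Qed.

Variables (M : nat) (th : nat -> R) (io : nat -> 'I_n.+1) (o : nat -> bool) (be : nat -> R -> R).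
Hypothesis A : arc_seq f M th io o be.
Hypothesis two : forall i, exists j k, [/\ (j < M)%N, (k < M)%N, j <> k, io j = i & io k = i].

Lemma th_le j k : (j <= k)%N -> (k <= M)%N -> th j <= th k.
Proof.
have [_ _ ths _] := A; elim: k => [|k IH]; first by rewrite leqn0 => /eqP ->.
rewrite leq_eqVlt => /orP[/eqP -> //|jk] kM.
by apply: le_trans (IH jk (ltnW kM)) _; apply: ltW; exact: ths.
Qed.

Lemma circle_has_subdiv : has_subdiv (on_circle C) (th 0) (th M).
Proof.
have [M0 _ ths arcs] := A.
suff h m : (0 < m <= M)%N -> has_subdiv (on_circle C) (th 0) (th m) by apply: h; rewrite M0 leqnn.
elim: m => // m IH /andP[_ mM].
have hm : has_subdiv (on_circle C) (th m) (th m.+1).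
  have := arc_has_subdiv polyC Ccov polyP (ths m mM) (arcs m mM).
  done.
case: m IH mM hm => // m IH mM hm; apply: subdiv_cat hm; apply: IH; exact: ltnW.
Qed.

Lemma on_circle_per c s t : s - t \is a Num.int -> on_circle C c s -> on_circle C c t.
Proof. by rewrite /on_circle /= => /ce_int ->. Qed.

Variables (K : 'I_n.+1 -> nat) (tau : 'I_n.+1 -> nat -> R) (lam : 'I_n.+1 -> nat -> bool)
  (d : 'I_n.+1 -> nat -> R).
Hypothesis DP : forall i : 'I_n.+1, [/\ (1 < K i)%N, subdiv (on_petal C i) 0 1 (K i) (tau i) (lam i),
    forall k, (k < K i)%N -> lam i k = lam i 0%N (+) odd k &
    forall k, (k < K i)%N -> tau i k <= d i k <= tau i k.+1 /\
      ~ on_petal C i (~~ lam i k) (d i k)].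

Variables (L : nat) (sg : nat -> R) (mu : nat -> bool) (dX : nat -> R).
Hypotheses (L1 : (1 < L)%N) (SX : subdiv (on_circle C) (th 0) (th M) L sg mu).
Hypotheses (muE : forall k, (k < L)%N -> mu k = mu 0%N (+) odd k)
  (dXP : forall k, (k < L)%N -> sg k <= dX k <= sg k.+1 /\ ~ on_circle C (~~ mu k) (dX k)).

(* Each change of colour along the arcs costs a piece of the circle. *)
Lemma changes_bound :
  (\sum_(j < M) (K (io j)).-1 <= L.-1)%N /\
  (M = 2%N -> lam (io 0%N) (flip (o 0%N) (K (io 0%N)).-1 (K (io 0%N)).-1) !=
     lam (io 1%N) (flip (o 1%N) (K (io 1%N)).-1 0) ->
   ((K (io 0%N)).-1 + (K (io 1%N)).-1 < L.-1)%N).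
Proof.
have [M0 thM ths arcs] := A.
have [idx [idxL idxP idxm idxc]] := subdiv_index SX.
(* [e j k] is a point on the [k]-th piece met along arc [j] having only the colour of that piece.
   Successive ones on an arc differ in colour, so they lie in different pieces of the circle. *)
have ex j : exists e : nat -> R, (j < M)%N -> forall k, (k < K (io j))%N ->
    [/\ th j <= e k <= th j.+1, ~ on_circle C (~~ lam (io j) (flip (o j) (K (io j)).-1 k)) (e k) &
        ((k.+1 < K (io j))%N -> e k <= e k.+1)].
  have [jM|jM] := ltnP j M; last by exists (fun=> 0).
  have [_ S _ dP] := DP (io j).
  by have [e eP] := arc_points (ths j jM) (arcs j jM) S dP; exists e.
have [e eP] := choice ex.
have K1 i : (0 < K i)%N by have [h _ _ _] := DP i; exact: ltnW.
have ein j k : (j < M)%N -> (k < K (io j))%N -> th 0 <= e j k <= th M.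
  move=> jM kK; have [/andP[e1 e2] _ _] := eP j jM k kK.
  by rewrite (le_trans _ e1) ?th_le ?(ltnW jM) // (le_trans e2) // th_le.
have type j k : (j < M)%N -> (k < K (io j))%N -> mu (idx (e j k)) = lam (io j) (flip (o j) (K (io j)).-1 k).
  by move=> jM kK; have [_ nP _] := eP j jM k kK; apply: idxc => //; exact: ein.
have alt j k : (j < M)%N -> (k.+1 < K (io j))%N -> (idx (e j k) < idx (e j k.+1))%N.
  move=> jM kK; have [_ _ le] := eP j jM k (ltnW kK).
  rewrite ltn_neqAle idxm ?ein ?le ?andbT //; last exact: ltnW.
  apply/eqP => ee; have := type j k jM (ltnW kK); rewrite ee type //.
  have [_ _ lE _] := DP (io j).
  have [a [b [-> -> aK bK ab]]] : exists a b, [/\ flip (o j) (K (io j)).-1 k = a,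
      flip (o j) (K (io j)).-1 k.+1 = b, (a < K (io j))%N, (b < K (io j))%N & odd a = ~~ odd b].
    rewrite /flip; case: (o j).
      by exists k, k.+1; split=> //; [exact: ltnW|rewrite /= negbK].
    exists ((K (io j)).-1 - k)%N, ((K (io j)).-1 - k.+1)%N; split; [by []|by []|lia|lia|].
    have -> : ((K (io j)).-1 - k = ((K (io j)).-1 - k.+1).+1)%N by lia.
    by [].
  by rewrite (lE a aK) (lE b bK) ab; case: (lam (io j) 0%N); case: (odd b).
have alts j k : (j < M)%N -> (k < K (io j))%N -> (idx (e j 0%N) + k <= idx (e j k))%N.
  move=> jM; elim: k => [|k IH] kK; first by rewrite addn0.
  by rewrite addnS; apply: leq_ltn_trans (IH (ltnW kK)) _; exact: alt.
have Kp i : ((K i).-1 < K i)%N by rewrite prednK.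
have next j : (j.+1 < M)%N -> e j (K (io j)).-1 <= e j.+1 0%N.
  move=> jM; have [/andP[_ e2] _ _] := eP j (ltnW jM) _ (Kp _).
  by have [/andP[e1 _] _ _] := eP j.+1 jM 0%N (K1 _); exact: le_trans e2 e1.
have nexti j : (j.+1 < M)%N -> (idx (e j (K (io j)).-1) <= idx (e j.+1 0%N))%N.
  by move=> jM; apply: idxm; [apply: ein => //; exact: ltnW|exact: ein|exact: next].
have sum m : (m < M)%N -> (\sum_(j < m.+1) (K (io j)).-1 <= idx (e m (K (io m)).-1))%N.
  elim: m => [|m IH] mM.
    by rewrite big_ord_recr big_ord0 /=; apply: leq_trans (alts 0%N _ mM (Kp _)); rewrite add0n leq_addl.
  rewrite big_ord_recr /=; apply: leq_trans (alts m.+1 _ mM (Kp _)); rewrite leq_add2r.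
  by apply: leq_trans (IH (ltnW mM)) _; exact: nexti.
split.
  have := sum M.-1; rewrite prednK // => /(_ (leqnn _)) h; apply: leq_trans h _.
  rewrite -ltnS prednK //; last exact: ltnW.
  by apply: idxL; apply: ein; rewrite ?prednK.
move=> M2; have M1 : (1 < M)%N by rewrite M2.
have MM : (0 < M)%N by rewrite M2.
rewrite -(type 0%N _ MM (Kp _)) -(type 1%N _ M1 (K1 _)) => ne.
(* A change of colour at the junction of the two arcs makes the index jump there as well. *)
have h1 : (idx (e 0%N (K (io 0%N)).-1) < idx (e 1%N 0%N))%N.
  by rewrite ltn_neqAle nexti // andbT; apply: contraNneq ne => ->.
have h2 := alts 0%N _ MM (Kp _); have h3 := alts 1%N _ M1 (Kp _).
have h4 : (idx (e 1%N (K (io 1%N)).-1) < L)%N by apply: idxL; exact: ein.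
by lia.
Qed.


Section Classes.
Variables (m : nat) (Km : forall i, (K i <= m)%N).

Definition class_rep (cl : option ('I_n.+1 * 'I_m)) : bouquet p :=
  if cl is Some ik then loop p ik.1 (d ik.1 ik.2) else v.

(** An integer-valued continuous [y] is constant along a piece. The first and last pieces of a petal
    contain the vertex, which is therefore a common representative for the class [None]. *)
Lemma class_of c x : ~ C (~~ c) (jq x) -> exists cl,
  [/\ cl \in piece_classes m K lam c, C c (jq (class_rep cl)) &
      forall y : bouquet p -> R, {within jq @^-1` C c, continuous y} ->
        (forall w, C c (jq w) -> y w \is a Num.int) -> y x = y (class_rep cl)].
Proof.
move=> nx; have [i /petalP[t tx]] := bouquet_surj x.
have [u /andP[u0 u1] ut] := window 0 t; rewrite add0r in u1.
have {tx ut}ux : loop p i u = x by rewrite (loop_int _ _ ut).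
have [K1 S lE dP] := DP i; have [K0 t0 tK h] := S.
have [idx [idxL idxP _ idxc]] := subdiv_index S.
have u01 : 0 <= u <= 1 by rewrite u0 ltW.
have kK := idxL u u01; have uk := idxP u u01.
have lc : lam i (idx u) = c by apply: idxc => //; rewrite /on_petal /= ux.
have km := leq_trans kK (Km i).
have [_] := h _ kK; rewrite lc => inC.
exists (piece_class K (i, Ordinal km)); split.
- by apply/imsetP; exists (i, Ordinal km); rewrite // inE /= kK lc eqxx.
- rewrite /piece_class /=; case: ifP => [_|/negP nint] /=.
    by have [dk _] := dP _ kK; exact: inC dk.
  have [k0|kK'] : idx u = 0%N \/ (idx u).+1 = K i by lia.
    have := inC (tau i (idx u)); rewrite lexx (subdiv_le S) // /on_petal k0 t0 /= loop_int0 ?rpred0 //.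
    by apply.
  have := inC (tau i (idx u).+1); rewrite lexx (subdiv_le S) // /on_petal kK' tK /= loop_int0 ?rpred1 //.
  by apply.
- move=> y cy yZ; rewrite -ux.
  have pc s : tau i (idx u) <= s <= tau i (idx u).+1 -> y (loop p i u) = y (loop p i s).
    move=> hs; apply: (@piece_const (on_petal C i c) (fun t => y (loop p i t)) _ _ _ _ inC) => //.
      exact: petal_pull.
    by move=> w; exact: yZ.
  rewrite /piece_class /=; case: ifP => [_|/negP nint] /=.
    by apply: pc; have [dk _] := dP _ kK.
  have [k0|kK'] : idx u = 0%N \/ (idx u).+1 = K i by lia.
    by rewrite (pc (tau i (idx u))) ?lexx ?(subdiv_le S) // k0 t0 loop_int0 ?rpred0.
  by rewrite (pc (tau i (idx u).+1)) ?lexx ?(subdiv_le S) // ?andbT kK' tK loop_int0 ?rpred1.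
Qed.

(** The class of the point at [t0] supplies the base point [w0]. Functions vanishing there have zero
    columns on that class, so it does not contribute to the rank; hence the strict inequality. *)
Lemma class_base c t0 : ~ on_circle C (~~ c) t0 -> exists2 w0 : bouquet p, C c (jq w0) &
  forall m' n' (y : 'I_m' -> bouquet p -> R) (e : 'I_n' -> R),
    (forall i, {within jq @^-1` C c, continuous (y i)}) ->
    (forall i w, C c (jq w) -> y i w \is a Num.int) -> (forall i, y i w0 = 0) ->
    (forall a, ~ on_circle C (~~ c) (e a)) ->
  (\rank (\matrix_(i, a) y i (F (e a))) < #|piece_classes m K lam c|)%N.
Proof.
move=> nt0; have [b [bS Cb _]] := class_of nt0.
exists (class_rep b) => // m' n' y e cy yZ y0 ne.
pose g a := projT1 (cid (class_of (ne a))).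
have gP a : g a \in piece_classes m K lam c /\ forall i, y i (F (e a)) = y i (class_rep (g a)).
  have := projT2 (cid (class_of (ne a))); rewrite -/(g a) => -[h1 _ h3].
  by split=> // i; exact: h3 (cy i) (yZ i).
rewrite (cardsD1 b) bS add1n ltnS.
apply: (@rank_classes _ _ _ _ _ _ g (fun i cl => y i (class_rep cl))) => [i a|a].
  by rewrite mxE; have [_ ->] := gP a.
have [gS _] := gP a; rewrite !inE gS andbT.
by have [->|] := eqVneq (g a) b; [right|left].
Qed.

(** The pieces of the circle are paired: [2a] has colour [c1], [2a+1] has colour [c2], with points
    [P a] and [P' a] of a single colour. The chords from [P i] to [P i.+1] have their ends off
    [C c2] and are tested at the [P' a]; those from [P' j] to [P' j.+1] have their ends off [C c1]
    and are tested at the [P a]. The indicators are then the two shifted identity matrices of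
    [cyclic_rank_bound]. *)
Lemma rank_count : (L./2 < #|piece_classes m K lam true| + #|piece_classes m K lam false|)%N.
Proof.
have [M0 thM ths arcs] := A; have [L0 s0 sL h] := SX.
(* If [L] is odd there remains an unpaired last piece of colour [c1], which continues piece 0 across
   the period. *)
have [S LS] : exists S, L./2 = S.+1 by case: L L1 => [|[|l]] // _; exists l./2.
pose P a := dX a.*2; pose P' a := dX a.*2.+1.
pose c1 := mu 0%N; pose c2 := ~~ c1.
have L2 a : (a < S.+1)%N -> (a.*2.+1 < L)%N.
  by move=> aS; rewrite -[L]odd_double_half LS; lia.
have muP a : (a < S.+1)%N -> mu a.*2 = c1 by move=> /L2 aL; rewrite muE ?odd_double ?addbF //; exact: ltnW.
have muP' a : (a < S.+1)%N -> mu a.*2.+1 = c2.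
  by move=> /L2 aL; rewrite muE //= odd_double addbT.
have nP a : (a < S.+1)%N -> ~ on_circle C c2 (P a).
  by move=> aS; have [_] := dXP (ltnW (L2 _ aS)); rewrite muP.
have nP' a : (a < S.+1)%N -> ~ on_circle C c1 (P' a).
  by move=> aS; have [_] := dXP (L2 _ aS); rewrite muP' // negbK.
have ncov t : on_circle C c1 t \/ on_circle C c2 t.
  have [c Ct] := Ccov (jq (F t)).
  by move: Ct; rewrite /c2 /c1; case: c; case: (mu 0%N) => Ct; [left|right|right|left].
have PP' a : (a < S.+1)%N -> P a < P' a.
  move=> aS; have [/andP[_ l1] _] := dXP (ltnW (L2 _ aS)); have [/andP[l2 _] _] := dXP (L2 _ aS).
  rewrite lt_neqAle (le_trans l1 l2) andbT; apply/eqP => e.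
  by have [hc|hc] := ncov (P a); [rewrite e in hc; exact: nP' hc|exact: nP hc].
have P'P a : (a.+1 < S.+1)%N -> P' a < P a.+1.
  move=> aS; have [/andP[_ l1] _] := dXP (L2 _ (ltnW aS)); have [/andP[l2 _] _] := dXP (ltnW (L2 _ aS)).
  rewrite doubleS in l2.
  rewrite lt_neqAle (le_trans l1 l2) andbT; apply/eqP => e.
  by have [hc|hc] := ncov (P' a); [exact: nP' (ltnW aS) hc|rewrite e in hc; exact: nP hc].
have Pmono a b : (a < b)%N -> (b < S.+1)%N -> P' a < P b.
  elim: b => // b IH; rewrite ltnS leq_eqVlt => /orP[/eqP ->|ab] bS; first exact: P'P.
  by apply: lt_trans (IH ab (ltnW bS)) _; apply: lt_trans (PP' _ (ltnW bS)) _; exact: P'P.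
have Ple a b : (a <= b)%N -> (b < S.+1)%N -> P a <= P b.
  rewrite leq_eqVlt => /orP[/eqP ->//|ab] bS; apply: ltW; apply: lt_trans (Pmono a b ab bS).
  by apply: PP'; exact: ltn_trans bS.
have lo a : (a < S.+1)%N -> th 0 <= P a.
  move=> aS; have [/andP[l1 _] _] := dXP (ltnW (L2 _ aS)); apply: le_trans l1.
  by rewrite -s0 (subdiv_le SX) //; exact: ltnW (ltnW (L2 _ aS)).
have hi a : (a < S.+1)%N -> P' a <= th 0 + 1.
  move=> aS; have [/andP[_ l1] _] := dXP (L2 _ aS); apply: le_trans l1 _.
  by rewrite -thM -sL (subdiv_le SX) //; exact: L2.
have span a b : (a < S.+1)%N -> (b < S.+1)%N -> P' b - P a < 1.
  move=> aS bS; rewrite ltrBlDl lt_neqAle; apply/andP; split; last first.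
    by apply: le_trans (hi b bS) _; rewrite lerD2r lo.
  apply/eqP => e; have [hc|hc] := ncov (P' b); first exact: nP' bS hc.
  by apply: (nP a aS); apply: on_circle_per hc; rewrite e addrAC subrr add0r rpred1.
have S0 : (0 < S.+1)%N by [].
have nP'0 : ~ on_circle C (~~ c2) (P' 0%N) by rewrite negbK; exact: nP'.
have [w2 Cw2 rk2] := class_base nP'0.
have [w1 Cw1 rk1] := class_base (c := c1) (nP 0%N S0).
have ex2 (i : 'I_S) : exists xy : (disk R -> R) * (bouquet p -> R),
    [/\ {within q @^-1` C c2, continuous xy.1}, {within jq @^-1` C c2, continuous xy.2},
        forall z, C c2 (q z) -> xy.1 z \is a Num.int, forall w, C c2 (jq w) -> xy.2 w \is a Num.int &
        xy.2 w2 = 0 /\ forall a, (a < S.+1)%N -> (a == i)%:R = xy.1 (bd (ce (P' a))) + xy.2 (F (P' a))].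
  have iS : (i < S.+1)%N by exact: ltnW (ltn_ord i).
  have i1S : (i.+1 < S.+1)%N by rewrite ltnS.
  have [||||xy [h1 h2 h3 h4 [h5 h6]]] := @chord_based c2 w2 (P i) (P i.+1) => //.
  - rewrite (lt_trans (PP' _ iS) (P'P _ i1S)) /= -ltrBlDl; apply: le_lt_trans (span i i.+1 iS i1S).
    by rewrite lerD2r; apply: ltW; exact: PP'.
  - exact: nP.
  - exact: nP.
  exists xy; split=> //; split=> // a aS; rewrite -h6; first last.
  - by have [hc|//] := ncov (P' a); case: (nP' a aS).
  - rewrite ltr_norml; have := span i.+1 a i1S aS; have := span 0%N i.+1 S0 i1S.
    have := PP' i.+1 i1S; have := Ple 0%N a isT aS; have := PP' a aS; move=> *; apply/andP; split; lra.
  - rewrite ltr_norml; have := span i a iS aS; have := span 0%N i S0 iS.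
    have := PP' i iS; have := Ple 0%N a isT aS; have := PP' a aS; move=> *; apply/andP; split; lra.
  - have [ai|ai|ai] := ltngtP a i.
    + by rewrite ltNge (ltW (Pmono _ _ ai iS)).
    + by rewrite [P' a < _]ltNge (le_trans (Ple _ _ ai aS) (ltW (PP' _ aS))) andbF.
    + by rewrite ai PP' // P'P.
have ex1 (j : 'I_S) : exists xy : (disk R -> R) * (bouquet p -> R),
    [/\ {within q @^-1` C c1, continuous xy.1}, {within jq @^-1` C c1, continuous xy.2},
        forall z, C c1 (q z) -> xy.1 z \is a Num.int, forall w, C c1 (jq w) -> xy.2 w \is a Num.int &
        xy.2 w1 = 0 /\ forall a, (a < S.+1)%N -> (a == j.+1)%:R = xy.1 (bd (ce (P a))) + xy.2 (F (P a))].
  have iS : (j < S.+1)%N by exact: ltnW (ltn_ord j).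
  have i1S : (j.+1 < S.+1)%N by rewrite ltnS.
  have [||||xy [h1 h2 h3 h4 [h5 h6]]] := @chord_based c1 w1 (P' j) (P' j.+1) => //.
  - rewrite (lt_trans (P'P _ i1S) (PP' _ i1S)) /= -ltrBlDl; apply: le_lt_trans (span j j.+1 iS i1S).
    by rewrite lerD2l lerN2; apply: ltW; exact: PP'.
  - exact: nP'.
  - exact: nP'.
  exists xy; split=> //; split=> // a aS; rewrite -h6; first last.
  - by have [//|hc] := ncov (P a); case: (nP a aS).
  - rewrite ltr_norml; have := span a j.+1 aS i1S; have := span 0%N a S0 aS.
    have := PP' a aS; have := Ple 0%N j.+1 isT i1S; have := PP' _ i1S; move=> *; apply/andP; split; lra.
  - rewrite ltr_norml; have := span a j aS iS; have := span 0%N a S0 aS.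
    have := PP' a aS; have := Ple 0%N j isT iS; have := PP' _ iS; move=> *; apply/andP; split; lra.
  - have [aj|aj|aj] := ltngtP a j.+1.
    + by rewrite ltnS in aj; rewrite ltNge (le_trans (Ple _ _ aj iS) (ltW (PP' _ iS))).
    + by rewrite [P a < _]ltNge (ltW (Pmono _ _ aj aS)) andbF.
    + by rewrite aj P'P // PP'.
have [xy2 xy2P] := choice ex2; have [xy1 xy1P] := choice ex1.
pose X := \matrix_(i < S, a < S.+1) (xy2 i).1 (bd (ce (P' a))).
pose Y := \matrix_(i < S, a < S.+1) (xy2 i).2 (F (P' a)).
pose X' := \matrix_(j < S, a < S.+1) (xy1 j).1 (bd (ce (P a))).
pose Y' := \matrix_(j < S, a < S.+1) (xy1 j).2 (F (P a)).
have rY : (\rank Y < #|piece_classes m K lam c2|)%N.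
  apply: (rk2 _ _ (fun i => (xy2 i).2) (fun a : 'I_S.+1 => P' a)) => [i|i|i|a].
  - by have [] := xy2P i.
  - by have [_ _ _ h4 _] := xy2P i.
  - by have [_ _ _ _ []] := xy2P i.
  - by rewrite negbK; exact: nP'.
have rY' : (\rank Y' < #|piece_classes m K lam c1|)%N.
  apply: (rk1 _ _ (fun j => (xy1 j).2) (fun a : 'I_S.+1 => P a)) => [i|i|i|a].
  - by have [] := xy1P i.
  - by have [_ _ _ h4 _] := xy1P i.
  - by have [_ _ _ _ []] := xy1P i.
  - exact: nP.
have bound : (S <= \rank Y + \rank Y')%N.
  apply: (@cyclic_rank_bound _ _ X Y X' Y').
  - by move=> i a; rewrite !mxE; have [_ _ _ _ [_ e]] := xy2P i; exact: esym (e a (ltn_ord a)).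
  - by move=> j a; rewrite !mxE; have [_ _ _ _ [_ e]] := xy1P j; exact: esym (e a (ltn_ord a)).
  - move=> i j.
    have [cx _ xZ _ _] := xy2P i; have [cx' _ xZ' _ _] := xy1P j.
    have cl c : closed (q @^-1` C c).
      by apply: closed_comp => [z _|]; [exact: q_cont|exact: subpoly_closed (polyC c)].
    (* The product of the two disk parts, considered where both colours hold, is a coboundary
       [al - bt] with [al] living on [c1] and [bt] on [c2]. *)
    have [||z [C1 C2]|al [bt [ca cb aZ bZ E]]] := @unicoherence R (disk R) (@diskT_compact R)
      (@disk_hausdorff R) (@disk_contractible R) _ _ (fun z => (xy2 i).1 z * (xy1 j).1 z) (cl c1) (cl c2).
    - apply/seteqP; split=> // z _; have [c Cc] := Ccov (q z).
      by move: Cc; rewrite /c2 /c1 /=; case: c; case: (mu 0%N) => Cc; [left|right|right|left].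
    - apply: sub_within; apply: contI => z; apply: contM.
        have h2 : {within q @^-1` C c1 `&` q @^-1` C c2, continuous (xy2 i).1}.
          by apply: continuous_subspaceW cx => u [].
        by have := within_sub h2 => /(_ z).
      have h1 : {within q @^-1` C c1 `&` q @^-1` C c2, continuous (xy1 j).1}.
        by apply: continuous_subspaceW cx' => u [].
      by have := within_sub h1 => /(_ z).
    - by rewrite rpredM ?xZ ?xZ'.
    pose e t := bd (ce t).
    have pc c (w : disk R -> R) : {within q @^-1` C c, continuous w} ->
        (forall z, C c (q z) -> w z \is a Num.int) -> forall k s t, (k < L)%N -> mu k = c ->
        sg k <= s <= sg k.+1 -> sg k <= t <= sg k.+1 -> w (e s) = w (e t).
      move=> cw wZ k s t kL muk hs ht; have [_ inC] := h k kL; rewrite muk in inC.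
      apply: (@piece_const (on_circle C c) (fun t => w (e t)) _ _ _ _ inC) => //; first exact: bdry_pull.
      by move=> u Cu; apply: wZ; rewrite /e q_bdry.
    have pin k : (k < L)%N -> sg k <= dX k <= sg k.+1 by move=> kL; have [] := dXP kL.
    have inl k : (k < L)%N -> sg k <= sg k <= sg k.+1 by move=> kL; rewrite lexx; have [->] := h k kL.
    have inr k : (k < L)%N -> sg k <= sg k.+1 <= sg k.+1 by move=> kL; rewrite lexx; have [->] := h k kL.
    have per : e (sg L) = e (sg 0%N) by rewrite sL s0 thM /e ce_add1.
    have odds (a : 'I_S.+1) : on_circle C c1 (sg a.*2.+1) /\ on_circle C c2 (sg a.*2.+1) /\ on_circle C c2 (sg a.*2.+2).
      have aL := L2 _ (ltn_ord a); have [_ in1] := h _ (ltnW aL); have [_ in2] := h _ aL.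
      rewrite -(muP a) // -(muP' a) //; split; [exact: in1 (inr _ (ltnW aL))|split].
        exact: in2 (inl _ aL).
      exact: in2 (inr _ aL).
    (* The end of piece [2a+1] starts a stretch of colour [c1] leading to [P (ordS a)]; after the
       last pair this stretch crosses the period, by way of the unpaired piece if there is one. *)
    have next (a : 'I_S.+1) : on_circle C c1 (sg a.*2.+2) /\ forall w : disk R -> R,
        {within q @^-1` C c1, continuous w} -> (forall z, C c1 (q z) -> w z \is a Num.int) ->
        w (e (sg a.*2.+2)) = w (e (P (ordS a))).
      have aL := L2 _ (ltn_ord a).
      have [aS|aS] := ltnP a.+1 S.+1.
        have bL := ltnW (L2 _ aS); have mb := muP _ aS; rewrite doubleS in bL mb.
        have [_ inb] := h _ bL; split; first by rewrite -mb; exact: inb (inl _ bL).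
        move=> w cw wZ; rewrite /P /= modn_small // doubleS.
        by apply: (pc c1 w cw wZ _ _ _ bL mb); [exact: inl|exact: pin].
      have eS : a.+1 = S.+1 by apply/eqP; rewrite eqn_leq ltn_ord.
      have ordS0 : P (ordS a) = dX 0%N by rewrite /P /= eS modnn.
      have [_ in0] := h _ L0.
      have LE : L = a.*2.+2 \/ L = a.*2.+3.
        by have := odd_double_half L; rewrite LS; case: (odd L) => /= <-; [right|left]; lia.
      have fin (w : disk R -> R) : {within q @^-1` C c1, continuous w} -> (forall z, C c1 (q z) -> w z \is a Num.int) ->
          w (e (sg L)) = w (e (dX 0%N)).
        by move=> cw wZ; rewrite per; apply: (pc c1 w cw wZ _ _ _ L0 erefl); [exact: inl|exact: pin].
      case: LE => LE.
        rewrite ordS0 -LE; split=> //; apply: on_circle_per (in0 _ (inl _ L0)).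
        by rewrite sL s0 thM opprD addrA subrr sub0r rpredN rpred1.
      have bL : (a.*2.+2 < L)%N by rewrite LE.
      have mb : mu a.*2.+2 = c1 by rewrite muE //= negbK odd_double addbF.
      have [_ inb] := h _ bL; split; first by rewrite -mb; exact: inb (inl _ bL).
      move=> w cw wZ; rewrite ordS0 -fin // LE.
      by apply: (pc c1 w cw wZ _ _ _ bL mb); [exact: inl|exact: inr].
    (* Along piece [2a+1] the first disk part and [bt] are constant; before it, from [P a], and
       after it, up to [P (ordS a)], the second disk part and [al] are. Each summand is thus a
       difference of values of [al], and the cyclic sum telescopes to 0. *)
    have step (a : 'I_S.+1) : X i a * (X' j (ordS a) - X' j a) = al (e (P (ordS a))) - al (e (P a)).
      have aL := L2 _ (ltn_ord a); have [o1 [o2 o3]] := odds a; have [n1 nw] := next a.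
      rewrite !mxE mulrBr -!/(e _).
      have xP : (xy2 i).1 (e (sg a.*2.+1)) = (xy2 i).1 (e (P' a)).
        by apply: (pc c2 _ cx xZ _ _ _ aL (muP' _ _)) => //; [exact: inl|exact: pin].
      have xP2 : (xy2 i).1 (e (sg a.*2.+2)) = (xy2 i).1 (e (P' a)).
        by apply: (pc c2 _ cx xZ _ _ _ aL (muP' _ _)) => //; [exact: inr|exact: pin].
      have bP : bt (e (sg a.*2.+1)) = bt (e (sg a.*2.+2)).
        by apply: (pc c2 _ cb bZ _ _ _ aL (muP' _ _)) => //; [exact: inl|exact: inr].
      have pc1 (w : disk R -> R) : {within q @^-1` C c1, continuous w} -> (forall z, C c1 (q z) -> w z \is a Num.int) ->
          w (e (sg a.*2.+1)) = w (e (P a)).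
        move=> cw wZ; apply: (pc c1 w cw wZ _ _ _ (ltnW aL) (muP _ _)) => //; first exact: inr (ltnW aL).
        exact: pin (ltnW aL).
      have E1 : (xy2 i).1 (e (sg a.*2.+1)) * (xy1 j).1 (e (sg a.*2.+1)) = al (e (sg a.*2.+1)) - bt (e (sg a.*2.+1)).
        by apply: E; rewrite /= /e !q_bdry.
      have E2 : (xy2 i).1 (e (sg a.*2.+2)) * (xy1 j).1 (e (sg a.*2.+2)) = al (e (sg a.*2.+2)) - bt (e (sg a.*2.+2)).
        by apply: E; rewrite /= /e !q_bdry.
      rewrite xP (pc1 _ cx' xZ') (pc1 _ ca aZ) bP in E1.
      rewrite xP2 (nw _ cx' xZ') (nw _ ca aZ) in E2.
      by rewrite E1 E2; ring.
    under eq_bigr do rewrite step.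
    rewrite sumrB [X in _ - X](reindex_inj (can_inj (@ordSK S.+1))) /=.
    by rewrite subrr.
have cc : (#|piece_classes m K lam true| + #|piece_classes m K lam false| =
    #|piece_classes m K lam c1| + #|piece_classes m K lam c2|)%N.
  by rewrite /c2 /c1; case: (mu 0%N) => //=; rewrite addnC.
by rewrite cc LS; lia.
Qed.

End Classes.

End SplitCount.

(** * The shape of a splittable complex *)

Section SplitShape.
Variables (R : realType) (n : nat) (p : 'I_n.+1 -> circle R) (f : circle R -> bouquet p).
Local Notation Q := (one_relator_complex f).
Local Notation jq := (bouquet_to_complex f).
Variables (SQ : pl_structure R Q).
Hypotheses (fa : attaching_map f) (ft : taut f) (fu : unexposed f).
Hypothesis polyP : forall i, subpolyhedron SQ (jq @` petal (p := p) i).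
Variables (M : nat) (th : nat -> R) (io : nat -> 'I_n.+1) (o : nat -> bool) (be : nat -> R -> R).
Hypothesis A : arc_seq f M th io o be.

Lemma splittable_shape : finitely_splittable SQ -> [/\ n = 0%N, M = 2%N & o 0%N <> o 1%N].
Proof.
move=> [B0 [B1 [[pB0 B0T fB0] [pB1 B1T fB1] BT]]].
pose C c := if c then B0 else B1.
have polyC c : subpolyhedron SQ (C c) by case: c.
have finC c : finite_set (H1 R (C c)) by case: c.
have CT c : C c <> setT by case: c.
have Ccov a : exists c, C c a.
  have : (B0 `|` B1) a by rewrite BT.
  by case=> h; [exists true|exists false].
have [fc _] := fa.
have fs := f_surj fu A.
have two i : exists j k, [/\ (j < M)%N, (k < M)%N, j <> k, io j = i & io k = i].
  by have [j [k [h1 h2 h3 h4 h5]]] := petal_two_arcs fu A i; exists j, k.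
have [D DP] := choice (petal_alternating fc fs polyC finC CT Ccov polyP).
pose K i := (D i).1.1.1; pose tau i := (D i).1.1.2; pose lam i := (D i).1.2; pose d i := (D i).2.
have KP i : [/\ (1 < K i)%N, subdiv (on_petal C i) 0 1 (K i) (tau i) (lam i),
    forall k, (k < K i)%N -> lam i k = lam i 0%N (+) odd k &
    forall k, (k < K i)%N -> tau i k <= d i k <= tau i k.+1 /\
      ~ on_petal C i (~~ lam i k) (d i k)] by exact: DP.
have hs := circle_has_subdiv polyC Ccov polyP A.
have [|L [sg [mu [dX [L1 SX muE dXP]]]]] := alternating_subdiv hs.
  move=> c; have [t nt] := petal_not_inside fc fs (polyC c) (finC c) ord0 (@CT c).
  have [x fx] := fs (loop p ord0 t); have [s sw sx] := ce_surj_window (th 0%N) x.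
  have [_ -> _ _] := A; exists s; first by case/andP: sw => -> /ltW.
  by rewrite /on_circle /= sx fx.
have [ch1 ch2] := changes_bound A KP L1 SX.
pose m := (\sum_i K i)%N.
have Km i : (K i <= m)%N by rewrite /m (bigD1 i) //= leq_addr.
have rk := rank_count fs polyC finC Ccov A KP L1 SX muE dXP Km.
have /= cl := card_classes m K lam.
have ps := petal_sum_bound (fun i => (K i).-1) two.
have K2 i : (1 < K i)%N by have [] := KP i.
have Ksum : (\sum_i (K i).-1 = \sum_i (K i).-2 + n.+1)%N.
  have e : (\sum_(i < n.+1) 1 = n.+1)%N by rewrite sum1_card card_ord.
  rewrite -[X in (_ + X)%N]e -big_split /=; apply: eq_bigr => i _.
  by have := K2 i; lia.
have half := odd_double_half L; have oL := leq_b1 (odd L).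
pose e1 := None \in piece_classes m K lam true; pose e2 := None \in piece_classes m K lam false.
have [oe1 oe2] := (leq_b1 e1, leq_b1 e2).
rewrite -/e1 -/e2 in cl.
(* From [L./2 < sum (K i - 2) + 2] and [2 sum (K i - 1) <= L - 1] the number [n.+1] of petals is
   less than 2. *)
have n0 : n = 0%N.
  move: rk cl ps Ksum ch1 half; rewrite -muln2.
  move: (\sum_i (K i).-1)%N (\sum_i (K i).-2)%N (\sum_(j < M) _)%N => s1 s2 s3.
  move: #|_| #|_| (odd L : nat) (e1 : nat) (e2 : nat) oL oe1 oe2 L./2 => k1 k2 ol a b h1 h2 h3 hl.
  move=> h4 h5 h6 h7 h8 h9; clear -h1 h2 h3 h4 h5 h6 h7 h8 h9 L1; lia.
have i0 (i : 'I_n.+1) : i = ord0 by apply/val_inj => /=; have := ltn_ord i; lia.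
have sum0 (g : 'I_n.+1 -> nat) : (\sum_i g i = g ord0)%N.
  by rewrite (bigD1 ord0) //= big1 ?addn0 // => i; rewrite (i0 i) eqxx.
rewrite !sum0 in cl ps Ksum.
have [halfL hL] : (L <= L./2 * 2 + 1)%N /\ (L./2 < (K ord0).-2 + e1 + e2)%N.
  by split; [rewrite muln2; lia|exact: leq_trans rk cl].
clear rk cl half oL.
have ch1' : (M * (K ord0).-1 <= L.-1)%N.
  rewrite -[M]card_ord -sum_nat_const; apply: leq_trans ch1.
  by apply: leq_sum => j _; rewrite (i0 (io j)).
have two' : (1 < M)%N by have [j [k [h1 h2 h3 _ _]]] := two ord0; lia.
have K20 := K2 ord0.
have Lk : (L.-1 <= (K ord0).-1 * 2)%N.
  by move: oe1 oe2 hL halfL; move: (e1 : nat) (e2 : nat) L./2 => a b hl; clear -K20; lia.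
(* Now [L./2 < K - 2 + e1 + e2] while [L./2 >= K - 1], so the vertex class occurs for both
   colours. *)
have [E1 E2] : e1 /\ e2.
  rewrite /e1 /e2 in hL *; move: hL halfL ch1' two' K20.
  case: (None \in _); case: (None \in _) => //=; move: (K ord0) L./2 => k hl; clear -L1; nia.
(* The bounds are [M (K - 1) <= L - 1 <= 2 (K - 1)]. *)
have M2 : M = 2%N by move: ch1' two' K20 Lk; move: (K ord0) => k; clear -L1; nia.
have last c : None \in piece_classes m K lam c -> lam ord0 0%N = c \/ lam ord0 (K ord0).-1 = c.
  move=> /imsetP[[i k]]; rewrite inE /= (i0 i) => /andP[kK /eqP lc].
  rewrite /piece_class /=; case: ifP => // /negP nint _.
  have [k0|k0] : k = 0%N :> nat \/ k = (K ord0).-1 :> nat by lia.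
    by rewrite -k0; left.
  by rewrite -k0; right.
(* A vertex class of either colour comes from an end piece of the petal, so its two end pieces have
   different colours. *)
have ne : lam ord0 0%N <> lam ord0 (K ord0).-1.
  move=> e; have [] := last _ E1; have [] := last _ E2; rewrite -?e; by move=> ->.
(* In equal directions the last piece of the first traversal and the first piece of the second are
   opposite ends of the petal, so the colour changes once more at the vertex. *)
split=> // oe; have := ch2 M2; rewrite !(i0 (io _)) -oe /flip subnn subn0.
have -> : lam ord0 (if o 0%N then (K ord0).-1 else 0%N) != lam ord0 (if o 0%N then 0%N else (K ord0).-1).
  by case: (o 0%N); apply/eqP => e; apply: ne.
by move=> /(_ isT); rewrite M2 in ch1'; rewrite M2 in ch1 *; lia.
Qed.

End SplitShape.

(** * Null-homotopic attaching maps *)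

Section Shape.
Variables (R : realType) (n : nat) (p : 'I_n.+1 -> circle R) (f : circle R -> bouquet p).
Local Notation v := (vertex p).
Local Notation F := (fun t => f (ce t)).
Variables (M : nat) (th : nat -> R) (io : nat -> 'I_n.+1) (o : nat -> bool) (be : nat -> R -> R).
Hypothesis A : arc_seq f M th io o be.

Lemma th_lt j k : (j < k)%N -> (k <= M)%N -> th j < th k.
Proof.
have [_ _ ths _] := A => jk kM.
exact: lt_le_trans (ths j (leq_trans jk kM)) (th_le A jk kM).
Qed.

Lemma zeros_card : f @^-1` [set v] #= `I_M.
Proof.
have [M0 thM ths arcs] := A.
have -> : f @^-1` [set v] = (fun j => ce (th j)) @` `I_M.
  apply/seteqP; split=> x /=.
    move=> fx; have [t tw tx] := ce_surj_window (th 0%N) x; rewrite -thM in tw.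
    have [j jM /andP[]] := locate tw.
    rewrite le_eqVlt => /orP[/eqP e|h1] h2; first by exists j => //; rewrite e.
    have := @arc_open _ _ _ _ _ _ _ _ _ t (arcs j jM); rewrite h1 h2 tx fx => /(_ isT).
    by move=> [_ /(_ erefl)].
  by move=> [j jM <-]; apply: (th_vertex A); exact: ltnW.
apply: inj_card_eq => j k; rewrite !inE /= => jM kM /ce_inj e.
have win i : (i < M)%N -> th 0 <= th i < th 0 + 1.
  by move=> iM; rewrite -thM th_lt // (th_le A) // ltnW.
have {}e := window_small (win j jM) (win k kM) e.
case: (ltngtP j k) => // jk.
  by have := th_lt jk (ltnW kM); rewrite e ltxx.
by have := th_lt jk (ltnW jM); rewrite e ltxx.
Qed.

Hypotheses (fc : continuous f) (n0 : n = 0%N).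

Lemma petal_ord0 (i : 'I_n.+1) : i = ord0.
Proof. by apply/val_inj => /=; have := ltn_ord i; rewrite ltnS {2}n0 leqn0 => /eqP. Qed.

Lemma orient_cont (b : bool) : continuous (@orient R b).
Proof. by case: b; apply: contI => t; rewrite /orient; [exact: contId|cont_tac]. Qed.

(** Going through the petal and back is described by a real function [al] with equal values at both
    ends of the period; it descends to the circle and is contracted linearly to 0. *)
Lemma shape_null_homotopic : M = 2%N -> o 0%N <> o 1%N -> null_homotopic f.
Proof.
move=> M2 oo; have [M0 thM ths arcs] := A; rewrite M2 in thM ths arcs.
have [cb0 b00 b01 _ F0] := arcs 0%N isT; have [cb1 b10 b11 _ F1] := arcs 1%N isT.
have t01 := ths 0%N isT; have t12 := ths 1%N isT.
have o10 : o 1%N = ~~ o 0%N by case: (o 0%N) (o 1%N) oo => -[].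
pose al t := if t <= th 1%N then orient (o 0%N) (be 0%N t) else orient (o 1%N) (be 1%N t).
have lower t : th 0%N <= t <= th 1%N -> al t = orient (o 0%N) (be 0%N t).
  by rewrite /al => /andP[_ ->].
have upper t : th 1%N <= t <= th 2%N -> al t = orient (o 1%N) (be 1%N t).
  move=> /andP[t1 _]; rewrite /al; case: ifP => // t1'.
  have -> : t = th 1%N by apply/eqP; rewrite eq_le t1 t1'.
  by rewrite b01 b10 o10; case: (o 0%N); rewrite /orient /= ?subrr ?subr0.
have alF t : th 0%N <= t <= th 2%N -> F t = loop p ord0 (al t).
  move=> /andP[h0 h2]; have [h1|h1] := leP t (th 1%N).
    by rewrite lower ?h0 // -(petal_ord0 (io 0%N)) F0 ?h0.
  by rewrite upper ?h2 ?ltW // -(petal_ord0 (io 1%N)) F1 ?h2 ?ltW.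
have cal : {within `[th 0%N, th 2%N]%classic, continuous al}.
  have -> : `[th 0%N, th 2%N]%classic = `[th 0%N, th 1%N]%classic `|` `[th 1%N, th 2%N]%classic.
    apply/seteqP; split=> t /=; rewrite !in_itv /=.
      by move=> /andP[h0 h2]; have [h1|/ltW h1] := leP t (th 1%N); rewrite ?h0 ?h1 ?h2; [left|right].
    by case=> /andP[h1 h2]; rewrite ?h1 ?h2 ?(le_trans h2 (ltW t12)) ?(le_trans (ltW t01) h1).
  apply: withinU_continuous; try exact: itv_closed.
    apply: (@subspace_eq_continuous _ _ _ (fun t => orient (o 0%N) (be 0%N t))).
      by move=> t; rewrite inE /= in_itv /= => ht; exact: esym (lower t ht).
    by apply: continuous_subspaceT; exact: (cont_comp cb0 (@orient_cont _)).
  apply: (@subspace_eq_continuous _ _ _ (fun t => orient (o 1%N) (be 1%N t))).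
    by move=> t; rewrite inE /= in_itv /= => ht; exact: esym (upper t ht).
  by apply: continuous_subspaceT; exact: (cont_comp cb1 (@orient_cont _)).
have per : al (th 0%N) = al (th 2%N).
  rewrite lower ?lexx ?ltW // upper ?lexx ?ltW // b00 b11 o10.
  by case: (o 0%N); rewrite /orient /= ?subrr ?subr0.
pose T x := projT1 (cid2 (ce_surj_window (th 0%N) x)).
have TP x : th 0%N <= T x < th 2%N /\ ce (T x) = x by rewrite /T thM; case: cid2.
have alT t : th 0%N <= t <= th 2%N -> al t = al (T (ce t)).
  move=> /andP[h0 h2]; have [h1 /ce_inj e] := TP (ce t); rewrite thM in h1.
  have [t2|t2] := eqVneq t (th 2%N).
    have <- : th 0%N = T (ce t); last by rewrite t2 per.
    apply: (window_small _ h1); first by rewrite lexx ltrDl ltr01.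
    rewrite -opprB rpredN; have -> : T (ce t) - th 0%N = T (ce t) - t + 1 by rewrite t2 thM; ring.
    by rewrite rpredD ?rpred1.
  have -> // : T (ce t) = t.
  by apply: (window_small h1 _ e); rewrite h0 -thM lt_neqAle t2.
have cA : continuous (fun x => al (T x)).
  apply: contI => x.
  apply: (@compact_map_cont R (circle R) R `[th 0%N, th 2%N]%classic ce).
  - exact: segment_compact.
  - exact/continuous_subspaceT/ce_cont.
  - exact: circle_hausdorff.
  - by move=> y; have [/andP[h1 h2] <-] := TP y; exists (T y); rewrite //= in_itv /= h1 ltW.
  - apply: (@subspace_eq_continuous _ _ _ al _ _ cal) => t; rewrite inE /= in_itv /=.
    exact: alT.
exists v, (fun sx => loop p ord0 ((1 - sx.1) * al (T sx.2))); split=> [|x|x] /=.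
- apply: continuous_subspaceT; apply: (cont_comp _ (@loop_cont _ _ p ord0)); apply: contI => -[s x].
  have c1 : {for (s, x), continuous (fun sx : R * circle R => sx.1)} by exact: cvg_fst.
  have c2 : {for (s, x), continuous (fun sx : R * circle R => al (T sx.2))}.
    by apply: (@cont_comp_for _ _ _ snd (fun x => al (T x))); [exact: cvg_snd|exact: cA].
  by cont_tac.
- have [/andP[h1 h2] e] := TP x.
  by rewrite subr0 mul1r -alF ?e // h1 ltW.
- by rewrite subrr mul0r loop_vertex.
Qed.

(* A null-homotopy lifts to the universal cover of the circle, over a rectangle
   placed inside the disk; the total rotation of the attaching map is then 0. *)
Lemma null_homotopic_shape : M = 2%N -> null_homotopic f -> o 0%N <> o 1%N.
Proof.
move=> M2 [c [H [cH H0 H1]]]; have [M0 thM ths arcs] := A; rewrite M2 in thM ths arcs.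
have [cb0 b00 b01 _ F0] := arcs 0%N isT; have [cb1 b10 b11 _ F1] := arcs 1%N isT.
have t01 := ths 0%N isT; have t12 := ths 1%N isT.
(* The square [0, 1/2]^2 lies in the disk; doubling its coordinates gives the time of the homotopy
   and one period of the circle, so lifting over the disk suffices. *)
have inS (w : disk R) : (`[0, 1]%classic `*` setT) (clamp01 (2 * set_val w 0 0), ce (th 0%N + 2 * set_val w 0 1)).
  by split=> //=; rewrite in_itv /=; exact: clamp01_in.
pose Phi (w : disk R) := coord ord0 (H (clamp01 (2 * set_val w 0 0), ce (th 0%N + 2 * set_val w 0 1))).
have zP : zcont setT Phi.
  apply: zcontT_comp (@coord_zcont _ _ p ord0).
  have cw : continuous (fun w => mk_sub (inS w)).
    apply: sub_cont; apply: cont_pair.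
      apply: (cont_comp _ (@clamp01_cont R)); apply: contI => w.
      have c0 : {for w, continuous (fun w : disk R => set_val w 0 0)}.
        exact: (cont_comp (@set_val_continuous _ _) (@coord_cont _ _ _)).
      by cont_tac.
    apply: (cont_comp _ (@ce_cont R)); apply: contI => w.
    have c1 : {for w, continuous (fun w : disk R => set_val w 0 1)}.
      exact: (cont_comp (@set_val_continuous _ _) (@coord_cont _ _ _)).
    by cont_tac.
  exact: (cont_comp cw (within_sub cH)).
have [h [ch hZ]] := zcont_lift (@diskT_compact R) (@disk_contractible R) zP.
have inD (s t : R) : disk R (\row_(j < 2) if j == 0 then clamp01 s / 2 else clamp01 t / 2).
  apply/diskP; rewrite !mxE /=; have /andP[s0 s1] := clamp01_in s; have /andP[t0 t1] := clamp01_in t.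
  by nra.
pose g s t := h (mk_sub (inD s (t - th 0%N))).
have gZ s t : 0 <= s <= 1 -> th 0%N <= t <= th 2%N -> g s t - coord ord0 (H (s, ce t)) \is a Num.int.
  move=> s01 /andP[t0 t2]; have := hZ (mk_sub (inD s (t - th 0%N))).
  have ct : clamp01 (t - th 0%N) = t - th 0%N by apply: clamp01_id; apply/andP; split; lra.
  rewrite -/(g s t) /Phi !mk_subE !mxE /= (clamp01_id s01) ct.
  have -> : 2 * (s / 2) = s by field.
  have -> : th 0%N + 2 * ((t - th 0%N) / 2) = t by field.
  by rewrite clamp01_id.
have cgs t : continuous (fun s => g s t).
  apply: (cont_comp _ ch); apply: sub_cont; apply: contI => s; apply: rV_cont => j.
  rewrite (_ : (fun _ => _) = (fun s => if j == 0 then clamp01 s / 2 else clamp01 (t - th 0%N) / 2)); last first.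
    by apply/funext => s'; rewrite mk_subE mxE.
  have cl : {for s, continuous (fun s : R => clamp01 s)} by exact: clamp01_cont.
  by case: (j == 0); cont_tac.
have cgt s : continuous (fun t => g s t).
  apply: (cont_comp _ ch); apply: sub_cont; apply: contI => t; apply: rV_cont => j.
  rewrite (_ : (fun _ => _) = (fun t => if j == 0 then clamp01 s / 2 else clamp01 (t - th 0%N) / 2)); last first.
    by apply/funext => s'; rewrite mk_subE mxE.
  have cl : {for t, continuous (fun t : R => clamp01 (t - th 0%N))}.
    by apply: (@cont_comp_for _ _ _ (fun t => t - th 0%N)); [cont_tac|exact: clamp01_cont].
  by case: (j == 0); cont_tac.
have t02 : th 0%N <= th 2%N by rewrite ltW // (lt_trans t01).
have e1 : g 1 (th 0%N) = g 1 (th 2%N).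
  have := @int_valued_const R (fun t => g 1 t - coord ord0 c) _ _ t02.
  move=> e; apply: (addIr (- coord ord0 c)); apply: e.
    apply: continuous_subspaceT; apply: contI => t; have ct : {for t, continuous (g 1)} by exact: cgt.
    by cont_tac.
  by move=> t; rewrite in_itv /= -(H1 (ce t)) => tt; apply: gZ; rewrite ?lexx ?ler01.
have e0 : g 0 (th 2%N) = g 0 (th 0%N).
  have := @int_valued_const R (fun s => g s (th 2%N) - g s (th 0%N)) 0 1 ler01.
  rewrite e1 subrr => e; apply/eqP; rewrite -subr_eq0; apply/eqP; apply: e.
    apply: continuous_subspaceT; apply: contI => s.
    have cs2 : {for s, continuous (fun s => g s (th 2%N))} by exact: cgs.
    have cs0 : {for s, continuous (fun s => g s (th 0%N))} by exact: cgs.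
    by cont_tac.
  move=> s; rewrite in_itv /= => s01.
  have h2 : g s (th 2%N) - coord ord0 (H (s, ce (th 2%N))) \is a Num.int.
    by apply: gZ; rewrite // lexx t02.
  have h0 : g s (th 0%N) - coord ord0 (H (s, ce (th 0%N))) \is a Num.int.
    by apply: gZ; rewrite // lexx t02.
  rewrite thM ce_add1 -thM in h2.
  have -> : g s (th 2%N) - g s (th 0%N) = (g s (th 2%N) - coord ord0 (H (s, ce (th 0%N)))) -
      (g s (th 0%N) - coord ord0 (H (s, ce (th 0%N)))) by ring.
  exact: rpredB.
(* Each arc changes the lift by 1 or -1 according to its direction, while by [e0] the total change
   is 0. *)
have arc (a b : R) (b' : R -> R) (oo : bool) : a <= b -> th 0%N <= a -> b <= th 2%N -> continuous b' -> b' a = 0 -> b' b = 1 ->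
    (forall t, a <= t <= b -> F t = loop p ord0 (orient oo (b' t))) ->
    g 0 b - g 0 a = if oo then 1 else -1.
  move=> ab a0 b2 cb ba bb bF.
  have := @int_valued_const R (fun t => g 0 t - orient oo (b' t)) a b ab.
  rewrite ba bb => e; have {}e : g 0 a - orient oo 0 = g 0 b - orient oo 1.
    apply: e.
      apply: continuous_subspaceT; apply: contI => t; have ct : {for t, continuous (g 0)} by exact: cgt.
      have co : {for t, continuous (fun t => orient oo (b' t))} by exact: (cont_comp cb (@orient_cont _)).
      by cont_tac.
    move=> t; rewrite in_itv /= => tab; have /andP[at_ tb] := tab.
    have := gZ 0 t; rewrite H0 bF // lexx ler01 (le_trans a0 at_) (le_trans tb b2) => /(_ isT isT) h1.
    by rewrite -(subrKA (coord ord0 (loop p ord0 (orient oo (b' t))))) rpredD // coord_loop.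
  by move: e; case: oo {bF}; rewrite /orient => e; lra.
have a0 := arc _ _ _ (o 0%N) (ltW t01) (lexx _) (ltW t12) cb0 b00 b01.
have a1 := arc _ _ _ (o 1%N) (ltW t12) (ltW t01) (lexx _) cb1 b10 b11.
rewrite (petal_ord0 (io 0%N)) in F0; rewrite (petal_ord0 (io 1%N)) in F1.
move: (a0 F0) (a1 F1) => {}a0 {}a1 oo; move: a0 a1; rewrite oo.
rewrite e0; move: (g 0 _) (g 0 _) => u w.
case: (o 1%N) => h1 h2.
  have : (1 + 1 : R) = 0 by rewrite -{1}h1 -h2; ring.
  by move/eqP; rewrite -(natrD _ 1 1) pnatr_eq0.
have : (1 + 1 : R) = 0 by rewrite -[LHS]opprK opprD -{1}h1 -h2; ring.
by move/eqP; rewrite -(natrD _ 1 1) pnatr_eq0.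
Qed.

End Shape.

(** * The sphere with two points identified *)

Section WrappedSphere.
Variable R : realType.
Implicit Types c s b r : R.

Definition chord_half c : R := Num.sqrt (1 - c ^+ 2).

(* Each vertical chord of the disk is wrapped once around the circle of latitude
   at its abscissa, so that exactly the ends of the chord are identified.  The
   factor [chord_half c] makes the value at [c = 1, -1], where the quotient is a
   division by [0], the pole. *)
Definition wrap c s : 'rV[R]_3 :=
  let x := set_val (ce (s / (2 * chord_half c))) in
  \row_j (if j == 0 then c else chord_half c * (if j == 1 then x 0 0 else x 0 1)).

Lemma wrap0 c s : wrap c s 0 0 = c.
Proof. by rewrite mxE. Qed.

Lemma wrap1 c s : wrap c s 0 1 = chord_half c * set_val (ce (s / (2 * chord_half c))) 0 0.
Proof. by rewrite mxE. Qed.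

Lemma wrap2 c s : wrap c s 0 2 = chord_half c * set_val (ce (s / (2 * chord_half c))) 0 1.
Proof. by rewrite mxE. Qed.

Lemma ord3P (j : 'I_3) : [\/ j = 0, j = 1 | j = 2].
Proof.
case: j => -[|[|[|m]]] // hm; [constructor 1|constructor 2|constructor 3]; exact: val_inj.
Qed.

Lemma sphere2P (y : 'rV[R]_3) : sphere R 2 y <-> y 0 0 ^+ 2 + (y 0 1 ^+ 2 + y 0 2 ^+ 2) = 1.
Proof.
rewrite /sphere /= !big_ord_recl big_ord0 addr0.
have -> : lift ord0 ord0 = 1 :> 'I_3 by exact: val_inj.
by have -> : lift ord0 (lift ord0 ord0) = 2 :> 'I_3 by exact: val_inj.
Qed.

Lemma chord_half_sqr c s : c ^+ 2 + s ^+ 2 <= 1 -> chord_half c ^+ 2 = 1 - c ^+ 2.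
Proof. by move=> h; rewrite sqr_sqrtr // subr_ge0; apply: le_trans h; rewrite lerDl sqr_ge0. Qed.

Lemma wrap_sphere c s : c ^+ 2 + s ^+ 2 <= 1 -> sphere R 2 (wrap c s).
Proof.
move=> h; apply/sphere2P; rewrite wrap0 wrap1 wrap2 !exprMn -mulrDr circleP mulr1.
by rewrite (chord_half_sqr h) addrC subrK.
Qed.

Lemma chord_half_ge0 c : 0 <= chord_half c.
Proof. exact: sqrtr_ge0. Qed.

Lemma chord_half_bound c s : c ^+ 2 + s ^+ 2 <= 1 -> - chord_half c <= s <= chord_half c.
Proof.
move=> h; rewrite -ler_norml -(ger0_norm (chord_half_ge0 c)) -ler_sqr ?nnegrE ?normr_ge0 //.
by rewrite !real_normK ?num_real // (chord_half_sqr h) lerBrDl.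
Qed.

Lemma wrap_conj c s : c ^+ 2 + s ^+ 2 = 1 -> wrap c s = wrap c (- s).
Proof.
move=> h; have h' : c ^+ 2 + s ^+ 2 <= 1 by rewrite h.
have ss : s ^+ 2 = chord_half c ^+ 2 by rewrite (chord_half_sqr h') -h; ring.
rewrite /wrap (@ce_int _ _ (- s / (2 * chord_half c))) //.
have [w0|w0] := eqVneq (chord_half c) 0; first by rewrite w0 mulr0 invr0 !mulr0 subrr rpred0.
have -> : s / (2 * chord_half c) - - s / (2 * chord_half c) = s / chord_half c by field.
move/eqP: ss; rewrite eqf_sqr => /orP[]/eqP ->; rewrite ?mulNr divff ?rpred1 //.
by rewrite rpredN rpred1.
Qed.

Lemma wrap_eq c s c' s' : c ^+ 2 + s ^+ 2 <= 1 -> c' ^+ 2 + s' ^+ 2 <= 1 ->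
  wrap c s = wrap c' s' -> c = c' /\ (s = s' \/ s = - s' /\ c ^+ 2 + s ^+ 2 = 1).
Proof.
move=> h h' e; have ec : c = c' by rewrite -(wrap0 c s) e wrap0.
subst c'; split=> //.
have [w0|w0] := eqVneq (chord_half c) 0.
  have /andP[] := chord_half_bound h; have /andP[] := chord_half_bound h'.
  by rewrite w0 => *; left; lra.
have wpos : 0 < chord_half c by rewrite lt_neqAle eq_sym w0 chord_half_ge0.
have ez : ce (s / (2 * chord_half c)) = ce (s' / (2 * chord_half c)).
  apply: circle_eq; apply: (mulfI w0); first by rewrite -!wrap1 e.
  by rewrite -!wrap2 e.
have /intrP[k] := ce_inj ez.
have -> : s / (2 * chord_half c) - s' / (2 * chord_half c) = (s - s') / (2 * chord_half c) by field.
move=> ek; have {ek} ek : s - s' = k%:~R * (2 * chord_half c) by rewrite -ek divfK // mulf_neq0 // pnatr_eq0.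
have /andP[l1 u1] := chord_half_bound h; have /andP[l2 u2] := chord_half_bound h'.
have k1 : (k <= 1)%R.
  rewrite -(ler_int R) -(ler_pM2r (_ : 0 < 2 * chord_half c)) ?mulr_gt0 // -ek mul1r; lra.
have k2 : (-1 <= k)%R.
  rewrite -(ler_int R) -(ler_pM2r (_ : 0 < 2 * chord_half c)) ?mulr_gt0 // -ek mulN1r; lra.
have [k0|[k0|k0]] : k = 0 \/ k = 1 \/ k = -1 by lia.
- by left; rewrite k0 mul0r in ek; lra.
- rewrite k0 mul1r in ek; right; have -> : s = chord_half c by lra.
  have -> : s' = - chord_half c by lra.
  by rewrite opprK (chord_half_sqr h) addrC subrK.
- rewrite k0 mulN1r in ek; right; have -> : s = - chord_half c by lra.
  have -> : s' = chord_half c by lra.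
  by rewrite sqrrN (chord_half_sqr h) addrC subrK.
Qed.

Lemma wrap_surj (y : 'rV[R]_3) : sphere R 2 y ->
  exists c s, c ^+ 2 + s ^+ 2 <= 1 /\ wrap c s = y.
Proof.
move=> /sphere2P Sy; pose c := y 0 0; pose w := chord_half c.
have h0 : c ^+ 2 + 0 ^+ 2 <= 1 by rewrite expr0n /= addr0 -Sy lerDl addr_ge0 ?sqr_ge0.
have w2 : w ^+ 2 = y 0 1 ^+ 2 + y 0 2 ^+ 2 by rewrite (chord_half_sqr h0) -Sy /c; ring.
have [w0|w0] := eqVneq w 0.
  exists c, 0; split=> //; move: w2; rewrite w0 expr0n /= => /esym/eqP.
  rewrite paddr_eq0 ?sqr_ge0 // !sqrf_eq0 => /andP[/eqP y1 /eqP y2].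
  by apply/rowP => j; have [->|->|->] := ord3P j; rewrite ?wrap0 ?wrap1 ?wrap2 -/w ?w0 ?mul0r ?y1 ?y2.
have Sx : sphere R 1 (\row_(j < 2) if j == 0 then y 0 1 / w else y 0 2 / w).
  by apply/sphere1P; rewrite !mxE /= !expr_div_n -mulrDl -w2 divff // expf_neq0.
(* The turn is taken in [-1/2, 1/2), so that [2 w u] stays between the ends [-w] and [w] of the
   chord. *)
have [u /andP[u1 u2] ux] := ce_surj_window (- 2^-1) (mk_sub Sx).
exists c, (2 * w * u); split.
  have wu : (2 * u) ^+ 2 <= 1.
    by rewrite -real_normK ?num_real // expr_le1 // ler_norml; apply/andP; split; lra.
  have -> : (2 * w * u) ^+ 2 = w ^+ 2 * (2 * u) ^+ 2 by ring.
  apply: le_trans (_ : c ^+ 2 + w ^+ 2 * 1 <= _); first by rewrite lerD2l ler_wpM2l ?sqr_ge0.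
  by rewrite mulr1 (chord_half_sqr h0) addrC subrK.
have e : 2 * w * u / (2 * chord_half c) = u by rewrite -/w; field.
apply/rowP => j; have [->|->|->] := ord3P j; rewrite ?wrap0 ?wrap1 ?wrap2 // e ux mk_subE !mxE /= -/w.
  by rewrite mulrC divfK.
by rewrite mulrC divfK.
Qed.

Lemma wrap_cont (T : topologicalType) (c s : T -> R) x :
  {for x, continuous c} -> {for x, continuous s} ->
  {for x, continuous (fun u => wrap (c u) (s u))}.
Proof.
move=> cc cs.
have cw : {for x, continuous (fun u => chord_half (c u))}.
  apply: (@cont_comp_for _ _ _ (fun u => 1 - c u ^+ 2) Num.sqrt); last exact: sqrt_continuous.
  rewrite (_ : (fun u => _) = (fun u => 1 - c u * c u)); first by cont_tac.
  by apply/funext => u; rewrite expr2.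
have main (F : R -> R) : continuous F -> (forall t, `|F t| <= 1) ->
    {for x, continuous (fun u => chord_half (c u) * F (s u / (2 * chord_half (c u))))}.
  (* At a pole the angle need not be continuous, but it enters through a bounded factor multiplied
     by [chord_half], which tends to 0. *)
  move=> cF F1; have [w0|w0] := eqVneq (chord_half (c x)) 0.
    apply/cont_eps => e e0; have := (cont_eps _ _).1 cw e e0; rewrite w0 mul0r.
    apply: near_imp => y; rewrite !sub0r !normrN normrM; apply: le_lt_trans.
    by rewrite -[X in _ <= X]mulr1 ler_wpM2l.
  apply: contM => //; apply: (@cont_comp_for _ _ _ (fun u => s u / (2 * chord_half (c u)))); last exact: cF.
  apply: contM => //; apply: contV; last by cont_tac.
  by rewrite mulf_neq0 // pnatr_eq0.
have ce_le j t : `|set_val (ce t : circle R) 0 j| <= 1.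
  rewrite -(@expr_le1 _ 2) // real_normK ?num_real //; have := circleP (ce t : circle R).
  by have [->|->] := ord2P j => <-; rewrite ?lerDl ?lerDr sqr_ge0.
have ce_j j : continuous (fun t => set_val (ce t : circle R) 0 j).
  exact: (cont_comp (@ce_cont R) (cont_comp (@set_val_continuous _ _) (@coord_cont _ _ j))).
apply: rV_cont => j; have [->|->|->] := ord3P j.
- by rewrite (_ : (fun _ => _) = c) //; apply/funext => u; rewrite wrap0.
- rewrite (_ : (fun _ => _) = (fun u => chord_half (c u) * set_val (ce (s u / (2 * chord_half (c u)))) 0 0)).
    exact: (main (fun t => set_val (ce t : circle R) 0 0)).
  by apply/funext => u; rewrite wrap1.
- rewrite (_ : (fun _ => _) = (fun u => chord_half (c u) * set_val (ce (s u / (2 * chord_half (c u)))) 0 1)).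
    exact: (main (fun t => set_val (ce t : circle R) 0 1)).
  by apply/funext => u; rewrite wrap2.
Qed.

Lemma polar_eq r r' b b' : 0 <= r -> 0 <= r' ->
  r *: set_val (ce b) = r' *: set_val (ce b') -> r = r' /\ (r = 0 \/ b - b' \is a Num.int).
Proof.
move=> r0 r0' /rowP e.
have e0 : r * set_val (ce b) 0 0 = r' * set_val (ce b') 0 0 by have := e 0; rewrite !mxE.
have e1 : r * set_val (ce b) 0 1 = r' * set_val (ce b') 0 1 by have := e 1; rewrite !mxE.
have rr : r = r'.
  have : r ^+ 2 = r' ^+ 2.
    have E (u a : R) : u ^+ 2 = (u * set_val (ce a) 0 0) ^+ 2 + (u * set_val (ce a) 0 1) ^+ 2.
      by rewrite !exprMn -mulrDr circleP mulr1.
    by rewrite (E r b) (E r' b') e0 e1.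
  by move/eqP; rewrite eqrXn2 // => /eqP.
split=> //; rewrite -rr in e0 e1; have [->|rn0] := eqVneq r 0; [by left|right].
by apply: ce_inj; apply: circle_eq; exact: (mulfI rn0).
Qed.

Lemma polar_surj c s : c ^+ 2 + s ^+ 2 <= 1 -> exists r b,
  [/\ 0 <= r <= 1, 0 <= b < 1, r * set_val (ce b : circle R) 0 0 = c & r * set_val (ce b : circle R) 0 1 = s].
Proof.
move=> h; pose r := Num.sqrt (c ^+ 2 + s ^+ 2).
have r2 : r ^+ 2 = c ^+ 2 + s ^+ 2 by rewrite sqr_sqrtr // addr_ge0 ?sqr_ge0.
have r01 : 0 <= r <= 1 by rewrite sqrtr_ge0 /= -(@expr_le1 _ 2) ?sqrtr_ge0 // r2.
have [rz|rn0] := eqVneq r 0.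
  exists 0, 0; rewrite !mul0r lexx ler01 ltr01; move: r2; rewrite rz expr0n /= => /esym/eqP.
  by rewrite paddr_eq0 ?sqr_ge0 // !sqrf_eq0 => /andP[/eqP -> /eqP ->].
have Sx : sphere R 1 (\row_(j < 2) if j == 0 then c / r else s / r).
  by apply/sphere1P; rewrite !mxE /= !expr_div_n -mulrDl -r2 divff // expf_neq0.
have [b b01 bx] := ce_surj_window 0 (mk_sub Sx); rewrite add0r in b01.
by exists r, b; rewrite bx mk_subE !mxE /= ![r * _]mulrC !divfK.
Qed.

End WrappedSphere.

Lemma pair_identified_eq (X : topologicalType) (a b x y : X) :
  let pr := quotient_proj (fun x y : X => x = a /\ y = b) in
  pr x = pr y <-> x = y \/ (x = a \/ x = b) /\ (y = a \/ y = b).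
Proof.
split=> [/eqmodP/asboolP|].
  elim=> [u w [-> ->]|u|u w _ [->|[h1 h2]]|u w z _ [->|[h1 h2]] _ [<-|[h3 h4]]]; try by left.
  - by right; split; [left|right].
  - by right.
  - by right.
  - by right.
  - by right.
have ab : quotient_proj (fun x y : X => x = a /\ y = b) a = quotient_proj (fun x y : X => x = a /\ y = b) b.
  by apply/eqmodP/asboolP; exact: rst_step.
by case=> [->//|[[->|->] [->|->]]].
Qed.

Section CircleReflection.
Variable R : realType.
Implicit Types b : R.

Lemma ceN0 b : set_val (ce (- b)) 0 0 = set_val (ce b) 0 0.
Proof. by rewrite !ce0 mulrN cosN. Qed.

Lemma ceN1 b : set_val (ce (- b)) 0 1 = - set_val (ce b) 0 1.
Proof. by rewrite !ce1 mulrN sinN. Qed.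

Lemma ce_zero : set_val (ce (0 : R)) 0 0 = 1 /\ set_val (ce (0 : R)) 0 1 = 0.
Proof. by rewrite ce0 ce1 mulr0 cos0 sin0. Qed.

Lemma ce_half : set_val (ce (2^-1 : R)) 0 0 = -1 /\ set_val (ce (2^-1 : R)) 0 1 = 0.
Proof.
have e : 2 * pi * 2^-1 = pi :> R by field.
by rewrite ce0 ce1 e cospi sinpi.
Qed.

Lemma int_in3 (u : R) : u \is a Num.int -> -1 <= u <= 1 -> [\/ u = -1, u = 0 | u = 1].
Proof.
move=> /intrP[k ->] /andP[h1 h2].
have k1 : (k <= 1)%R by rewrite -(ler_int R).
have k2 : (-1 <= k)%R by rewrite -(ler_int R).
have [->|[->|->]] : k = -1 \/ k = 0 \/ k = 1 by lia.
- by constructor 1.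
- by constructor 2.
- by constructor 3.
Qed.

End CircleReflection.

Section SphereHomeo.
Variables (R : realType) (n : nat) (p : 'I_n.+1 -> circle R) (f : circle R -> bouquet p).
Local Notation Q := (one_relator_complex f).
Local Notation q := (disk_to_complex f).
Local Notation jq := (bouquet_to_complex f).
Local Notation bd := (bdry_incl R).
Local Notation v := (vertex p).
Local Notation F := (fun t => f (ce t)).
Variables (th : nat -> R) (io : nat -> 'I_n.+1) (o : nat -> bool) (be : nat -> R -> R).
Hypotheses (A : arc_seq f 2 th io o be) (n0 : n = 0%N) (oo : o 0%N <> o 1%N).

(* The inverse of this map makes the attaching map fold the circle [0, 1]/(0 = 1)
   by [b |-> 1 - b], the two fixed points going to the vertex. *)
Lemma fold_parameter : exists B : R -> R, [/\ continuous B, B (th 0%N) = 0, B (th 2%N) = 1,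
  forall t, th 0%N <= t <= th 2%N -> 0 <= B t <= 1 &
  (forall t t', th 0%N <= t <= th 2%N -> th 0%N <= t' <= th 2%N -> B t = B t' -> t = t') /\
  forall t t', th 0%N <= t <= th 2%N -> th 0%N <= t' <= th 2%N ->
    F t = F t' <-> [\/ B t = B t', B t + B t' = 1 | (2 * B t \is a Num.int) /\ (2 * B t' \is a Num.int)]].
Proof.
have [_ th2 ths arcs] := A.
have A0 := arcs 0%N isT; have A1 := arcs 1%N isT.
have [cb0 b00 b01 _ F0] := A0; have [cb1 b10 b11 _ F1] := A1.
have t01 := ths 0%N isT; have t12 := ths 1%N isT.
(* [B] runs from 0 to 1/2 on the first arc and from 1/2 to 1 on the second; the minimum and maximum
   freeze the parameter of the other arc at 1 or 0. *)
pose t1 := th 1%N; pose B t := (be 0%N (Num.min t t1) + be 1%N (Num.max t t1)) / 2.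
have lo t : t <= t1 -> B t = be 0%N t / 2.
  by move=> h; rewrite /B min_l // max_r // b10 addr0.
have up t : t1 <= t -> B t = (1 + be 1%N t) / 2.
  by move=> h; rewrite /B min_r // max_l // b01.
have cB : continuous B.
  apply: contI => t.
  have cmin : {for t, continuous (fun t => Num.min t t1)}.
    rewrite (_ : (fun _ => _) = (fun t => (t + t1 - `|t - t1|) / 2)); first by cont_tac.
    by apply/funext => s; rewrite minr_absE.
  have cmax : {for t, continuous (fun t => Num.max t t1)}.
    rewrite (_ : (fun _ => _) = (fun t => (t + t1 + `|t - t1|) / 2)); first by cont_tac.
    by apply/funext => s; rewrite maxr_absE.
  have c0 : {for t, continuous (fun t => be 0%N (Num.min t t1))} by exact: (cont_comp_for cmin (cb0 _)).
  have c1 : {for t, continuous (fun t => be 1%N (Num.max t t1))} by exact: (cont_comp_for cmax (cb1 _)).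
  by rewrite /B; cont_tac.
have in0 t : th 0%N <= t <= t1 -> 0 <= be 0%N t <= 1.
  move=> h; have e0 : th 0%N <= th 0%N <= th 1%N by rewrite lexx ltW.
  have e1 : th 0%N <= th 1%N <= th 1%N by rewrite lexx ltW.
  by rewrite -{1}b00 -b01 (arc_mono A0 e0 h) (arc_mono A0 h e1).
have in1 t : t1 <= t <= th 2%N -> 0 <= be 1%N t <= 1.
  move=> h; have e0 : th 1%N <= th 1%N <= th 2%N by rewrite lexx ltW.
  have e1 : th 1%N <= th 2%N <= th 2%N by rewrite lexx ltW.
  by rewrite -{1}b10 -b11 (arc_mono A1 e0 h) (arc_mono A1 h e1).
have inj0 s t : th 0%N <= s <= t1 -> th 0%N <= t <= t1 -> be 0%N s = be 0%N t -> s = t.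
  by move=> hs ht e; apply/eqP; rewrite eq_le -(arc_mono A0 hs ht) -(arc_mono A0 ht hs) e lexx.
have inj1 s t : t1 <= s <= th 2%N -> t1 <= t <= th 2%N -> be 1%N s = be 1%N t -> s = t.
  by move=> hs ht e; apply/eqP; rewrite eq_le -(arc_mono A1 hs ht) -(arc_mono A1 ht hs) e lexx.
have o10 : o 1%N = ~~ o 0%N by case: (o 0%N) (o 1%N) oo => -[].
(* With this sign [F t] is the loop at [sg * (2 * B t)] on the first arc and at the opposite
   parameter on the second, whence the fold by [1 - b]. *)
pose sg : R := if o 0%N then 1 else -1.
have sgZ u : (sg * u \is a Num.int) = (u \is a Num.int).
  by rewrite /sg; case: (o 0%N); rewrite ?mul1r // mulN1r rpredN.
have Flo t : th 0%N <= t <= t1 -> F t = loop p ord0 (sg * (2 * B t)).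
  move=> h; rewrite F0 // (petal_ord0 n0 (io 0%N)) lo; last by case/andP: h.
  rewrite [2 * _]mulrC divfK ?pnatr_eq0 // /sg; apply: loop_int; rewrite /orient.
  by case: (o 0%N); rewrite ?mul1r ?subrr ?rpred0 // mulN1r opprK subrK rpred1.
have Fup t : t1 <= t <= th 2%N -> F t = loop p ord0 (- (sg * (2 * B t))).
  move=> h; rewrite F1 // (petal_ord0 n0 (io 1%N)) up; last by case/andP: h.
  rewrite [2 * _]mulrC divfK ?pnatr_eq0 // /sg; apply: loop_int; rewrite /orient o10.
  case: (o 0%N); rewrite /= ?mulN1r ?mul1r opprK.
    have -> : 1 - be 1%N t + (1 + be 1%N t) = 2 by ring.
    exact: rpred_nat.
  have -> : be 1%N t - (1 + be 1%N t) = -1 by ring.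
  by rewrite rpredN rpred1.
have part t : th 0%N <= t <= th 2%N ->
    (th 0%N <= t <= t1 /\ 0 <= B t <= 2^-1) \/ (t1 <= t <= th 2%N /\ 2^-1 <= B t <= 1).
  move=> /andP[h0 h2]; have [h|/ltW h] := leP t t1; [left|right].
    have ht : th 0%N <= t <= t1 by rewrite h0.
    split; first by rewrite h0.
    by rewrite lo //; have /andP[? ?] := in0 t ht; apply/andP; split; lra.
  have ht : t1 <= t <= th 2%N by rewrite h.
  by split=> //; rewrite up //; have /andP[? ?] := in1 t ht; apply/andP; split; lra.
have Binj t t' : th 0%N <= t <= th 2%N -> th 0%N <= t' <= th 2%N -> B t = B t' -> t = t'.
  have cross s s' : th 0%N <= s <= t1 -> t1 <= s' <= th 2%N -> B s = B s' -> s = s'.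
    move=> hs hs' e; have /andP[_ sl] := hs; have /andP[sl' _] := hs'.
    rewrite (lo _ sl) (up _ sl') in e; have /andP[a1 a2] := in0 s hs; have /andP[a3 a4] := in1 s' hs'.
    transitivity t1; [apply: inj0|apply: inj1] => //; rewrite ?lexx ?ltW //.
      by rewrite b01; lra.
    by rewrite b10; lra.
  move=> /part[[h _]|[h _]] /part[[h' _]|[h' _]] e.
  - by apply: inj0 => //; case/andP: h h' e => _ ? /andP[_ ?]; rewrite !lo // => ?; lra.
  - exact: cross.
  - by apply/esym; exact: cross.
  - by apply: inj1 => //; case/andP: h h' e => ? _ /andP[? _]; rewrite !up // => ?; lra.
exists B; split=> //.
- by rewrite lo ?ltW // b00 mul0r.
- by rewrite up ?ltW // b11; field.
- by move=> t /part[[_ /andP[? ?]]|[_ /andP[? ?]]]; apply/andP; split; lra.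
split=> // t t' ht ht'; split=> [e|].
  have int1 (u : R) : u = 0 \/ u = 1 \/ u = 2^-1 -> 2 * u \is a Num.int.
    by case=> [->|[->|->]]; rewrite ?mulr0 ?mulr1 ?divff ?rpred0 ?rpred1 ?rpred_nat ?pnatr_eq0.
  have same w w' : w - w' \is a Num.int -> w = sg * (2 * B t) -> w' = sg * (2 * B t') ->
      -1 <= 2 * B t - 2 * B t' <= 1 -> 2 * B t - 2 * B t' = 0 \/ 
      (2 * B t - 2 * B t' = 1 \/ 2 * B t - 2 * B t' = -1).
    move=> wZ ew ew'; move: wZ; rewrite ew ew' -mulrBr sgZ => /int_in3 h /h[|->|->]; by [move=> ->; right; right|left|right; left].
  have cross : sg * (2 * B t) + sg * (2 * B t') \is a Num.int -> 1 <= 2 * B t + 2 * B t' <= 3 ->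
      [\/ 2 * B t + 2 * B t' = 1, 2 * B t + 2 * B t' = 2 | 2 * B t + 2 * B t' = 3].
    rewrite -mulrDr sgZ => wZ hw; have := @int_in3 _ (2 * B t + 2 * B t' - 2).
    rewrite rpredB ?rpred_nat // => /(_ isT) [|h|h|h].
    - by case/andP: hw => ? ?; apply/andP; split; lra.
    - by constructor 1; lra.
    - by constructor 2; lra.
    - by constructor 3; lra.
  move: (part t ht) (part t' ht') => [[h /andP[b1 b2]]|[h /andP[b1 b2]]] [[h' /andP[b1' b2']]|[h' /andP[b1' b2']]].
  - have := loop_inj (etrans (esym (Flo t h)) (etrans e (Flo t' h'))).
    move=> /same /(_ erefl erefl) [|E|[E|E]].
    + by apply/andP; split; lra.
    + by constructor 1; lra.
    + by constructor 3; split; apply: int1; lra.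
    + by constructor 3; split; apply: int1; lra.
  - have := loop_inj (etrans (esym (Flo t h)) (etrans e (Fup t' h'))); rewrite opprK.
    move=> /cross[|E|E|E].
    + by apply/andP; split; lra.
    + by constructor 3; split; apply: int1; lra.
    + by constructor 2; lra.
    + by constructor 3; split; apply: int1; lra.
  - have := loop_inj (etrans (esym (Fup t h)) (etrans e (Flo t' h'))).
    rewrite -opprD rpredN => /cross[|E|E|E].
    + by apply/andP; split; lra.
    + by constructor 3; split; apply: int1; lra.
    + by constructor 2; lra.
    + by constructor 3; split; apply: int1; lra.
  - have := loop_inj (etrans (esym (Fup t h)) (etrans e (Fup t' h'))).
    rewrite -opprD rpredN => /same /(_ erefl erefl) [|E|[E|E]].
    + by apply/andP; split; lra.
    + by constructor 1; lra.
    + by constructor 3; split; apply: int1; lra.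
    + by constructor 3; split; apply: int1; lra.
case=> [/(Binj _ _ ht ht') -> //|E|[Z Z']].
  move: (part t ht) (part t' ht') => [[h /andP[b1 b2]]|[h /andP[b1 b2]]] [[h' /andP[b1' b2']]|[h' /andP[b1' b2']]].
  - by have -> : t = t' by apply: Binj => //; lra.
  - rewrite Flo // Fup //; apply: loop_int; rewrite opprK -mulrDr sgZ -mulrDr E mulr1.
    exact: rpred_nat.
  - rewrite (Fup t) // (Flo t') //; apply: loop_int; rewrite -opprD rpredN -mulrDr sgZ -mulrDr E mulr1.
    exact: rpred_nat.
  - by have -> : t = t' by apply: Binj => //; lra.
have vert s : th 0%N <= s <= th 2%N -> 2 * B s \is a Num.int -> F s = v.
  by move=> /part[[h _]|[h _]] sZ; rewrite ?(Flo _ h) ?(Fup _ h) loop_int0 // ?rpredN sgZ.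
by rewrite !vert.
Qed.

End SphereHomeo.

Section SphereQuotient.
Variables (R : realType) (n : nat) (p : 'I_n.+1 -> circle R) (f : circle R -> bouquet p).
Local Notation Q := (one_relator_complex f).
Local Notation q := (disk_to_complex f).
Local Notation jq := (bouquet_to_complex f).
Local Notation bd := (bdry_incl R).
Local Notation F := (fun t => f (ce t)).
Variables (th : nat -> R) (io : nat -> 'I_n.+1) (o : nat -> bool) (be : nat -> R -> R).
Hypotheses (A : arc_seq f 2 th io o be) (n0 : n = 0%N) (oo : o 0%N <> o 1%N).

(** [K] carries polar coordinates: [gz] uses them on the disk, and [k1] replaces the angle by [B]
    and then wraps. Points with equal [gz] have equal [k1], so [ka] is well defined. On the boundary
    [wrap] identifies the angles b and -b, which is the fold made by [f]; the poles come from the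
    two zeros of [f]. *)
Lemma fold_sphere : exists (ka : disk R -> sphere R 2) (N S : sphere R 2),
  [/\ continuous ka, forall y, exists z, ka z = y, N <> S,
      forall z z', q z = q z' <-> ka z = ka z' \/ (ka z = N \/ ka z = S) /\ (ka z' = N \/ ka z' = S) &
      forall z z', ka z = ka z' -> ka z = N \/ ka z = S -> z = z'].
Proof.
have [B [cB B0 B2 B01 [Binj FB]]] := fold_parameter A n0 oo.
have [_ th2 ths _] := A.
have t02 : th 0%N < th 2%N by rewrite th2 ltrDl ltr01.
pose K : set (R * R) := `[0, 1]%classic `*` `[th 0%N, th 2%N]%classic.
have KP (x : K) : 0 <= (set_val x).1 <= 1 /\ th 0%N <= (set_val x).2 <= th 2%N.
  by have [] := set_valP x; rewrite /= !in_itv /=.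
have cK : compact [set: K] by apply: sub_compact; apply: compact_setX; exact: segment_compact.
have c1 (x : K) : {for x, continuous (fun x : K => (set_val x).1)}.
  by apply: (@cont_comp_for _ _ _ (set_val : K -> _) fst); [exact: set_val_continuous|exact: cvg_fst].
have c2 (x : K) : {for x, continuous (fun x : K => (set_val x).2)}.
  by apply: (@cont_comp_for _ _ _ (set_val : K -> _) snd); [exact: set_val_continuous|exact: cvg_snd].
have norm1 (r b : R) : (r * set_val (ce b : circle R) 0 0) ^+ 2 + (r * set_val (ce b : circle R) 0 1) ^+ 2 = r ^+ 2.
  by rewrite !exprMn -mulrDr circleP mulr1.
have le1 (r b : R) : 0 <= r <= 1 ->
    (r * set_val (ce b : circle R) 0 0) ^+ 2 + (r * set_val (ce b : circle R) 0 1) ^+ 2 <= 1.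
  by move=> /andP[r0 r1]; rewrite norm1 expr_le1.
have Dz (x : K) : disk R ((set_val x).1 *: set_val (ce (set_val x).2)).
  have [r01 _] := KP x; have := le1 _ (set_val x).2 r01.
  by move=> h; apply/diskP; rewrite mxE [X in _ + X ^+ 2]mxE; exact: h.
pose gz (x : K) : disk R := mk_sub (Dz x).
have Sz (x : K) := wrap_sphere (le1 (set_val x).1 (B (set_val x).2) (KP x).1).
pose k1 (x : K) : sphere R 2 := mk_sub (Sz x).
have pl : 1 ^+ 2 + 0 ^+ 2 <= 1 :> R by rewrite expr1n expr0n addr0.
have mi : (-1) ^+ 2 + 0 ^+ 2 <= 1 :> R by rewrite sqrrN expr1n expr0n addr0.
pose N : sphere R 2 := mk_sub (wrap_sphere pl); pose S : sphere R 2 := mk_sub (wrap_sphere mi).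
have NS : N <> S.
  move/(congr1 (fun x : sphere R 2 => set_val x 0 0)); rewrite !mk_subE !wrap0 => e.
  by have : (1 + 1 : R) = 0 by [rewrite {2}e subrr]; move/eqP; rewrite -(natrD _ 1 1) pnatr_eq0.
have cg : continuous gz.
  apply: sub_cont; apply: contI => x; rewrite /gz.
  have c3 : {for x, continuous (fun x : K => set_val (ce (set_val x).2))}.
    apply: (@cont_comp_for _ _ _ _ (fun t : R => set_val (ce t)) x (c2 x)).
    exact: (cont_comp (@ce_cont R) (@set_val_continuous _ _)).
  exact: contZ (c1 x) c3.
have ck1 : continuous k1.
  apply: sub_cont; apply: contI => x.
  rewrite (_ : (fun _ => _) = fun x : K => wrap ((set_val x).1 * set_val (ce (B (set_val x).2)) 0 0)
    ((set_val x).1 * set_val (ce (B (set_val x).2)) 0 1)) //.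
  have c3 j : {for x, continuous (fun x : K => set_val (ce (B (set_val x).2)) 0 j)}.
    apply: (@cont_comp_for _ _ _ _ (fun t : R => set_val (ce (B t)) 0 j) x (c2 x)).
    exact: (cont_comp cB (cont_comp (@ce_cont R) (cont_comp (@set_val_continuous _ _) (@coord_cont _ _ j)))).
  by apply: wrap_cont; apply: contM; try exact: c1; exact: c3.
have mkK (r t : R) : 0 <= r <= 1 -> th 0%N <= t <= th 2%N -> exists x : K, set_val x = (r, t).
  move=> hr ht; have h : K (r, t) by split; rewrite /= in_itv.
  by exists (mk_sub h).
have gs (z : disk R) : exists x, gz x = z.
  have [r [b [r01 _ e0 e1]]] := polar_surj ((diskP _).1 (set_valP z)).
  have [t /andP[h1 h2] tb] := window (th 0%N) b.
  have [|x ex] := mkK r t r01; first by rewrite h1 th2 ltW.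
  exists x; apply: set_val_inj; rewrite mk_subE ex /= (ce_int tb).
  by apply/rowP => j; have [->|->] := ord2P j; rewrite [LHS]mxE.
have ks (y : sphere R 2) : exists x, k1 x = y.
  have [c [s [cs1 ey]]] : exists c s, c ^+ 2 + s ^+ 2 <= 1 /\ wrap c s = set_val y.
    by apply: wrap_surj; exact: (set_valP y).
  have [r [b [r01 /andP[b0 b1] e0 e1]]] := polar_surj cs1.
  have [|t ht tb] := IVT_between cB (ltW t02) (w := b); first by rewrite B0 B2 b0 ltW.
  have [x ex] := mkK r t r01 ht.
  by exists x; apply: set_val_inj; rewrite mk_subE ex /= tb e0 e1.
have k1E (x : K) : set_val (k1 x) = wrap ((set_val x).1 * set_val (ce (B (set_val x).2)) 0 0)
    ((set_val x).1 * set_val (ce (B (set_val x).2)) 0 1) by exact: mk_subE.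
have gzE (x : K) : set_val (gz x) = (set_val x).1 *: set_val (ce (set_val x).2) by exact: mk_subE.
have NE : set_val N = wrap 1 0 by exact: mk_subE.
have SE : set_val S = wrap (-1) 0 by exact: mk_subE.
have r1 (r : R) : 0 <= r <= 1 -> r ^+ 2 = 1 -> r = 1.
  by move=> /andP[r0 _] /eqP; rewrite sqrf_eq1 => /orP[/eqP //|/eqP e]; move: r0; rewrite e oppr_ge0 ler10.
have wI t t' : th 0%N <= t <= th 2%N -> th 0%N <= t' <= th 2%N ->
    (t - t' \is a Num.int) = (B t - B t' \is a Num.int).
  move=> ht ht'; have /andP[t1 t2] := ht; have /andP[t1' t2'] := ht'.
  have /andP[b1 b2] := B01 t ht; have /andP[b1' b2'] := B01 t' ht'.
  have ht0 : th 0%N <= th 0%N <= th 2%N by rewrite lexx ltW.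
  have ht2 : th 0%N <= th 2%N <= th 2%N by rewrite lexx ltW.
  apply/idP/idP => /int_in3 h; case: h => [|e|e|e].
  - by rewrite th2 in t2 t2'; apply/andP; split; lra.
  - have [-> ->] : t = th 0%N /\ t' = th 2%N by rewrite th2 in t2' *; split; lra.
    by rewrite B0 B2 sub0r rpredN rpred1.
  - by have -> : t = t' by [lra]; rewrite subrr rpred0.
  - have [-> ->] : t = th 2%N /\ t' = th 0%N by rewrite th2 in t2 *; split; lra.
    by rewrite B0 B2 subr0 rpred1.
  - by apply/andP; split; lra.
  - have -> : t = th 0%N by apply: Binj => //; rewrite B0; lra.
    have -> : t' = th 2%N by apply: Binj => //; rewrite B2; lra.
    by rewrite th2 opprD addrA subrr sub0r rpredN rpred1.
  - by have -> : t = t' by [apply: Binj => //; lra]; rewrite subrr rpred0.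
  - have -> : t = th 2%N by apply: Binj => //; rewrite B2; lra.
    have -> : t' = th 0%N by apply: Binj => //; rewrite B0; lra.
    by rewrite th2 addrAC subrr add0r rpred1.
have bdz (x : K) : (set_val x).1 = 1 -> gz x = bd (ce (set_val x).2).
  by move=> e; apply: set_val_inj; rewrite gzE e scale1r bdry_val.
have zero2 : [/\ set_val (ce (0 : R)) 0 0 = 1, set_val (ce (0 : R)) 0 1 = 0,
    set_val (ce (2^-1 : R)) 0 0 = -1 & set_val (ce (2^-1 : R)) 0 1 = 0].
  by have [h1 h2] := ce_zero R; have [h3 h4] := ce_half R.
case: zero2 => z00 z01 z10 z11.
have pole (x : K) : (k1 x = N \/ k1 x = S) <-> (set_val x).1 = 1 /\ 2 * B (set_val x).2 \is a Num.int.
  have [r01 t01] := KP x; split.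
    have dir (e : R) : e ^+ 2 = 1 -> e ^+ 2 + 0 ^+ 2 <= 1 -> set_val (k1 x) = wrap e 0 ->
        [/\ (set_val x).1 = 1, set_val (ce (B (set_val x).2)) 0 0 = e & set_val (ce (B (set_val x).2)) 0 1 = 0].
      move=> e1 ee; rewrite k1E => /(wrap_eq (le1 _ _ r01) ee) [ec es].
      have {}es : (set_val x).1 * set_val (ce (B (set_val x).2)) 0 1 = 0.
        by case: es => [//|[-> _]]; rewrite oppr0.
      have rx : (set_val x).1 = 1.
        by apply: r1 => //; rewrite -(norm1 _ (B (set_val x).2)) ec es e1 expr0n addr0.
      by rewrite rx !mul1r in ec es.
    case=> /(congr1 set_val); rewrite ?NE ?SE => /dir.
      move=> /(_ (expr1n _ 2) pl) [-> h1 h2]; split=> //.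
      have /ce_inj : ce (B (set_val x).2) = ce 0 by apply: circle_eq; rewrite ?h1 ?h2.
      by rewrite subr0 => h; rewrite rpredM // rpred_nat.
    have m1 : (-1 : R) ^+ 2 = 1 by rewrite sqrrN expr1n.
    move=> /(_ m1 mi) [-> h1 h2]; split=> //.
    have /ce_inj h : ce (B (set_val x).2) = ce 2^-1 by apply: circle_eq; rewrite ?h1 ?h2.
    have -> : 2 * B (set_val x).2 = 2 * (B (set_val x).2 - 2^-1) + 1 by field.
    by rewrite rpredD ?rpred1 // rpredM // rpred_nat.
  move=> [rx bZ]; have /andP[b1 b2] := B01 _ t01.
  have [||e|e|e] := @int_in3 _ (2 * B (set_val x).2 - 1).
  - by rewrite rpredB ?rpred1.
  - by apply/andP; split; lra.
  - left; apply: set_val_inj; rewrite k1E NE rx !mul1r.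
    by have -> : B (set_val x).2 = 0 by [lra]; rewrite z00 z01.
  - right; apply: set_val_inj; rewrite k1E SE rx !mul1r.
    by have -> : B (set_val x).2 = 2^-1 by [lra]; rewrite z10 z11.
  - have e1 : B (set_val x).2 = 1 by lra.
    have ec : ce (B (set_val x).2) = ce 0 by apply: ce_int; rewrite e1 subr0 rpred1.
    by left; apply: set_val_inj; rewrite k1E NE rx !mul1r ec z00 z01.
have same (x x' : K) : gz x = gz x' -> k1 x = k1 x'.
  have [r01 t01] := KP x; have [r01' t01'] := KP x'.
  move=> /(congr1 set_val); rewrite !gzE.
  case/andP: (r01) => r0 _; case/andP: (r01') => r0' _.
  move=> /(polar_eq r0 r0') [er [rz|tZ]]; apply: set_val_inj; rewrite !k1E.
    by rewrite -er rz !mul0r.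
  by rewrite wI // in tZ; rewrite -er (ce_int tZ).
have same' (x x' : K) :
    (set_val x).1 * set_val (ce (B (set_val x).2)) 0 0 = (set_val x').1 * set_val (ce (B (set_val x').2)) 0 0 ->
    (set_val x).1 * set_val (ce (B (set_val x).2)) 0 1 = (set_val x').1 * set_val (ce (B (set_val x').2)) 0 1 ->
    gz x = gz x'.
  have [r01 t01] := KP x; have [r01' t01'] := KP x'; move=> ec es.
  case/andP: (r01) => r0 _; case/andP: (r01') => r0' _.
  have : (set_val x).1 *: set_val (ce (B (set_val x).2)) = (set_val x').1 *: set_val (ce (B (set_val x').2)).
    by apply/rowP => j; have [->|->] := ord2P j; rewrite mxE [RHS]mxE.
  move=> /(polar_eq r0 r0') [er rt]; apply: set_val_inj; rewrite !gzE -er.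
  case: rt => [->|tZ]; first by rewrite !scale0r.
  by rewrite -wI // in tZ; rewrite (ce_int tZ).
have [sec secK] := choice gs.
pose ka z := k1 (sec z).
have kE x : ka (gz x) = k1 x by apply: same; rewrite secK.
have fiber x x' : q (gz x) = q (gz x') <-> k1 x = k1 x' \/ (k1 x = N \/ k1 x = S) /\ (k1 x' = N \/ k1 x' = S).
  have [r01 t01] := KP x; have [r01' t01'] := KP x'.
  split=> [/q_eq [e|[y [y' [ey ey' fy]]]]|].
  - by left; exact: same.
  - have on (z : K) w : gz z = bd w -> (set_val z).1 = 1 /\ w = ce (set_val z).2.
      move=> e; have rz : (set_val z).1 = 1.
        apply: r1; first by have [] := KP z.
        have := circleP w; rewrite -bdry_val -e gzE mxE [X in _ + X ^+ 2]mxE => h.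
        by rewrite -[RHS]h norm1.
      by split=> //; apply: bdry_inj; rewrite -e bdz.
    have [rx ex] := on _ _ ey; have [rx' ex'] := on _ _ ey'; rewrite ex ex' in fy.
    have /(FB _ _ t01 t01')[eB|eB|[Z Z']] := fy.
    + by left; apply: set_val_inj; rewrite !k1E rx rx' eB.
    + left; apply: set_val_inj; rewrite !k1E rx rx' !mul1r.
      have -> : ce (B (set_val x').2) = ce (- B (set_val x).2).
        by apply: ce_int; rewrite opprK addrC eB rpred1.
      by rewrite ceN0 ceN1; apply: wrap_conj; exact: circleP.
    + by right; split; apply/pole.
  - case=> [/(congr1 set_val)|[/pole [rx Z] /pole [rx' Z']]]; last first.
      by rewrite !bdz // !q_bdry; congr (jq _); apply/(FB _ _ t01 t01'); constructor 3.
    rewrite !k1E => /(wrap_eq (le1 _ _ r01) (le1 _ _ r01')) [ec [es|[es u]]].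
      by congr (q _); exact: same'.
    have rx : (set_val x).1 = 1 by apply: r1 => //; rewrite -(norm1 _ (B (set_val x).2)).
    have rx' : (set_val x').1 = 1.
      by apply: r1 => //; rewrite -(norm1 _ (B (set_val x').2)) -ec -[X in _ + X]sqrrN -es.
    rewrite rx rx' !mul1r in ec es.
    rewrite !bdz // !q_bdry; congr (jq _); apply/(FB _ _ t01 t01').
    have /ce_inj : ce (B (set_val x).2) = ce (- B (set_val x').2).
      by apply: circle_eq; rewrite ?ceN0 ?ceN1.
    rewrite opprK => h; have /andP[b1 b2] := B01 _ t01; have /andP[b1' b2'] := B01 _ t01'.
    have [||e|e|e] := @int_in3 _ (B (set_val x).2 + B (set_val x').2 - 1).
    + by rewrite rpredB ?rpred1.
    + by apply/andP; split; lra.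
    + by constructor 1; lra.
    + by constructor 2; lra.
    + by constructor 1; lra.
exists ka, N, S; split=> //.
- apply: contI => z; apply: (@compact_map_cont K (disk R) (sphere R 2) setT gz ka z cK).
  + exact: continuous_subspaceT.
  + exact: disk_hausdorff.
  + by move=> b; have [x <-] := gs b; exists x.
  + by apply: continuous_subspaceT; under eq_fun do rewrite kE.
- by move=> y; have [x <-] := ks y; exists (gz x).
- by move=> z z'; have [x <-] := gs z; have [x' <-] := gs z'; rewrite !kE; exact: fiber.
- move=> z z'; have [x <-] := gs z; have [x' <-] := gs z'; rewrite !kE => e xp.
  have x'p : k1 x' = N \/ k1 x' = S by rewrite -e.
  have [/(pole x).1 [rx Z] /(pole x').1 [rx' Z']] := (xp, x'p).
  have sin0 (b : R) : 2 * b \is a Num.int -> set_val (ce b : circle R) 0 1 = 0.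
    move=> bZ; have e2 : ce b = ce (- b) by apply: ce_int; rewrite opprK -mulr2n -mulr_natl.
    have := ceN1 b; rewrite -e2 => /eqP; rewrite -addr_eq0 -mulr2n mulrn_eq0 /=.
    by move/eqP.
  move: (congr1 set_val e); rewrite !k1E => /(wrap_eq (le1 _ _ (KP x).1) (le1 _ _ (KP x').1)) [ec _].
  by apply: same' => //; rewrite !sin0 // !mulr0.
Qed.

Hypotheses (fs : forall y, exists x, f x = y) (hQ : hausdorff_space Q).

Lemma shape_sphere : exists a b : sphere R 2, a <> b /\ homeomorphic Q (pair_identified a b).
Proof.
have [ka [N [S [cka kas NS fiber _]]]] := fold_sphere.
exists N, S; split=> //.
apply: (@homeo_of_fibers (disk R) Q (pair_identified N S) q
  (fun z => quotient_proj (fun x y => x = N /\ y = S) (ka z))) => //.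
- exact: diskT_compact.
- exact: q_cont.
- exact: (cont_comp cka (@quotient_proj_cont _ _)).
- exact: q_surj.
- move=> y; have [z zy] : exists z, quotient_proj (fun x y => x = N /\ y = S) z = y by exists (repr y); exact: reprK.
  by have [x xz] := kas z; exists x; rewrite xz.
- move=> U oU; apply: (hausdorff_compact_quotient (@diskT_compact R) _ cka kas oU).
  by apply: sub_hausdorff; exact: rV_hausdorff.
- by move=> z z'; rewrite pair_identified_eq.
Qed.

End SphereQuotient.

(** * Polyhedral geometry *)

Section ConvexCombinations.
Context {R : realType}.

(** Partial sums are divided by their total weight, so that each new term is an instance of
    two-point convexity. *)
Lemma convex_comb (V : lmodType R) (C : set V) (I : finType) (c : I -> R) (e : I -> V) :
  convex C -> (forall i, 0 <= c i) -> \sum_i c i = 1 -> (forall i, c i != 0 -> C (e i)) ->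
  C (\sum_i c i *: e i).
Proof.
move=> vC c0 c1 Ce.
have main (r : seq I) : 0 < \sum_(i <- r) c i ->
    C ((\sum_(i <- r) c i)^-1 *: \sum_(i <- r) c i *: e i).
  elim: r => [|i r IH]; first by rewrite big_nil ltxx.
  rewrite !big_cons; set S := \sum_(j <- r) c j in IH *; set x := \sum_(j <- r) _ in IH *.
  have S0 : 0 <= S by apply: sumr_ge0.
  have [Sz|Sn0] := eqVneq S 0.
    have -> : x = 0.
      rewrite /x big_seq big1 // => j jr; have /eqP := Sz.
      rewrite psumr_eq0 // => /allP /(_ j jr) /= /eqP ->; exact: scale0r.
    rewrite Sz !addr0 scalerA => ci; have cn : c i != 0 by rewrite gt_eqF.
    by rewrite mulVf // scale1r; exact: Ce.
  have Sp : 0 < S by rewrite lt_neqAle eq_sym Sn0.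
  have [cz|cn0] := eqVneq (c i) 0; first by rewrite cz scale0r !add0r.
  move=> cS; pose t := S / (c i + S).
  have -> : (c i + S)^-1 *: (c i *: e i + x) = (1 - t) *: e i + t *: (S^-1 *: x).
    rewrite scalerDr !scalerA; congr (_ *: _ + _ *: _); first by rewrite /t; field; rewrite gt_eqF.
    by rewrite /t; field; rewrite Sn0 gt_eqF.
  apply: vC; [exact: Ce|exact: IH|].
  by rewrite /t divr_ge0 // ?(ltW cS) // ler_pdivrMr // mul1r lerDr c0.
by have := main (index_enum I); rewrite c1 invr1 scale1r; apply; exact: ltr01.
Qed.

Context {m : nat}.
Implicit Types s : seq 'rV[R]_m.

Lemma hull_mem s x : x \in s -> convex_hull s x.
Proof.
move=> xs; have k : (index x s < size s)%N by rewrite index_mem.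
exists (fun i => (i == Ordinal k)%:R); first split=> [i|].
- exact: ler0n.
- by rewrite (bigD1 (Ordinal k)) //= eqxx big1 ?addr0 // => i /negbTE ->.
- rewrite (bigD1 (Ordinal k)) //= eqxx scale1r big1 ?addr0 ?nth_index // => i /negbTE ->.
  exact: scale0r.
Qed.

Lemma hull_min s (C : set 'rV[R]_m) : convex C -> (forall x, x \in s -> C x) -> convex_hull s `<=` C.
Proof.
move=> vC sC _ [a [a0 a1] <-]; apply: convex_comb => // i _.
by apply: sC; exact: mem_nth.
Qed.

Lemma hull_family s (I : finType) (c : I -> R) (e : I -> 'rV[R]_m) :
  (forall i, 0 <= c i) -> \sum_i c i = 1 -> (forall i, c i != 0 -> e i \in s) ->
  convex_hull s (\sum_i c i *: e i).
Proof.
by move=> c0 c1 es; apply: convex_comb => //; [exact: hull_convex|move=> i /es; exact: hull_mem].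
Qed.

Lemma polyhedronU (P P' : set 'rV[R]_m) : polyhedron P -> polyhedron P' -> polyhedron (P `|` P').
Proof.
move=> [ss ->] [ss' ->]; exists (ss ++ ss'); apply/seteqP; split=> x.
  by move=> [[s sss sx]|[s sss sx]]; exists s => //=; rewrite mem_cat sss ?orbT.
by move=> [s /=]; rewrite mem_cat => /orP[sss|sss] sx; [left|right]; exists s.
Qed.

Lemma polyhedron_bigcup (T : eqType) (l : seq T) (P : T -> set 'rV[R]_m) :
  (forall x, x \in l -> polyhedron (P x)) -> polyhedron (\bigcup_(x in [set` l]) P x).
Proof.
elim: l => [|x l IH] h.
  by exists [::]; apply/seteqP; split=> y [].
rewrite (_ : \bigcup_(_ in _) _ = P x `|` \bigcup_(y in [set` l]) P y).
  by apply: polyhedronU; [apply: h; rewrite inE eqxx|apply: IH => y yl; apply: h; rewrite inE yl orbT].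
apply/seteqP; split=> [z [y /=]|z [xz|[y yl yz]]].
- by rewrite inE => /orP[/eqP ->|yl] yz; [left|right; exists y].
- by exists x => //=; rewrite inE eqxx.
- by exists y => //=; rewrite inE yl orbT.
Qed.

Lemma polyhedron_hull s : polyhedron (convex_hull s).
Proof.
exists [:: s]; apply/seteqP; split=> [x sx|x [t /=]]; first by exists s => //=; rewrite inE eqxx.
by rewrite inE => /eqP ->.
Qed.

Section HalfSpace.
Variables (b c : R) (k : 'I_m).
Let l (x : 'rV[R]_m) := b * x 0 k.

Let l_comb (I : finType) (a : I -> R) (e : I -> 'rV[R]_m) : l (\sum_i a i *: e i) = \sum_i a i * l (e i).
Proof.
by rewrite /l summxE mulr_sumr; apply: eq_bigr => i _; rewrite mxE mulrCA.
Qed.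

Let crossing x y := ((l y - c) / (l y - l x)) *: x + ((c - l x) / (l y - l x)) *: y.

(* The part of a polytope in a half-space is spanned by its vertices there and by
   the points where the segments joining these to the others cross the boundary. *)
Lemma hull_halfspace s : polyhedron (convex_hull s `&` [set x | b * x 0 k <= c]).
Proof.
pose t := [seq x <- s | l x <= c] ++
  [seq crossing x y | x <- [seq x <- s | l x <= c], y <- [seq y <- s | c < l y]].
suff -> : convex_hull s `&` [set x | b * x 0 k <= c] = convex_hull t by exact: polyhedron_hull.
apply/seteqP; split; last first.
  apply: hull_min => [x y u [sx lx] [sy ly] u01|x].
    split; first exact: hull_convex.
    rewrite /= !mxE mulrDr mulrCA [b * (u * _)]mulrCA; case/andP: u01 => u0 u1.
    apply: le_trans (_ : (1 - u) * c + u * c <= _); last by lra.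
    by apply: lerD; apply: ler_wpM2l => //; rewrite subr_ge0.
  rewrite mem_cat => /orP[|/allpairsP[[y z] /= []]].
    by rewrite mem_filter => /andP[lx xs]; split=> //; exact: hull_mem.
  rewrite !mem_filter => /andP[ly ys] /andP[lz zs] ->.
  have d : 0 < l z - l y by lra.
  split.
    have -> : crossing y z = (1 - (c - l y) / (l z - l y)) *: y + ((c - l y) / (l z - l y)) *: z.
      by rewrite /crossing; congr (_ *: _ + _); field; rewrite gt_eqF.
    apply: hull_convex; try exact: hull_mem.
    by rewrite divr_ge0 ?(ltW d) ?subr_ge0 //= ler_pdivrMr // mul1r lerD2r ltW.
  rewrite /= !mxE mulrDr mulrCA [b * (_ * z 0 k)]mulrCA -!/(l _).
  have -> : (l z - c) / (l z - l y) * l y + (c - l y) / (l z - l y) * l z = c by field; rewrite gt_eqF.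
  exact: lexx.
move=> _ [[a [a0 a1] <-]]; rewrite /= -/(l _) l_comb => lc.
pose L (i : 'I_(size s)) := l s`_i - c.
have lcL : \sum_i a i * L i <= 0.
  rewrite /L; under eq_bigr do rewrite mulrBr; rewrite sumrB -mulr_suml a1 mul1r subr_le0.
  exact: lc.
(* [E] is the total excess of the vertices above the hyperplane and [Dd] the total deficit of the
   others. Each vertex above is paired with all those below in proportion to their deficits: [W i j]
   is the weight of the crossing point, [W' i] the weight left at vertex [i]. *)
pose E := \sum_(i | 0 < L i) a i * L i; pose Dd := - \sum_(i | ~~ (0 < L i)) a i * L i.
have ED : E <= Dd by rewrite -subr_le0 opprK; move: lcL; rewrite (bigID (fun i => 0 < L i)).
have E0 : 0 <= E by apply: sumr_ge0 => i Li; rewrite mulr_ge0 // ltW.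
have lo i : ~~ (0 < L i) -> s`_i \in t.
  by rewrite -leNgt subr_le0 => Li; rewrite mem_cat mem_filter Li mem_nth.
have [Ez|En0] := eqVneq E 0.
  apply: hull_family => // i ai; apply: lo; apply: contra ai => Li.
  have /eqP := Ez; rewrite psumr_eq0; last by move=> j Lj; rewrite mulr_ge0 // ltW.
  by move=> /allP /(_ i (mem_index_enum i)); rewrite Li /= mulf_eq0 (gt_eqF Li) orbF.
have D0 : 0 < Dd by apply: lt_le_trans ED; rewrite lt_neqAle eq_sym En0.
pose W i j := if ~~ (0 < L i) && (0 < L j) then a i * a j * (L j - L i) / Dd else 0.
pose W' i := if ~~ (0 < L i) then a i * (1 - E / Dd) else 0.
have flow (V : lmodType R) (u : 'I_(size s) -> V) :
    \sum_i \sum_j (if ~~ (0 < L i) && (0 < L j) then (a i * a j / Dd) *: (L j *: u i - L i *: u j) else 0) +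
    \sum_i W' i *: u i = \sum_i a i *: u i.
  have -> : \sum_i \sum_j (if ~~ (0 < L i) && (0 < L j) then (a i * a j / Dd) *: (L j *: u i - L i *: u j) else 0) =
     \sum_(i | ~~ (0 < L i)) (a i * (E / Dd)) *: u i + \sum_(j | 0 < L j) a j *: u j.
    transitivity (\sum_(i | ~~ (0 < L i)) \sum_(j | 0 < L j) (a i * a j / Dd) *: (L j *: u i - L i *: u j)).
      rewrite [RHS]big_mkcond; apply: eq_bigr => i _; case: (~~ _) => /=; first by rewrite [RHS]big_mkcond.
      by rewrite big1.
    have -> : \sum_(i | ~~ (0 < L i)) \sum_(j | 0 < L j) (a i * a j / Dd) *: (L j *: u i - L i *: u j) =
      \sum_(i | ~~ (0 < L i)) \sum_(j | 0 < L j) (a i * (a j * L j / Dd)) *: u i -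
      \sum_(i | ~~ (0 < L i)) \sum_(j | 0 < L j) (a i * L i / Dd * a j) *: u j.
      rewrite -sumrB; apply: eq_bigr => i _; rewrite -sumrB; apply: eq_bigr => j _.
      by rewrite scalerBr !scalerA; congr (_ *: _ - _ *: _); field; rewrite gt_eqF.
    congr (_ + _).
      apply: eq_bigr => i _; rewrite -scaler_suml -mulr_sumr; congr ((_ * _) *: _).
      by rewrite /E mulr_suml.
    rewrite exchange_big /= -sumrN; apply: eq_bigr => j _.
    rewrite -scaler_suml -mulr_suml -mulr_suml -scaleNr; congr (_ *: _).
    have -> : \sum_(i | ~~ (0 < L i)) a i * L i = - Dd by rewrite opprK.
    by field; rewrite gt_eqF.
  rewrite addrAC [RHS](bigID (fun i => ~~ (0 < L i))) /=; congr (_ + _); last first.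
    by apply: eq_bigl => i; rewrite negbK.
  rewrite [X in _ + X](_ : _ = \sum_(i | ~~ (0 < L i)) (a i * (1 - E / Dd)) *: u i).
    by rewrite -big_split /=; apply: eq_bigr => i _; rewrite -scalerDl -mulrDr addrC subrK mulr1.
  rewrite [RHS]big_mkcond; apply: eq_bigr => i _; rewrite /W'; case: (~~ _) => //; exact: scale0r.
pose c' (p : 'I_(size s) * 'I_(size s) + 'I_(size s)) :=
  match p with inl ij => W ij.1 ij.2 | inr i => W' i end.
pose e' (p : 'I_(size s) * 'I_(size s) + 'I_(size s)) :=
  match p with inl ij => crossing s`_ij.1 s`_ij.2 | inr i => s`_i end.
have -> : \sum_i a i *: s`_i = \sum_p c' p *: e' p.
  rewrite big_sumType /= -(flow _ (fun i => s`_i)); congr (_ + _).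
  rewrite pair_big /=; apply: eq_bigr => -[i j] _ /=; rewrite /W; case: ifP => [/andP[Li Lj]|_]; last by rewrite scale0r.
  rewrite /crossing -scaleNr !scalerDr !scalerA.
  have d : l s`_j - l s`_i != 0 by rewrite gt_eqF //; move: Li Lj; rewrite /L -leNgt => ? ?; lra.
  by congr (_ *: _ + _ *: _); rewrite /L; field; rewrite d gt_eqF.
apply: hull_family.
- move=> [[i j]|i]; rewrite /c' /W /W' /=; case: ifP => // h; last first.
    by rewrite mulr_ge0 // subr_ge0 ler_pdivrMr // mul1r.
  case/andP: h => Li Lj; rewrite divr_ge0 ?(ltW D0) // mulr_ge0 ?mulr_ge0 // subr_ge0.
  by rewrite ltW // (le_lt_trans _ Lj) // leNgt.
- rewrite big_sumType /=; have := flow R^o (fun=> 1); under [RHS]eq_bigr do rewrite [_ *: _]mulr1.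
  rewrite a1 => <-; congr (_ + _); last by apply: eq_bigr => i _; rewrite [RHS]mulr1.
  rewrite pair_big /=; apply: eq_bigr => -[i j] _ /=; rewrite /W; case: ifP => // _.
  by rewrite /GRing.scale /=; ring.
- move=> [[i j]|i]; rewrite /c' /W /W' /=; case: ifP => [h|_]; rewrite ?eqxx // => _; last exact: lo.
  case/andP: h => Li Lj; rewrite mem_cat; apply/orP; right; apply/allpairsP.
  exists (s`_i, s`_j); split=> //=; rewrite mem_filter mem_nth // andbT.
    by rewrite -subr_le0 leNgt.
  by rewrite -subr_gt0.
Qed.

Lemma polyhedron_halfspace P : polyhedron P -> polyhedron (P `&` [set x | b * x 0 k <= c]).
Proof.
move=> [ss ->]; rewrite setI_bigcupl; apply: polyhedron_bigcup => s _; exact: hull_halfspace.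
Qed.

End HalfSpace.

End ConvexCombinations.

Lemma polyhedron_linear (R : realType) m m' (g : {linear 'rV[R]_m -> 'rV[R]_m'}) (P : set 'rV[R]_m) :
  polyhedron P -> polyhedron (g @` P).
Proof.
move=> [ss ->]; exists (map (map g) ss); rewrite image_bigcup; apply/seteqP; split=> y.
  move=> [s sss [x [a [a0 a1] <-] <-]]; exists (map g s); first by apply/mapP; exists s.
  have -> : g (\sum_(i < size s) a i *: s`_i) = \sum_(i < size s) a i *: g s`_i.
    by rewrite linear_sum; apply: eq_bigr => i _; rewrite linearZ.
  by apply: hull_family => // i _; apply: map_f; exact: mem_nth.
move=> [_ /mapP[s sss ->] sy]; exists s => //; apply: hull_min sy => [_ _ t [x sx <-] [z sz <-] t01|_ /mapP[x xs ->]].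
  by exists ((1 - t) *: x + t *: z); [exact: hull_convex|rewrite linearD !linearZ].
by exists x => //; exact: hull_mem.
Qed.

Section PositiveBounds.
Context {R : realType}.

Lemma compact_pos_bound (T : topologicalType) (K : set T) (N : T -> R) :
  compact K -> {within K, continuous N} -> (forall x, K x -> 0 < N x) ->
  exists2 d, 0 < d & forall x, K x -> d <= N x.
Proof.
move=> cK cN N0; have [K0|/nonemptyPn K0] := pselect (K !=set0); last first.
  by exists 1 => // x Kx; rewrite K0 in Kx.
have [x Kx xmin] := compact_EVT_min K0 cK cN.
exists (N x); first by apply: N0; rewrite inE in Kx.
by move=> y Ky; apply: xmin; rewrite inE.
Qed.

Lemma pos_bound_seq (T : eqType) (l : seq T) (P : T -> R -> Prop) :
  (forall x, x \in l -> exists2 d, 0 < d & forall e, e <= d -> P x e) ->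
  exists2 d, 0 < d & forall x e, x \in l -> e <= d -> P x e.
Proof.
elim: l => [|x l IH] h; first by exists 1.
have [|d d0 hd] := IH; first by move=> y yl; apply: h; rewrite inE yl orbT.
have [|d' d0' hd'] := h x; first by rewrite inE eqxx.
exists (Num.min d d'); first by rewrite lt_min d0.
by move=> y e; rewrite inE le_min => /orP[/eqP ->|yl] /andP[h1 h2]; [exact: hd'|exact: hd].
Qed.

End PositiveBounds.

Section Conic.
Context {R : realType} {m : nat} (a : 'rV[R]_m) (s : seq 'rV[R]_m).
Local Notation I := 'I_(size s).

Let face (T : {set I}) := [seq s`_(val i) | i : I <- enum T].

Let weighted (T : {set I}) : set 'rV[R]_m := [set y | exists c : I -> R,
  [/\ forall i, 0 <= c i, forall i, i \notin T -> c i = 0, \sum_i c i = 1 &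
    y = \sum_i c i *: s`_i]].

Let face_weights T y : convex_hull (face T) y -> weighted T y.
Proof.
apply: (@hull_min _ _ (face T) (weighted T)) => [_ _ u [c [c0 cT c1 ->]] [c' [c0' cT' c1' ->]] /andP[u0 u1]|_ /mapP[i iT ->]].
  exists (fun i => (1 - u) * c i + u * c' i); split=> [i|i iT||].
  - by rewrite addr_ge0 // mulr_ge0 // subr_ge0.
  - by rewrite cT // cT' // !mulr0 addr0.
  - by rewrite big_split /= -!mulr_sumr c1 c1' !mulr1 subrK.
  - by rewrite !scaler_sumr -big_split /=; apply: eq_bigr => i _; rewrite !scalerA scalerDl.
rewrite mem_enum in iT; exists (fun j => (j == i)%:R); split=> [j|j jT||].
- exact: ler0n.
- by case: eqP jT => // ->; rewrite iT.
- by rewrite (bigD1 i) //= eqxx big1 ?addr0 // => j /negbTE ->.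
- rewrite (bigD1 i) //= eqxx scale1r big1 ?addr0 // => j /negbTE ->.
  exact: scale0r.
Qed.

Let cone_over (T : {set I}) (x : 'rV[R]_m) := exists (l0 : R) (l : I -> R),
  [/\ 0 <= l0, forall i, 0 <= l i, forall i, i \notin T -> l i = 0, l0 + \sum_i l i = 1 &
      x = l0 *: a + \sum_i l i *: s`_i].

(* If [a] lies in the face spanned by [T], subtracting a multiple of a
   representation of [a] removes one vertex from [T]. *)
Let cone_shrink T x : cone_over T x -> convex_hull (face T) a ->
  exists2 T' : {set I}, (#|T'| < #|T|)%N & cone_over T' x.
Proof.
move=> [l0 [l [l00 l0' lT l1 ->]]] /face_weights[c [c0 cT c1 ca]].
have [i0 ci0] : exists i, 0 < c i.
  apply: contrapT => nc; have : (1 : R) = 0.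
    rewrite -c1 big1 // => i _; apply/eqP; rewrite eq_le c0 andbT leNgt.
    by apply/negP => ci; apply: nc; exists i.
  by move/eqP; rewrite oner_eq0.
have [k ck kmin] := @arg_minP _ _ _ i0 (fun i => 0 < c i) (fun i => l i / c i) ci0.
pose u := l k / c k.
have u0 : 0 <= u by rewrite divr_ge0 // ltW.
have kT : k \in T by apply: contraLR ck => /cT ->; rewrite ltxx.
exists (T :\ k); first by rewrite [X in (_ < X)%N](cardsD1 k) kT.
exists (l0 + u), (fun i => l i - u * c i); split=> [|i|i||].
- exact: addr_ge0.
- have [ci|] := ltP 0 (c i); last first.
    by move=> ci; have -> : c i = 0 by [apply/eqP; rewrite eq_le ci c0]; rewrite mulr0 subr0.
  by rewrite subr_ge0 -ler_pdivlMr //; exact: kmin.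
- rewrite !inE negb_and negbK => /orP[/eqP ->|iT]; first by rewrite divfK ?subrr // gt_eqF.
  by rewrite lT // cT // mulr0 subr0.
- by rewrite sumrB -mulr_sumr c1 mulr1 addrACA subrr addr0.
- have -> : \sum_i (l i - u * c i) *: s`_i = \sum_i l i *: s`_i - u *: (\sum_i c i *: s`_i).
    by rewrite scaler_sumr -sumrB; apply: eq_bigr => i _; rewrite scalerBl scalerA.
  by rewrite -ca scalerDl addrACA subrr addr0.
Qed.

Let cone_min n (T : {set I}) (x : 'rV[R]_m) : (#|T| <= n)%N -> cone_over T x ->
  exists2 T' : {set I}, cone_over T' x & ~ convex_hull (face T') a.
Proof.
elim: n T => [|n IH] T Tn cx; have [aT|aT] := pselect (convex_hull (face T) a); try by exists T.
  by have [T' lt _] := cone_shrink cx aT; move: (leq_trans lt Tn).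
by have [T' lt cx'] := cone_shrink cx aT; apply: (IH T') => //; rewrite -ltnS (leq_trans lt).
Qed.

(** [N] is homogeneous about [a]. By [cone_min], [x] lies on a segment from [a] to a point [y] of a
    face missing [a]. On these finitely many compact faces [N] is at least [d], so the point at
    level [e] on the ray from [a] is reached no later than [y]. *)
Lemma conic (N : 'rV[R]_m -> R) : convex_hull s a -> continuous N ->
  (forall x l, 0 <= l -> N (a + l *: (x - a)) = l * N x) ->
  (forall x, convex_hull s x -> x <> a -> 0 < N x) ->
  exists2 d, 0 < d & forall e x, e <= d -> 0 < e -> convex_hull s x -> x <> a ->
    convex_hull s (a + (e / N x) *: (x - a)).
Proof.
move=> sa cN Nl N0.
have fs (T : {set I}) x : convex_hull (face T) x -> convex_hull s x.
  apply: hull_min; first exact: hull_convex.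
  by move=> _ /mapP[i _ ->]; apply: hull_mem; exact: (mem_nth 0 (ltn_ord i)).
have [d d0 hd] : exists2 d, 0 < d & forall T e, T \in enum {set I} -> e <= d ->
    ~ convex_hull (face T) a -> forall y, convex_hull (face T) y -> e <= N y.
  apply: pos_bound_seq => T _; have [aT|aT] := pselect (convex_hull (face T) a).
    by exists 1 => // e _ [].
  have [|||d d0 dP] := @compact_pos_bound R _ (convex_hull (face T)) N.
  - exact: hull_compact.
  - exact: continuous_subspaceT.
  - by move=> x xT; apply: N0; [exact: fs xT|move=> xa; apply: aT; rewrite -xa].
  by exists d => // e ed _ y /dP; exact: le_trans.
exists d => // e x ed e0 sx xa.
have cx : cone_over [set: I]%SET x.
  have [c [c0 c1 xE]] := sx; exists 0, c; split=> // [i||].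
  - by rewrite inE.
  - by rewrite add0r.
  - by rewrite scale0r add0r xE.
have [T [l0 [l [l00 l0' lT l1 xE]]] aT] := cone_min (leqnn _) cx.
pose u := \sum_i l i.
have u0 : 0 <= u by exact: sumr_ge0.
have un0 : u != 0.
  apply/eqP => uz; apply: xa; rewrite xE; have -> : l0 = 1 by rewrite -l1 -/u uz addr0.
  have lz i : l i = 0.
    by move/eqP: uz; rewrite psumr_eq0 // => /allP /(_ i (mem_index_enum i)) /eqP.
  by rewrite scale1r big1 ?addr0 // => i _; rewrite lz scale0r.
have up : 0 < u by rewrite lt_neqAle eq_sym un0.
pose y := \sum_i (l i / u) *: s`_i.
have yT : convex_hull (face T) y.
  apply: hull_family => [i||i].
  - by rewrite divr_ge0.
  - by rewrite -mulr_suml divff.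
  - move=> li; apply: map_f; rewrite mem_enum; apply: contraNT li => /lT ->.
    by rewrite mul0r.
have xy : x - a = u *: (y - a).
  rewrite xE /y scalerBr scaler_sumr.
  under [in RHS]eq_bigr do rewrite scalerA mulrC divfK //.
  have -> : l0 = 1 - u by rewrite -l1 addrK.
  by rewrite scalerBl scale1r addrAC [_ - _ - a]addrAC subrr sub0r addrC.
have Nx : N x = u * N y by rewrite -[x](subrK a) addrC xy Nl.
have ey : e <= N y by apply: (hd T); rewrite ?mem_enum.
have Ny : 0 < N y by exact: lt_le_trans ey.
have -> : a + (e / N x) *: (x - a) = (1 - e / N y) *: a + (e / N y) *: y.
  rewrite xy scalerA Nx; have -> : e / (u * N y) * u = e / N y by field; rewrite un0 gt_eqF.
  by rewrite scalerBr scalerBl scale1r addrA addrAC.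
apply: hull_convex => //; first exact: fs yT.
by rewrite divr_ge0 ?(ltW e0) ?(ltW Ny) // ler_pdivrMr // mul1r.
Qed.

End Conic.

(** * The splitting of the exceptional complex *)

Section NormOfRows.
Context {R : realType} {m : nat}.

Lemma rV_coord_le (x : 'rV[R]_m) k : `|x 0 k| <= `|x|.
Proof.
have := @mx_normrE R 1 m x; rewrite -[mx_norm x]/(`|x|) => ->.
by apply: (@le_bigmax _ _ _ 0 (fun i : 'I_1 * 'I_m => `|x i.1 i.2|) (0, k)).
Qed.

Lemma rV_norm_attained (x : 'rV[R]_m) : 0 < `|x| -> exists k, `|x| = `|x 0 k|.
Proof.
move=> x0; have [|[i k] e] := @mx_norm_neq0 R 1 m x; first by rewrite gt_eqF.
by exists k; rewrite -[LHS]/(mx_norm x) e /= ord1.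
Qed.

Variable P : set 'rV[R]_m.
Hypothesis polyP : polyhedron P.

Lemma polyhedron_halfspaces (l : seq (R * 'I_m * R)) :
  polyhedron (P `&` [set x | forall h, h \in l -> h.1.1 * x 0 h.1.2 <= h.2]).
Proof.
elim: l => [|[[b k] c] l IH].
  by rewrite (_ : _ `&` _ = P) //; apply/seteqP; split=> [x []|x Px].
have := polyhedron_halfspace b c k IH; congr polyhedron.
apply/seteqP; split=> x [].
  by move=> [Px xl] xk; split=> // h; rewrite inE => /orP[/eqP ->|/xl].
move=> Px xl; split; first by split=> // h hl; apply: xl; rewrite inE hl orbT.
by apply: (xl (b, k, c)); rewrite inE eqxx.
Qed.

End NormOfRows.

Section Blocks.
Context {R : realType} {d m : nat} (P : set 'rV[R]_(d + m)) (v : 'rV[R]_m) (e : R).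
Hypothesis polyP : polyhedron P.

(** The norm of a row is the maximum of the absolute values of its coordinates, so a ball is an
    intersection of half-spaces and its exterior, in [polyhedron_far], a union of them. Only the
    last block is constrained, as the set to be cut will be part of the graph of a map. *)
Lemma polyhedron_near : 0 <= e -> polyhedron (P `&` [set x | `|rsubmx x - v| <= e]).
Proof.
move=> e0.
pose l := [seq (1, rshift d k, v 0 k + e) | k <- enum 'I_m] ++
          [seq (-1, rshift d k, e - v 0 k) | k <- enum 'I_m] : seq (R * 'I_(d + m) * R).
have := polyhedron_halfspaces polyP l; congr polyhedron; apply/seteqP; split=> x [Px xl]; split=> //=.
  have [->|] := eqVneq (`|rsubmx x - v|) 0; first by [].
  rewrite -normr_gt0 normr_id => /rV_norm_attained [k ->]; rewrite !mxE ler_norml.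
  have h1 : 1 * x 0 (rshift d k) <= v 0 k + e.
    by apply: (xl (1, rshift d k, v 0 k + e)); rewrite mem_cat map_f ?mem_enum.
  have h2 : -1 * x 0 (rshift d k) <= e - v 0 k.
    apply: (xl (-1, rshift d k, e - v 0 k)); rewrite mem_cat; apply/orP; right.
    by apply: (map_f (fun k => (-1, rshift d k, e - v 0 k))); rewrite mem_enum.
  by apply/andP; split; lra.
move=> h; rewrite mem_cat => /orP[] /mapP[k _ ->] /=.
  have := le_trans (rV_coord_le (rsubmx x - v) k) xl; rewrite !mxE ler_norml => /andP[h1 h2]; lra.
have := le_trans (rV_coord_le (rsubmx x - v) k) xl; rewrite !mxE ler_norml => /andP[h1 h2]; lra.
Qed.

Lemma polyhedron_far : 0 < e -> polyhedron (P `&` [set x | e <= `|rsubmx x - v|]).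
Proof.
move=> e0.
pose half (h : bool * 'I_m) := if h.1 then P `&` [set x : 'rV[R]_(d + m) | 1 * x 0 (rshift d h.2) <= v 0 h.2 - e]
  else P `&` [set x : 'rV[R]_(d + m) | -1 * x 0 (rshift d h.2) <= - v 0 h.2 - e].
have := @polyhedron_bigcup R _ _ (enum {: bool * 'I_m}) half; rewrite (_ : \bigcup_(_ in _) _ =
  P `&` [set x | e <= `|rsubmx x - v|]).
  by apply=> -[[] k] _; exact: polyhedron_halfspace.
apply/seteqP; split=> [x [[h k] _]|x [Px /= xe]].
  rewrite /half /=; case: h => -[Px /= xk]; split=> //=; apply: le_trans (rV_coord_le _ k).
    by rewrite !mxE ler_normr; apply/orP; right; lra.
  by rewrite !mxE ler_normr; apply/orP; left; lra.
have [k ek] := rV_norm_attained (lt_le_trans e0 xe).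
move: xe; rewrite ek !mxE ler_normr => /orP[xe|xe].
  by exists (false, k); [rewrite /= mem_enum|split=> //=; lra].
by exists (true, k); [rewrite /= mem_enum|split=> //=; lra].
Qed.

End Blocks.

Section PuncturedSphere.
Context {R : realType} (S : sphere R 2).

(** The segment from [-S] to a point other than [S] avoids the origin, and its radial projection to
    the sphere never meets [S]. *)
Lemma punctured_sphere_contractible : contractible R [set y : sphere R 2 | y <> S].
Proof.
pose U := [set y : sphere R 2 | y <> S].
pose s j := set_val S 0 j.
have Ss : s 0 ^+ 2 + (s 1 ^+ 2 + s 2 ^+ 2) = 1 by apply/sphere2P; exact: (set_valP S).
pose px (x : R * U) j := set_val (set_val x.2) 0 j.
have Sp x : px x 0 ^+ 2 + (px x 1 ^+ 2 + px x 2 ^+ 2) = 1.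
  by apply/sphere2P; exact: (set_valP (set_val x.2)).
pose u x j := - ((1 - clamp01 x.1) * s j) + clamp01 x.1 * px x j.
pose n2 x := u x 0 ^+ 2 + (u x 1 ^+ 2 + u x 2 ^+ 2).
have dot x : px x 0 * s 0 + (px x 1 * s 1 + px x 2 * s 2) < 1.
  have ne : set_val x.2 <> S by exact: (set_valP x.2).
  have sq : 0 < (px x 0 - s 0) ^+ 2 + ((px x 1 - s 1) ^+ 2 + (px x 2 - s 2) ^+ 2).
    rewrite lt_neqAle !addr_ge0 ?sqr_ge0 // andbT; apply/eqP => /esym/eqP.
    rewrite !paddr_eq0 ?addr_ge0 ?sqr_ge0 // !sqrf_eq0 !subr_eq0 => /and3P[/eqP e0 /eqP e1 /eqP e2].
    apply: ne; apply: set_val_inj; apply/rowP => j.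
    by have [->|->|->] := ord3P j.
  by have := Sp x; nra.
have n2p x : 0 < n2 x.
  have /andP[t0 t1] := clamp01_in x.1; have := dot x.
  set t := clamp01 x.1 in t0 t1 *; set dd := _ + _ => d1.
  have -> : n2 x = (1 - t) ^+ 2 + t ^+ 2 - 2 * (t * (1 - t)) * dd.
    transitivity ((1 - t) ^+ 2 * (s 0 ^+ 2 + (s 1 ^+ 2 + s 2 ^+ 2)) +
      t ^+ 2 * (px x 0 ^+ 2 + (px x 1 ^+ 2 + px x 2 ^+ 2)) - 2 * (t * (1 - t)) * dd).
      by rewrite /n2 /u /dd -/t; ring.
    by rewrite Ss Sp !mulr1.
  have tt : 0 <= t * (1 - t) by rewrite mulr_ge0 // subr_ge0.
  have [tz|tn] := eqVneq (t * (1 - t)) 0.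
    rewrite tz mulr0 mul0r subr0; have -> : (1 - t) ^+ 2 + t ^+ 2 = 1 - 2 * (t * (1 - t)) by ring.
    by rewrite tz mulr0 subr0.
  have tp : 0 < t * (1 - t) by rewrite lt_neqAle eq_sym tn.
  have : 0 <= (1 - 2 * t) ^+ 2 by exact: sqr_ge0.
  by nra.
pose rho x := Num.sqrt (n2 x).
have rp x : 0 < rho x by rewrite sqrtr_gt0.
have r2 x : rho x ^+ 2 = n2 x by rewrite sqr_sqrtr // ltW.
pose w x : 'rV[R]_3 := \row_j (u x j / rho x).
have Sw x : sphere R 2 (w x).
  apply/sphere2P; rewrite !mxE !expr_div_n -!mulrDl r2 divff // gt_eqF //; exact: n2p.
have wU x : U (mk_sub (Sw x)).
  move=> /(congr1 set_val); rewrite mk_subE => /rowP e.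
  have /andP[t0 t1] := clamp01_in x.1; set t := clamp01 x.1 in t0 t1.
  have ej j : t * px x j = (rho x + (1 - t)) * s j.
    have := e j; rewrite mxE -/(s j) => /(congr1 (fun z => z * rho x)).
    by rewrite divfK ?gt_eqF // /u -/t; lra.
  have tt : t = rho x + (1 - t).
    have : t ^+ 2 = (rho x + (1 - t)) ^+ 2.
      transitivity (t ^+ 2 * (px x 0 ^+ 2 + (px x 1 ^+ 2 + px x 2 ^+ 2))); first by rewrite Sp mulr1.
      rewrite !mulrDr -!exprMn !ej !exprMn -!mulrDr Ss mulr1 //.
    move/eqP; rewrite eqrXn2 // => [/eqP //|].
    by rewrite addr_ge0 ?subr_ge0 // ltW.
  have tp : 0 < t by rewrite tt ltr_wpDr // subr_ge0.
  have ne : set_val x.2 <> S by exact: (set_valP x.2).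
  apply: ne; apply: set_val_inj; apply/rowP => j.
  have tn : t != 0 by rewrite gt_eqF.
  by apply: (mulfI tn); have := ej j; rewrite -tt.
pose H x : U := mk_sub (wU x).
have cp j x : {for x, continuous (fun x => px x j)}.
  apply: (@cont_comp_for _ _ _ (@snd R U) (fun y => set_val (set_val y) 0 j)); first exact: cvg_snd.
  exact: (cont_comp (@set_val_continuous _ _) (cont_comp (@set_val_continuous _ _) (@coord_cont _ _ j))).
have cc x : {for x, continuous (fun x : R * U => clamp01 x.1)}.
  by apply: (@cont_comp_for _ _ _ (@fst R U)); [exact: cvg_fst|exact: clamp01_cont].
have cu j x : {for x, continuous (fun x => u x j)}.
  by have := cp j x => h1; have := cc x => h2; rewrite /u; cont_tac.
have cn x : {for x, continuous n2}.
  have := cu 0 x => h0; have := cu 1 x => h1; have := cu 2 x => h2.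
  rewrite (_ : n2 = fun x => u x 0 * u x 0 + (u x 1 * u x 1 + u x 2 * u x 2)); first by cont_tac.
  by apply/funext => y; rewrite /n2 !expr2.
have cH : continuous H.
  apply: sub_cont; apply: sub_cont; apply: contI => x; apply: rV_cont => j.
  rewrite (_ : (fun _ => _) = (fun x => u x j / rho x)); last by apply/funext => y; rewrite !mk_subE mxE.
  apply: contM; first exact: cu.
  apply: contV; first by rewrite gt_eqF.
  by apply: (@cont_comp_for _ _ _ n2 Num.sqrt); [exact: cn|exact: sqrt_continuous].
have c0 : clamp01 0 = 0 :> R by rewrite clamp01_id // lexx ler01.
have c1 : clamp01 1 = 1 :> R by rewrite clamp01_id // lexx ler01.
have [y0 _] : exists y : U, True.
  have Sm : sphere R 2 (- set_val S) by apply/sphere2P; rewrite !mxE !sqrrN.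
  have Um : U (mk_sub Sm).
    move=> /(congr1 set_val); rewrite mk_subE => /rowP e.
    have z j : s j = 0 by have := e j; rewrite mxE -/(s j) => ?; lra.
    by move: Ss; rewrite !z expr0n /= !addr0 => /esym/eqP; rewrite oner_eq0.
  by exists (mk_sub Um).
exists (H (0, y0)), H; split=> // y; apply: set_val_inj; apply: set_val_inj; apply/rowP => j.
  rewrite !mk_subE !mxE; have ue z i : u (0, z) i = - s i by rewrite /u /= c0 subr0 mul1r mul0r addr0.
  by rewrite /rho /n2 !ue.
have ue i : u (1, y) i = set_val (set_val y) 0 i by rewrite /u /= c1 subrr mul0r oppr0 add0r mul1r.
rewrite !mk_subE !mxE ue /rho.
have -> : n2 (1, y) = 1 by rewrite /n2 !ue; exact: (Sp (1, y)).
by rewrite sqrtr1 divr1.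
Qed.

End PuncturedSphere.

Lemma chart_contractible (R : realType) (X : topologicalType) (S : pl_structure R X) (A : set X) :
  contractible R (S @` A) -> contractible R A.
Proof.
have [g [cg gS]] := chart_inv S.
have SA (x : A) : (S @` A) (S (set_val x)) by exists (set_val x) => //; exact: (set_valP x).
have gA (y : S @` A) : A (g (set_val y)).
  have [x Ax e] := set_valP y; have -> : set_val y = S x by exact: esym e.
  by rewrite gS.
apply: (@contractible_retract R (S @` A) A (fun x => mk_sub (SA x)) (fun y => mk_sub (gA y))).
- apply: sub_cont; exact: (cont_comp (@set_val_continuous _ _) (@chart_cont _ _ S)).
- apply: sub_cont.
  have : {within S @` A, continuous g} by apply: continuous_subspaceW cg => y [x _ <-]; exists x.
  by move=> /within_sub.
- by move=> x; apply: set_val_inj; rewrite !mk_subE gS.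
Qed.

(** Otherwise the indicator of [z0] would be a continuous integer-valued function on the
    contractible disk. *)
Lemma disk_not_isolated (R : realType) (z0 z1 : disk R) (B : set (disk R)) :
  z0 <> z1 -> nbhs z0 B -> exists z, [/\ B z, z <> z0 & z <> z1].
Proof.
move=> z01 Bz; apply: contrapT => nB.
have n1 : \forall z \near z0, z <> z1.
  have : open (~` [set z1] : set (disk R)).
    by apply: closed_openC; apply: accessible_closed_set1; apply: hausdorff_accessible; exact: disk_hausdorff.
  by move=> o1; apply: open_nbhs_nbhs; split.
have iso : \forall z \near z0, z = z0.
  apply: near_imp (near_andb Bz n1) => z [Bzz zz1].
  by apply: contrapT => zz0; apply: nB; exists z.
pose u (z : disk R) : R := if pselect (z = z0) then 1 else 0.
have u0 z : z <> z0 -> u z = 0 by rewrite /u; case: pselect.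
have u1 : u z0 = 1 by rewrite /u; case: pselect.
have cu : continuous u.
  apply: contI => z; apply/cont_eps => e e0; have [->|zz0] := pselect (z = z0).
    by apply: near_imp iso => y ->; rewrite subrr normr0.
  have : open (~` [set z0] : set (disk R)).
    by apply: closed_openC; apply: accessible_closed_set1; apply: hausdorff_accessible; exact: disk_hausdorff.
  move=> o0; have : nbhs z (~` [set z0]) by apply: open_nbhs_nbhs; split.
  by apply: near_imp => y yz0; rewrite !u0 // subrr normr0.
have uZ z : u z \is a Num.int by rewrite /u; case: pselect => ?; rewrite ?rpred1 ?rpred0.
have := contractible_int_const (@disk_contractible R) cu uZ z0 z1.
rewrite u1 u0; last by move=> e; apply: z01.
by move/eqP; rewrite oner_eq0.
Qed.

Section ExceptionalSplitting.
Variables (R : realType) (Q : topologicalType) (SD : pl_structure R (disk R)) (SQ : pl_structure R Q).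
Variables (q : disk R -> Q) (ka : disk R -> sphere R 2) (N S : sphere R 2).
Hypotheses (cq : continuous q) (qs : forall b, exists z, q z = b) (plq : pl_map SD SQ q).
Hypotheses (cka : continuous ka) (kas : forall y, exists z, ka z = y) (NS : N <> S).
Hypothesis fiber : forall z z', q z = q z' <->
  ka z = ka z' \/ (ka z = N \/ ka z = S) /\ (ka z' = N \/ ka z' = S).
Hypothesis uniq : forall z z', ka z = ka z' -> ka z = N \/ ka z = S -> z = z'.

(* The sphere is cut along the boundary of a small conical neighbourhood of [S]
   in the sheet of the complex through [S]: the part containing [S] is
   star-shaped, and the rest is a retract of the sphere punctured at [S]. *)
Lemma sphere_quotient_splittable : finitely_splittable SQ.
Proof.
(* The graph of [q] is a polyhedron that projects linearly to the chart of [Q]; unlike [Q] it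
   separates the sheets through [N] and [S]. *)
pose W z : 'rV[R]_(pl_dim SD + pl_dim SQ) := row_mx (SD z) (SQ (q z)).
have [ss ssE] : polyhedron (range W) := plq.
have WP := polyhedronP ssE.
have cW : continuous W.
  apply: contI => z; apply: rV_cont => j; case: (splitP j) => k jk.
    have -> : j = lshift _ k by apply: val_inj.
    rewrite (_ : (fun _ => _) = (fun z => SD z 0 k)); last by apply/funext => y; rewrite row_mxEl.
    exact: (cont_comp (@chart_cont _ _ SD) (@coord_cont _ _ k)).
  have -> : j = rshift _ k by apply: val_inj.
  rewrite (_ : (fun _ => _) = (fun z => SQ (q z) 0 k)); last by apply/funext => y; rewrite row_mxEr.
  exact: (cont_comp cq (cont_comp (@chart_cont _ _ SQ) (@coord_cont _ _ k))).
have Winj z z' : W z = W z' -> z = z'.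
  by move=> /(congr1 lsubmx); rewrite !row_mxKl => /(@chart_inj _ _ SD).
have Wr z : rsubmx (W z) = SQ (q z) by exact: row_mxKr.
have [zS kS] := kas S; have [zN kN] := kas N.
have zSN : zS <> zN by move=> e; apply: NS; rewrite -kN -kS e.
have uS z : ka z = S -> z = zS by move=> e; apply: uniq; rewrite e ?kS //; right.
have uN z : ka z = N -> z = zN by move=> e; apply: uniq; rewrite e ?kN //; left.
have qSN : q zS = q zN by apply/fiber; rewrite kS kN; right; split; [right|left].
pose a := W zS; pose v0 := SQ (q zS).
have pole z : q z = q zS -> ka z = N \/ ka z = S.
  by move=> /fiber[e|[]//]; right; rewrite e.
pose nn (x : 'rV[R]_(pl_dim SD + pl_dim SQ)) : R := `|rsubmx x - v0|.
have cnn : continuous nn.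
  apply: contI => x; apply: cont_norm; apply: contD; last by apply: contN; exact: contC.
  exact: continuous_rsubmx.
have nnl x l : 0 <= l -> nn (a + l *: (x - a)) = l * nn x.
  move=> l0; rewrite /nn linearD linearZ /= linearB /= Wr -/v0 addrAC subrr add0r.
  by rewrite normrZ ger0_norm.
pose sec y := projT1 (cid (kas y)).
have secK y : ka (sec y) = y by exact: projT2 (cid (kas y)).
pose h y := q (sec y).
have hk z : h (ka z) = q z by apply/fiber; left; exact: secK.
have sph_haus : hausdorff_space (sphere R 2) by apply: sub_hausdorff; exact: rV_hausdorff.
have ch : continuous h.
  apply: contI => y; apply: (@compact_map_cont (disk R) (sphere R 2) Q setT ka h y).
  - exact: diskT_compact.
  - exact: continuous_subspaceT.
  - exact: sph_haus.
  - by move=> b; exists (sec b) => //; exact: secK.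
  - by apply: continuous_subspaceT; under eq_fun do rewrite hk.
pose nu y := `|SQ (h y) - v0|.
have cnu : continuous nu.
  apply: contI => y; apply: cont_norm; apply: contD; last by apply: contN; exact: contC.
  exact: (cont_comp ch (@chart_cont _ _ SQ)).
have nW z : nn (W z) = nu (ka z) by rewrite /nn /nu Wr hk.
have nu0 y : y <> N -> y <> S -> 0 < nu y.
  move=> yN yS; rewrite normr_gt0 subr_eq0; apply/eqP => /(@chart_inj _ _ SQ).
  by rewrite /h => /pole; rewrite secK => -[].
pose Sh s := `[< convex_hull s a >].
(* The hulls of the graph containing [a], the point over [S], form the sheet in which the conical
   neighbourhood is taken; [PN] is the rest. *)
pose PS := \bigcup_(s in [set` [seq s <- ss | Sh s]]) convex_hull s.
pose PN := \bigcup_(s in [set` [seq s <- ss | ~~ Sh s]]) convex_hull s.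
have polyS : polyhedron PS by exists [seq s <- ss | Sh s].
have polyN : polyhedron PN by exists [seq s <- ss | ~~ Sh s].
have PSP x : PS x <-> exists s, [/\ s \in ss, convex_hull s a & convex_hull s x].
  split=> [[s /=]|[s [sss sa sx]]]; first by rewrite mem_filter => /andP[/asboolP sa sss] sx; exists s.
  by exists s => //=; rewrite mem_filter sss andbT; apply/asboolP.
have PNP x : PN x <-> exists s, [/\ s \in ss, ~ convex_hull s a & convex_hull s x].
  split=> [[s /=]|[s [sss sa sx]]]; first by rewrite mem_filter => /andP[/asboolPn sa sss] sx; exists s.
  by exists s => //=; rewrite mem_filter sss andbT; apply/asboolPn.
pose ZS := W @^-1` PS; pose ZN := W @^-1` PN.
have cl P : polyhedron P -> closed (W @^-1` P).
  move=> pP; apply: closed_pre => //; apply: compact_closed; first exact: rV_hausdorff.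
  exact: polyhedron_compact.
have cmp (Z : set (disk R)) : closed Z -> compact (ka @` Z).
  move=> cZ; apply: continuous_compact; first exact: continuous_subspaceT.
  by apply: (@subclosed_compact _ _ setT) => //; exact: diskT_compact.
pose YS := ka @` ZS; pose YN := ka @` ZN.
have cYS : compact YS by apply: cmp; exact: cl.
have cYN : compact YN by apply: cmp; exact: cl.
have clYS : closed YS by exact: compact_closed.
have clYN : closed YN by exact: compact_closed.
have covZ z : ZS z \/ ZN z.
  have [s sss sz] : exists2 s : seq 'rV[R]_(pl_dim SD + pl_dim SQ), s \in ss & convex_hull s (W z).
    by apply/WP; exists z.
  have [sa|sa] := pselect (convex_hull s a); [left; apply/PSP|right; apply/PNP]; by exists s.
have cov y : YS y \/ YN y.
  by have [z <-] := kas y; have [zZ|zZ] := covZ z; [left|right]; exists z.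
have SYN : ~ YN S.
  by move=> [z zZ /uS zz]; rewrite zz in zZ; have [s [_ sa /sa]] := (PNP _).1 zZ.
have inW s x : s \in ss -> convex_hull s x -> exists z, W z = x.
  by move=> sss sx; have /WP[z _ <-] : exists2 s : seq 'rV[R]_(pl_dim SD + pl_dim SQ), s \in ss & convex_hull s x by [exists s]; exists z.
(* A hull containing the points over both [N] and [S] would contain their midpoint, which projects
   to the double point again; but only the two ends lie over it. *)
have NYS : ~ YS N.
  move=> [z zZ kz]; have [s [sss sa sz]] := (PSP _).1 zZ; have zz := uN z kz.
  have half : 0 <= (2^-1 : R) <= 1 by apply/andP; split; lra.
  have sm := hull_convex sa sz half; have [z' z'm] := inW _ _ sss sm.
  have e12 : 1 - 2^-1 = 2^-1 :> R by field.
  rewrite e12 in z'm.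
  have qz' : q z' = q zS.
    apply: (@chart_inj _ _ SQ); rewrite -Wr z'm linearD !linearZ /= !Wr zz -qSN -scalerDl.
    have -> : 2^-1 + 2^-1 = 1 :> R by field.
    exact: scale1r.
  have az : a = W z.
    have m2 : 2^-1 *: (a + W z) = W z' by rewrite scalerDr z'm.
    have cancel2 (x : 'rV[R]_(pl_dim SD + pl_dim SQ)) : 2 *: (2^-1 *: x) = x.
      by rewrite scalerA divff ?pnatr_eq0 // scale1r.
    move: m2 => /(congr1 (fun x => 2 *: x)); rewrite cancel2 scaler_nat mulr2n.
    case: (pole _ qz') => [/uN ->|/uS ->]; first by rewrite -zz => /addIr.
    by rewrite -/a => /addrI ->.
  by apply: zSN; rewrite -zz; exact: Winj az.
have [d1 d10 conicP] : exists2 d, 0 < d & forall s e, s \in ss -> e <= d ->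
    convex_hull s a -> 0 < e -> forall x, convex_hull s x -> x <> a ->
    convex_hull s (a + (e / nn x) *: (x - a)).
  apply: pos_bound_seq => s sss; have [sa|sa] := pselect (convex_hull s a); last by exists 1.
  have [|d d0 hd] := conic sa cnn nnl; last by exists d => // e ed _ e0 x; exact: hd.
  move=> x sx xa; have [z zx] := inW _ _ sss sx; rewrite -zx nW; apply: nu0 => kz.
    by apply: NYS; exists z => //; apply/PSP; exists s; rewrite zx.
  by apply: xa; rewrite -zx (uS z kz).
have [d2 d20 overlap] : exists2 d, 0 < d & forall y, (YS `&` YN) y -> d <= nu y.
  apply: compact_pos_bound.
  - exact: compact_closedI.
  - exact: continuous_subspaceT.
  - by move=> y [yS yN]; apply: nu0 => e; [apply: NYS; rewrite -e|apply: SYN; rewrite -e].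
have [z3 [_ z3S z3N]] := @disk_not_isolated R zS zN setT zSN filterT.
have nu3 : 0 < nu (ka z3).
  by apply: nu0 => e; [apply: z3N; exact: uN|apply: z3S; exact: uS].
(* [d1] allows radial pushing inside each hull by [conic], [d2] keeps the level [eps] clear of the
   overlap with the other hulls, and the last bound leaves a point outside [B]. *)
pose eps := Num.min d1 (Num.min (d2 / 2) (nu (ka z3) / 2)).
have eps0 : 0 < eps by rewrite !lt_min d10 !divr_gt0.
have eps1 : eps <= d1 by rewrite ge_min lexx.
have eps2 : eps < d2.
  by apply: le_lt_trans (_ : d2 / 2 < d2); [rewrite !ge_min lexx orbT|lra].
have eps3 : eps < nu (ka z3).
  by apply: le_lt_trans (_ : nu (ka z3) / 2 < _); [rewrite !ge_min lexx !orbT|lra].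
have overlap' y : YS y -> YN y -> eps < nu y.
  by move=> yS yN; apply: lt_le_trans eps2 _; apply: overlap.
pose YB := YS `&` [set y | nu y <= eps].
pose YF := YS `&` [set y | eps <= nu y].
pose YA := YN `|` YF.
pose B := h @` YB; pose A := h @` YA.
have clF : closed YF by apply: closedI => //; exact: (@closed_pre _ _ nu [set x | eps <= x] cnu (@closed_ge _ eps)).
have clYA : closed YA by exact: closedU.
have SYA : ~ YA S.
  move=> [//|[_ /=]]; rewrite /nu -kS hk -/v0 subrr normr0 leNgt eps0 //.
have vS : nu S = 0 by rewrite /nu -kS hk -/v0 subrr normr0.
have YSS : YS S.
  by exists zS => //; have [//|/PNP[s [_ sa /sa]]//] := covZ zS.
have AE x : (exists2 y, YA y & SQ (h y) = x) <-> (SQ @` A) x.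
  by split=> [[y yA <-]|[_ [y yA <-] <-]]; [exists (h y) => //; exists y|exists y].
have ABT : A `|` B = setT.
  apply/seteqP; split=> // b _; have [z <-] := qs b; rewrite -hk.
  have [zS'|zN'] := cov (ka z); last by left; exists (ka z) => //; left.
  have [le|le] := leP (nu (ka z)) eps; first by right; exists (ka z).
  by left; exists (ka z) => //; right; split=> //; exact: ltW.
have polyA : subpolyhedron SQ A.
  have pF := polyhedron_far v0 polyS eps0.
  have := polyhedron_linear (@rsubmx R 1 (pl_dim SD) (pl_dim SQ)) (polyhedronU polyN pF).
  rewrite /subpolyhedron; congr polyhedron; apply/seteqP; split=> x.
    move=> [y [yN|[yS ye]] <-].
      have [s [sss _ sy]] := (PNP _).1 yN; have [z zy] := inW _ _ sss sy.
      exists (h (ka z)); last by rewrite hk -Wr zy.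
      by exists (ka z) => //; left; exists z => //; rewrite /ZN /= zy.
    have [s [sss _ sy]] := (PSP _).1 yS; have [z zy] := inW _ _ sss sy.
    exists (h (ka z)); last by rewrite hk -Wr zy.
    exists (ka z) => //; right; split; first by exists z => //; rewrite /ZS /= zy.
    by rewrite /= -nW zy.
  move=> [_ [_ [[z zZ <-]|[[z zZ <-] ze]] <-] <-]; exists (W z); try (by left); try (by rewrite hk; exact: Wr).
  by right; split=> //; rewrite /= -/(nn _) nW.
have polyB : subpolyhedron SQ B.
  have := polyhedron_linear (@rsubmx R 1 (pl_dim SD) (pl_dim SQ)) (polyhedron_near v0 polyS (ltW eps0)).
  rewrite /subpolyhedron; congr polyhedron; apply/seteqP; split=> x.
    move=> [y [yS ye] <-]; have [s [sss _ sy]] := (PSP _).1 yS; have [z zy] := inW _ _ sss sy.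
    exists (h (ka z)); last by rewrite hk -Wr zy.
    exists (ka z) => //; split; first by exists z => //; rewrite /ZS /= zy.
    by rewrite /= -nW zy.
  move=> [_ [_ [[z zZ <-] ze] <-] <-]; exists (W z); last by rewrite hk; exact: Wr.
  by split=> //; rewrite /= -/(nn _) nW.
have BT : B <> setT.
  move=> BT; have : B (q z3) by rewrite BT.
  move=> [y [_ /= ye] e]; move: ye; rewrite leNgt => /negP; apply.
  by rewrite /nu e -hk.
have AT : A <> setT.
  move=> AT.
  have nb : \forall z \near zS, ~ YA (ka z).
    have o : open (~` YA) by exact: closed_openC.
    have nk : nbhs (ka zS) (~` YA) by apply: open_nbhs_nbhs; split=> //; rewrite kS.
    exact: (cka nk).
  have [z [nz zzS zzN]] := disk_not_isolated zSN nb.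
  have [y yA e] : A (q z) by rewrite AT.
  have [z' z'y] := kas y; rewrite -z'y hk in e; rewrite -z'y in yA.
  have [ee|[_ [kz|kz]]] := (fiber _ _).1 e.
  - by apply: nz; rewrite -ee.
  - by apply: zzN; exact: uN.
  - by apply: zzS; exact: uS.
have conB : contractible R B.
  apply: (@chart_contractible _ _ SQ); apply: (@starshaped_contractible _ _ (SQ @` B) v0).
    by exists (q zS) => //; exists S; [split=> //=; rewrite vS ltW|rewrite -kS hk].
  move=> _ t [_ [_ [[z zZ <-] ze] <-] <-] t01; have [t0 t1] := andP t01.
  have [s [sss sa sz]] := (PSP _).1 zZ; have sm := hull_convex sa sz t01.
  have [z' z'm] := inW _ _ sss sm.
  exists (h (ka z')).
    exists (ka z') => //; split; first by exists z' => //; apply/PSP; exists s; rewrite z'm.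
    rewrite /= -nW z'm; have -> : (1 - t) *: a + t *: W z = a + t *: (W z - a).
      by rewrite scalerBr scalerBl scale1r addrAC addrA.
    rewrite nnl // nW; apply: le_trans ze; rewrite -[X in _ <= X]mul1r.
    by apply: ler_wpM2r => //; exact: normr_ge0.
  by rewrite !hk -Wr z'm linearD !linearZ /= !Wr.
have conA : contractible R A.
  apply: (@chart_contractible _ _ SQ).
  pose U := [set y : sphere R 2 | y <> S].
  (* With [S] excluded, only [N] can lie over the double point, so [h] is injective on [YA], and by
     compactness [A] embeds in the punctured sphere. *)
  have hinj y y' : YA y -> YA y' -> h y = h y' -> y = y'.
    move=> yA yA' /fiber; rewrite !secK => -[//|[[->|e] [->|e']]] //.
    - by rewrite e' in yA'; case: SYA.
    - by rewrite e in yA; case: SYA.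
    - by rewrite e in yA; case: SYA.
  have exi (x : SQ @` A) : exists y, YA y /\ SQ (h y) = set_val x.
    by have [y yA e] := (AE (set_val x)).2 (set_valP x); exists y.
  have [iy iyP] := choice exi.
  have iU x : U (iy x) by move=> e; have [] := iyP x; rewrite e => /SYA.
  have gA (y : YA) : (SQ @` A) (SQ (h (set_val y))) by apply/AE; exists (set_val y) => //; exact: (set_valP y).
  have iK (y : YA) : iy (mk_sub (gA y)) = set_val y.
    have [h1 h2] := iyP (mk_sub (gA y)); rewrite mk_subE in h2.
    by apply: hinj => //; [exact: (set_valP y)|exact: (@chart_inj _ _ SQ) h2].
  have ci : continuous (fun x => mk_sub (iU x)).
    apply: contI => x.
    apply: (@compact_map_cont YA (SQ @` A) U setT (fun y => mk_sub (gA y)) (fun x => mk_sub (iU x)) x).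
    - apply: sub_compact; apply: (@subclosed_compact _ _ setT) => //.
      have := cmp setT closedT; congr compact; apply/seteqP; split=> // y _.
      by have [z zy] := kas y; exists z.
    - apply: continuous_subspaceT; apply: sub_cont.
      exact: (cont_comp (@set_val_continuous _ _) (cont_comp ch (@chart_cont _ _ SQ))).
    - by apply: sub_hausdorff; exact: rV_hausdorff.
    - move=> b; have [h1 h2] := iyP b; exists (mk_sub h1) => //.
      by apply: set_val_inj; rewrite mk_subE -h2.
    - apply: continuous_subspaceT; apply: sub_cont.
      rewrite (_ : (fun _ => _) = set_val); first exact: set_val_continuous.
      by apply/funext => y; rewrite mk_subE iK.
  (* Points of the sheet below level [eps] are pushed away from the double point to that level, the
     others are fixed; this retracts the punctured sphere onto the image of [A]. *)
  pose push y := v0 + Num.max 1 (eps / nu y) *: (SQ (h y) - v0).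
  pose r y := if pselect (YS y) then push y else SQ (h y).
  have far y : eps <= nu y -> push y = SQ (h y).
    move=> e; rewrite /push max_l ?scale1r; first by rewrite addrC subrK.
    by rewrite ler_pdivrMr ?mul1r // (lt_le_trans eps0).
  have rS y : YS y -> r y = push y by rewrite /r; case: pselect.
  have rN y : YN y -> r y = SQ (h y).
    by move=> yN; rewrite /r; case: pselect => // yS; rewrite far // ltW //; exact: overlap'.
  have rA (y : U) : (SQ @` A) (r (set_val y)).
    have yS := set_valP y : set_val y <> S; rewrite /r; case: pselect => [/= yYS|/= ny]; last first.
      by apply/AE; exists (set_val y) => //; left; case: (cov (set_val y)).
    have [le|lt] := leP eps (nu (set_val y)).
      by rewrite far //; apply/AE; exists (set_val y) => //; right.
    have [z zZ zy] := yYS; have [s [sss sa sz]] := (PSP _).1 zZ.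
    have yp : 0 < nu (set_val y) by apply: nu0 => // e; apply: NYS; rewrite -e.
    have za : W z <> a by move=> /Winj e; apply: yS; rewrite -zy e.
    have sx := conicP s eps sss eps1 sa eps0 _ sz za; rewrite nW zy in sx.
    have [z' z'm] := inW _ _ sss sx.
    have nz' : nu (ka z') = eps.
      by rewrite -nW z'm nnl ?divr_ge0 ?ltW // nW zy divfK // gt_eqF.
    apply/AE; exists (ka z').
      right; split; last by rewrite /= nz'.
      by exists z' => //; apply/PSP; exists s; rewrite z'm.
    rewrite hk -Wr z'm /push max_r; last by rewrite ler_pdivlMr // mul1r ltW.
    by rewrite linearD linearZ /= linearB /= !Wr -zy hk.
  have cr : continuous (fun y : U => r (set_val y)).
    have cU : continuous (set_val : U -> sphere R 2) by exact: set_val_continuous.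
    apply/continuous_subspace_setT.
    have -> : [set: U] = set_val @^-1` YS `|` set_val @^-1` YN.
      by apply/seteqP; split=> // y _; have [?|?] := cov (set_val y); [left|right].
    apply: withinU_continuous; try exact: (closed_pre cU).
    - apply: (@subspace_eq_continuous _ _ _ (fun y : U => push (set_val y))).
        by move=> y; rewrite inE => yS; exact: esym (rS _ yS).
      apply/within_near => y yYS C kC.
      have yS := set_valP y : set_val y <> S.
      have yp : 0 < nu (set_val y) by apply: nu0 => // e; apply: NYS; rewrite -e.
      have c1 : {for y, continuous (fun y : U => nu (set_val y))} by exact: (cont_comp cU cnu).
      have c2 : {for y, continuous (fun y : U => SQ (h (set_val y)))}.
        exact: (cont_comp cU (cont_comp ch (@chart_cont _ _ SQ))).
      have c3 : {for y, continuous (fun y : U => eps / nu (set_val y))}.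
        by apply: contM; [exact: contC|apply: contV => //; rewrite gt_eqF].
      have c4 : {for y, continuous (fun y : U => Num.max 1 (eps / nu (set_val y)))}.
        rewrite (_ : (fun _ => _) = (fun y : U => (1 + eps / nu (set_val y) + `|1 - eps / nu (set_val y)|) / 2)).
          by cont_tac.
        by apply/funext => w; rewrite maxr_absE.
      have c5 : {for y, continuous (fun y : U => push (set_val y))} by rewrite /push; cont_tac.
      by apply: near_imp (c5 C kC).
    - apply: (@subspace_eq_continuous _ _ _ (fun y : U => SQ (h (set_val y)))).
        by move=> y; rewrite inE => yN; exact: esym (rN _ yN).
      by apply: continuous_subspaceT; exact: (cont_comp cU (cont_comp ch (@chart_cont _ _ SQ))).
  apply: (contractible_retract ci (sub_cont (f := fun y => mk_sub (rA y)) cr)).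
    move=> x; apply: set_val_inj; rewrite mk_subE mk_subE; have [yA yx] := iyP x.
    rewrite /r; case: pselect => //= yS; rewrite far //; case: yA => [yN|[] //].
    by rewrite ltW //; exact: overlap'.
  exact: punctured_sphere_contractible.
exists A, B; split=> //; split=> //; exact: H1_contractible.
Qed.

End ExceptionalSplitting.

Theorem mainTheorem1 (R : realType) (n : nat) (p : 'I_n.+1 -> circle R)
    (f : circle R -> bouquet p)
    (f_attaching : attaching_map f) (f_taut : taut f)
    (f_unexposed : unexposed f)
    (SD : pl_structure R (disk R)) (SJ : pl_structure R (bouquet p))
    (SQ : pl_structure R (one_relator_complex f))
    (f_pl : pl_compatible SD SJ SQ) :
  (finitely_unsplittable SQ <-> ~ exceptional f) /\
  (exceptional f ->
     exists a b : sphere R 2, a <> b /\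
       homeomorphic (one_relator_complex f) (pair_identified a b)).
Proof.
have [fc _] := f_attaching; have [_ plq _ _ polyP] := f_pl.
have [x0 fx0] := zero_exists f_attaching f_taut f_unexposed.
have [t0 t0x] := ce_surj x0; rewrite -t0x in fx0.
have [M [th [io [o [be [A _]]]]]] := arc_seq_exists f_attaching f_taut fx0.
have fs := f_surj f_unexposed A.
(* The exceptional case is read off the arcs: [n] is the number of petals less one, and [M] the
   number of zeros of [f]. *)
have shapeP : exceptional f <-> [/\ n = 0%N, M = 2%N & o 0%N <> o 1%N].
  split=> [[[n0] two nh]|[n0 M2 oo]].
    have M2 : M = 2%N.
      by apply/esym/card_eq_II; apply: card_eq_trans (zeros_card A); rewrite card_eq_sym.
    by split=> //; exact: (null_homotopic_shape A n0 M2 nh).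
  split; first by rewrite n0.
    by have := zeros_card A; rewrite M2.
  exact: (shape_null_homotopic A n0 M2 oo).
have haus : hausdorff_space (one_relator_complex f) by exact: chart_hausdorff SQ.
split; last by move=> /shapeP [n0 M2 oo]; rewrite M2 in A; exact: shape_sphere A n0 oo fs haus.
split=> [uns /shapeP[n0 M2 oo]|nex spl].
  rewrite M2 in A; have [ka [N [S [cka kas NS fiber uniq]]]] := fold_sphere A n0 oo.
  apply: uns; apply: (sphere_quotient_splittable _ _ plq cka kas NS fiber uniq).
    exact: q_cont.
  exact: q_surj.
by apply: nex; apply/shapeP; exact: (splittable_shape f_attaching f_unexposed polyP A spl).
Qed.
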